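(* Assume Assumption 1. If $\hat w$ is a weak minimum of problem (P), then $$\max_{\lambda\in\Lambda}\Omega[\lambda](z,v)\ge0\qquad\text{for all }(z,v)\in\mathcal C_2 .$$
   Context: Standing setting. Fix $T>0$, integers $n,m\ge1$, $d_\varphi,d_\eta\ge0$ and $x_0\in\mathbb R^n$. Write $\mathcal U:=L_\infty(0,T;\mathbb R^m)$, $\mathcal X:=W^1_\infty(0,T;\mathbb R^n)$, and for $1\le p\le\infty$, $\mathcal U_p:=L_p(0,T;\mathbb R^m)$, $\mathcal X_p:=W^1_p(0,T;\mathbb R^n)$. Let $f_0,\dots,f_m:\mathbb R^n\to\mathbb R^n$ be $C^2$ and $\varphi_0,\dots,\varphi_{d_\varphi},\eta_1,\dots,\eta_{d_\eta}:\mathbb R^n\to\mathbb R$ twice differentiable. Problem (P): minimize $\varphi_0(x(T))$ over $(x,u)\in\mathcal X\times\mathcal U$ subject to $\dot x(t)=\sum_{i=0}^m u_i(t)f_i(x(t))$ a.e. (with $u_0\equiv1$), $x(0)=x_0$; $u(t)\ge0$ componentwise a.e.; $\varphi_i(x(T))\le0$ ($1\le i\le d_\varphi$); $\eta_j(x(T))=0$ ($1\le j\le d_\eta$). A point satisfying all these is feasible. $\hat w=(\hat x,\hat u)$ is a fixed feasible point with $\varphi_i(\hat x(T))=0$ for all $i=0,\dots,d_\varphi$. $\hat w$ is a weak minimum if there is $\varepsilon>0$ such that $\varphi_0(\hat x(T))\le\varphi_0(x(T))$ for every feasible $(x,u)$ with $\|x-\hat x\|_\infty<\varepsilon$ and $\|u-\hat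 u\|_\infty<\varepsilon$. Multipliers. For $\alpha\in\mathbb R^{d_\varphi+1}$, $\beta\in\mathbb R^{d_\eta}$ and Lipschitz $\psi:[0,T]\to\mathbb R^{n,*}$ (row vectors), put $\lambda=(\alpha,\beta,\psi)$, $H[\lambda](x,u,t):=\psi(t)\sum_{i=0}^m u_if_i(x)$, $\ell[\lambda](q):=\sum_{i=0}^{d_\varphi}\alpha_i\varphi_i(q)+\sum_{j=1}^{d_\eta}\beta_j\eta_j(q)$. Derivatives of $H[\lambda]$ written without arguments are evaluated at $(\hat x(t),\hat u(t),t)$. $\Lambda$ is the set of $\lambda$ with $|\alpha|+|\beta|=1$, $\alpha\ge0$, $-\dot\psi(t)=H_x[\lambda](t)$ a.e., $\psi(T)=\ell'[\lambda](\hat x(T))$, and $H[\lambda](\hat x(t),\hat u(t),t)=\min_{v\in\mathbb R^m_+}H[\lambda](\hat x(t),v,t)$ for a.e. $t$. Active sets. For $i=1,\dots,m$: $I_0^i:=\{t\in[0,T]:\max_{\lambda\in\Lambda}H_{u_i}[\lambda](t)>0\}$, $I_+^i:=[0,T]\setminus I_0^i$. Assumption 1: for each $i$, $I_0^i=\{t:\hat u_i(t)=0\}$ up to a null set. Linearization. $A(t):=\sum_{i=0}^m\hat u_i(t)f_i'(\hat x(t))$, $B(t)v:=\sum_{i=1}^m v_if_i(\hat x(t))$. (LE): $\dot z=Az+Bv$ a.e., $z(0)=0$. (LC): $\varphi_i'(\hat x(T))z(T)\le0$ for $i=0,\dots,d_\varphi$, $\eta_j'(\hat x(T))z(T)=0$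 for $j=1,\dots,d_\eta$. $\mathcal C_2:=\{(z,v)\in\mathcal X_2\times\mathcal U_2:\ v_i=0\text{ a.e. on }I_0^i\ (i=1,\dots,m),\ \text{(LE), (LC) hold}\}$. Second variation: $\Omega[\lambda](z,v):=\tfrac12\ell''[\lambda](\hat x(T))(z(T),z(T))+\tfrac12\int_0^T\big[(H_{xx}[\lambda](t)z,z)+2(H_{ux}[\lambda](t)z,v)\big]dt$. *)

(* Defs.v *)
From HB Require Import structures.
From mathcomp Require Import all_boot all_order all_algebra.
From mathcomp Require Import all_classical all_reals all_analysis.
Set Implicit Arguments. Unset Strict Implicit. Unset Printing Implicit Defensive.
Import Order.TTheory GRing.Theory Num.Theory.
Import numFieldNormedType.Exports.
Local Open Scope classical_set_scope.
Local Open Scope ring_scope.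

Section Spaces.
Context {R : realType}.
Local Notation leb := (@lebesgue_measure R).

Definition ae_on (T : R) (P : R -> Prop) : Prop :=
  {ae leb, forall t, `[0, T]%classic t -> P t}.

Definition Linf (T : R) (g : R -> R) : Prop :=
  measurable_fun `[0, T]%classic g /\ exists M : R, ae_on T (fun t => `|g t| <= M).
Definition L2 (T : R) (g : R -> R) : Prop :=
  measurable_fun `[0, T]%classic g /\ leb.-integrable `[0, T]%classic (fun t => (g t ^+ 2)%:E).

Definition Linf_vec k (T : R) (g : R -> 'rV[R]_k) : Prop :=
  forall i, Linf T (fun t => g t 0 i).
Definition L2_vec k (T : R) (g : R -> 'rV[R]_k) : Prop :=
  forall i, L2 T (fun t => g t 0 i).

(* y is the (a.e./weak) derivative of x on [0,T]:
   y integrable and x(t) = x(0) + int_0^t y for all t in [0,T] *)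
Definition is_deriv k (T : R) (x y : R -> 'rV[R]_k) : Prop :=
  (forall i, leb.-integrable `[0, T]%classic (fun t => (y t 0 i)%:E)) /\
  forall t, `[0, T]%classic t -> forall i,
    x t 0 i = x 0 0 i + \int[leb]_(s in `[0, t]%classic) y s 0 i.

Definition dot k (a b : 'rV[R]_k) : R := \sum_(j < k) a 0 j * b 0 j.

Definition is_C2 k l (g : 'rV[R]_k -> 'rV[R]_l) : Prop :=
  (forall x, differentiable g x) /\
  (forall v x, differentiable ('D_v g) x) /\
  (forall v w, continuous ('D_w ('D_v g))).

Definition twice_diff k (g : 'rV[R]_k -> R) : Prop :=
  (forall x, differentiable g x) /\ (forall v x, differentiable ('D_v g) x).

End Spaces.

Section Problem.
Context {R : realType}.
Local Notation leb := (@lebesgue_measure R).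
Variables (n m : nat) (T : R) (x0 : 'rV[R]_n).
Variables (f0 : 'rV[R]_n -> 'rV[R]_n) (f : 'I_m -> 'rV[R]_n -> 'rV[R]_n).
Variables (dphi deta : nat) (phi : 'I_dphi.+1 -> 'rV[R]_n -> R)
          (eta : 'I_deta -> 'rV[R]_n -> R).

(* right-hand side  sum_{i=0}^m u_i f_i(x) with u_0 = 1 *)
Definition dyn (x : 'rV[R]_n) (u : 'rV[R]_m) : 'rV[R]_n :=
  f0 x + \sum_(i < m) u 0 i *: f i x.

(* feasible points of (P): x in W^1_infty, u in L_infty *)
Definition feasible (x : R -> 'rV[R]_n) (u : R -> 'rV[R]_m) : Prop :=
  Linf_vec T u /\
  (exists y, is_deriv T x y /\ Linf_vec T y /\
     ae_on T (fun t => y t = dyn (x t) (u t))) /\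
  x 0 = x0 /\
  ae_on T (fun t => forall i, 0 <= u t 0 i) /\
  (forall i : 'I_dphi.+1, i != ord0 -> phi i (x T) <= 0) /\
  (forall j, eta j (x T) = 0).

(* weak minimum: ||x - xh||_infty < eps and ||u - uh||_infty < eps *)
Definition weak_min (xh : R -> 'rV[R]_n) (uh : R -> 'rV[R]_m) : Prop :=
  exists eps : R, 0 < eps /\
    forall x u, feasible x u ->
      (forall t, `[0, T]%classic t -> `|x t - xh t| < eps) ->
      (exists d : R, d < eps /\ ae_on T (fun t => `|u t - uh t| <= d)) ->
      phi ord0 (xh T) <= phi ord0 (x T).

Record mult := Mult {
  alpha : 'I_dphi.+1 -> R;
  beta : 'I_deta -> R;
  psi : R -> 'rV[R]_n }.

Variables (xh : R -> 'rV[R]_n) (uh : R -> 'rV[R]_m).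

Definition Aop (t : R) (z : 'rV[R]_n) : 'rV[R]_n :=
  'D_z f0 (xh t) + \sum_(i < m) uh t 0 i *: 'D_z (f i) (xh t).
Definition Bop (t : R) (v : 'rV[R]_m) : 'rV[R]_n :=
  \sum_(i < m) v 0 i *: f i (xh t).

Definition Ham (lam : mult) (x : 'rV[R]_n) (v : 'rV[R]_m) (t : R) : R :=
  dot (psi lam t) (dyn x v).
Definition Hx (lam : mult) (t : R) : 'rV[R]_n :=
  \row_k dot (psi lam t) (Aop t (delta_mx 0 k)).
Definition Hu (lam : mult) (i : 'I_m) (t : R) : R :=
  dot (psi lam t) (f i (xh t)).

Definition ell (lam : mult) (q : 'rV[R]_n) : R :=
  \sum_(i < dphi.+1) alpha lam i * phi i q + \sum_(j < deta) beta lam j * eta j q.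
Definition ell' (lam : mult) (q : 'rV[R]_n) : 'rV[R]_n :=
  \row_k 'D_(delta_mx 0 k) (ell lam) q.

Definition in_Lambda (lam : mult) : Prop :=
  \sum_(i < dphi.+1) `|alpha lam i| + \sum_(j < deta) `|beta lam j| = 1 /\
  (forall i, 0 <= alpha lam i) /\
  (exists L : R, forall s t, `[0, T]%classic s -> `[0, T]%classic t ->
      `|psi lam s - psi lam t| <= L * `|s - t|) /\
  (exists y, is_deriv T (psi lam) y /\ ae_on T (fun t => y t = - Hx lam t)) /\
  psi lam T = ell' lam (xh T) /\
  ae_on T (fun t => forall v : 'rV[R]_m, (forall i, 0 <= v 0 i) ->
              Ham lam (xh t) (uh t) t <= Ham lam (xh t) v t).

Definition I0 (i : 'I_m) : set R :=
  [set t | `[0, T]%classic t /\ exists lam, in_Lambda lam /\ 0 < Hu lam i t].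

Definition Assumption1 : Prop :=
  forall i, ae_on T (fun t => I0 i t <-> uh t 0 i = 0).

Definition C2cone (z : R -> 'rV[R]_n) (v : R -> 'rV[R]_m) : Prop :=
  (exists y, is_deriv T z y /\ L2_vec T y /\
     ae_on T (fun t => y t = Aop t (z t) + Bop t (v t))) /\
  L2_vec T v /\
  z 0 = 0 /\
  (forall i, ae_on T (fun t => I0 i t -> v t 0 i = 0)) /\
  (forall i : 'I_dphi.+1, 'D_(z T) (phi i) (xh T) <= 0) /\
  (forall j, 'D_(z T) (eta j) (xh T) = 0).

Definition Hxx (lam : mult) (t : R) (z : 'rV[R]_n) : R :=
  dot (psi lam t) ('D_z ('D_z f0) (xh t)
                   + \sum_(i < m) uh t 0 i *: 'D_z ('D_z (f i)) (xh t)).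
Definition Hux (lam : mult) (t : R) (z : 'rV[R]_n) (v : 'rV[R]_m) : R :=
  \sum_(i < m) v 0 i * dot (psi lam t) ('D_z (f i) (xh t)).

Definition Omega (lam : mult) (z : R -> 'rV[R]_n) (v : R -> 'rV[R]_m) : R :=
  2^-1 * 'D_(z T) ('D_(z T) (ell lam)) (xh T)
  + 2^-1 * \int[leb]_(t in `[0, T]%classic) (Hxx lam t (z t) + 2 * Hux lam t (z t) (v t)).

End Problem.

(* Main.v *)
Require Import Defs.
From HB Require Import structures.
From mathcomp Require Import all_boot all_order all_algebra.
From mathcomp Require Import all_classical all_reals all_analysis.
From mathcomp Require Import measurable_realfun ring lra.
Set Implicit Arguments. Unset Strict Implicit. Unset Printing Implicit Defensive.
Import Order.TTheory GRing.Theory Num.Theory.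
Import numFieldNormedType.Exports.
Local Open Scope classical_set_scope.
Local Open Scope ring_scope.

(** The optimality conditions are read off from the endpoint x(T) alone.  Let Y(g) be the endpoint of
    the solution of the linearized equation with source g, written with the fundamental solutions of
    the adjoint equation, and let q be Y of the second-order terms along (z, v).  For controls
    u + e w + e^2 r, with w close to v in L^1 and Y(w) = z(T), the endpoint is
        x(T) + e z(T) + e^2 (q + Y(r)) + o(e^2),
    and its dependence on r is, up to o(e^2), that of e^2 Y(r); the variations r run over the bounded
    ones with r_i >= - K u_i, so that u + e w + e^2 r remains nonnegative when |w_i| <= K u_i.
    If the eta' Y(r) do not span R^d_eta, some beta <> 0 annihilates them and (0, beta) or (0, -beta) is
    the multiplier wanted.  Otherwise, let c and d collect the second-order terms along q and z of the
    phi_i and the eta_j.  If some Y(r), robustly, makes every entry of c + phi' Y(r) negative and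
    d + eta' Y(r) zero, then the nonlinear equality constraints can be solved by a contraction, which
    contradicts minimality.  If there is no such r, a hyperplane separates, and its normal (alpha, beta)
    is a multiplier: its nonnegativity on the cone of the r says that H_{u_i} >= 0 and u_i H_{u_i} = 0,
    the minimum condition, while the remaining inequality is alpha c + beta d = Omega >= 0. *)

(** * Primitives of integrable functions on [[0, T]] *)

Section Integrals.
Context {R : realType} (T : R).
Local Notation leb := (@lebesgue_measure R).
Local Notation I0T := (`[0, T]%classic : set R).

(** Four obstacles shape the argument. The direction [v] is only square integrable, so [u + e v]
    need not be admissible even though [v] vanishes where [u] does. It is clipped to
    [|w_i| <= K u_i]; clipping alone would spoil the endpoint at order [e], so a finite-rank
    correction restores [Y(w) = z(T)] exactly. The bound of [w] may blow up as [w] approaches [v]: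
    the error constant of the endpoint expansion must not depend on it, and the accuracy [k] is
    fixed before [w], and [w] before [e]. The [phi_i] and [eta_j] have second derivatives with no
    continuity, so they admit Peano expansions and strict differentiability at the endpoint; the
    latter is what a contraction asks for. The cone of the [r] need not be closed, so separation
    works with strict inequalities, from which the wanted ones follow as limits. Robustness of
    [Y(r)] means that it contains, with positive coefficients, finitely many vectors whose images
    under [eta'] span: these coefficients may move both ways without leaving the cone. *)

Definition integ (g : R -> R) : Prop := leb.-integrable I0T (EFin \o g).

(** Bounded at every point rather than almost everywhere, so that the estimates along trajectories
    are pointwise; the given control is replaced by such a representative in
    [essbounded_nonneg_repr]. *)
Definition bmeas (g : R -> R) : Prop :=
  measurable_fun I0T g /\ exists M : R, forall t, I0T t -> `|g t| <= M.

Definition contT (V : topologicalType) (x : R -> V) : Prop :=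
  {within I0T, continuous x}.

Lemma leb_itv_lty (a b : R) : (leb `[a, b]%classic < +oo)%E.
Proof. by rewrite lebesgue_measure_itv/=; case: ifP => _; rewrite ?ltry// -EFinB ltry. Qed.

Lemma bmeas_integ g : bmeas g -> integ g.
Proof.
move=> [mg [M gM]]; apply: measurable_bounded_integrable => //.
  exact: leb_itv_lty.
exists M; split; first exact: num_real.
by move=> y My t /= tT; rewrite (le_trans (gM _ tT)) ?ltW.
Qed.

Lemma bmeas_ext g h : (forall t, I0T t -> g t = h t) -> bmeas g -> bmeas h.
Proof.
move=> gh [mg [M gM]]; split; last by exists M => t tT; rewrite -gh ?gM.
by apply: eq_measurable_fun mg => t; rewrite inE => /gh.
Qed.

Lemma bmeas_cst (c : R) : bmeas (fun=> c).
Proof. by split; [exact: measurable_cst | exists `|c|]. Qed.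

Lemma bmeasD g h : bmeas g -> bmeas h -> bmeas (fun t => g t + h t).
Proof.
move=> [mg [M gM]] [mh [N hN]]; split; first exact: measurable_funD.
by exists (M + N) => t tT; rewrite (le_trans (ler_normD _ _)) ?lerD ?gM ?hN.
Qed.

Lemma bmeasM g h : bmeas g -> bmeas h -> bmeas (fun t => g t * h t).
Proof.
move=> [mg [M gM]] [mh [N hN]]; split; first exact: measurable_funM.
by exists (M * N) => t tT; rewrite normrM ler_pM ?gM ?hN.
Qed.

Lemma bmeasN g : bmeas g -> bmeas (fun t => - g t).
Proof.
move=> bg; apply: (bmeas_ext (g := fun t => (-1) * g t)).
  by move=> t _; rewrite mulN1r.
exact: bmeasM (bmeas_cst _) bg.
Qed.

Lemma bmeasB g h : bmeas g -> bmeas h -> bmeas (fun t => g t - h t).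
Proof. by move=> bg bh; apply: bmeasD => //; apply: bmeasN. Qed.

Lemma bmeas_sum (I : Type) (s : seq I) (g : I -> R -> R) :
  (forall i, bmeas (g i)) -> bmeas (fun t => \sum_(i <- s) g i t).
Proof.
move=> bg; elim: s => [|i s IH].
  by apply: (bmeas_ext (g := fun=> 0)); [move=> t _; rewrite big_nil | exact: bmeas_cst].
apply: (bmeas_ext (g := fun t => g i t + \sum_(i <- s) g i t)).
  by move=> t _; rewrite big_cons.
exact: bmeasD.
Qed.

Lemma contT_bmeas (g : R -> R) : contT g -> bmeas g.
Proof.
move=> cg; split; first exact: subspace_continuous_measurable_fun.
have /compact_bounded[M [_ Mg]] := continuous_compact cg (@segment_compact _ 0 T).
exists (M + 1) => t tT; apply: (Mg (M + 1)); last by exists t.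
by rewrite ltrDl.
Qed.

Lemma integ_ext g h : (forall t, I0T t -> g t = h t) -> integ g -> integ h.
Proof.
move=> gh; apply: eq_integrable => //= t; rewrite inE => tT.
by rewrite gh.
Qed.

Lemma integD g h : integ g -> integ h -> integ (fun t => g t + h t).
Proof.
move=> ig ih; have := @integrableD _ _ _ leb I0T (measurable_itv _) _ _ ig ih.
by apply: eq_integrable => // t _; rewrite /= EFinD.
Qed.

Lemma integ_meas g : integ g -> measurable_fun I0T g.
Proof. by move=> /integrableP[mg _]; apply/measurable_EFinP. Qed.

Lemma integMl h g : bmeas h -> integ g -> integ (fun t => h t * g t).
Proof.
move=> [mh [M hM]] ig.
have := @integrableMr _ _ _ leb I0T (measurable_itv _) h (EFin \o g) mh.
apply => //; exists M; split; first exact: num_real.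
by move=> y My t /= tT; rewrite (le_trans (hM _ tT)) ?ltW.
Qed.

Lemma integMr h g : bmeas h -> integ g -> integ (fun t => g t * h t).
Proof.
by move=> bh ig; apply: integ_ext (integMl bh ig) => t _; rewrite mulrC.
Qed.

Lemma integZ (c : R) g : integ g -> integ (fun t => c * g t).
Proof. exact: integMl (bmeas_cst c). Qed.

Lemma integN g : integ g -> integ (fun t => - g t).
Proof.
by move=> ig; apply: integ_ext (integZ (-1) ig) => t _; rewrite mulN1r.
Qed.

Lemma integB g h : integ g -> integ h -> integ (fun t => g t - h t).
Proof. by move=> ig ih; apply: integD => //; apply: integN. Qed.

Lemma integ_sum (I : Type) (s : seq I) (g : I -> R -> R) :
  (forall i, integ (g i)) -> integ (fun t => \sum_(i <- s) g i t).
Proof.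
move=> bg; elim: s => [|i s IH].
  apply: (integ_ext (g := fun=> 0)); first by move=> t _; rewrite big_nil.
  exact: bmeas_integ (bmeas_cst 0).
apply: (integ_ext (g := fun t => g i t + \sum_(i <- s) g i t)).
  by move=> t _; rewrite big_cons.
exact: integD.
Qed.

Lemma integ_norm g : integ g -> integ (fun t => `|g t|).
Proof. exact: integrable_norm. Qed.

Lemma integ_le (g h : R -> R) : measurable_fun I0T g -> integ h ->
  (forall t, I0T t -> `|g t| <= h t) -> integ g.
Proof.
move=> mg ih gh.
apply: (@le_integrable _ _ _ leb I0T (measurable_itv _) _ (EFin \o h)) => //.
  exact/measurable_EFinP.
by move=> t tT; rewrite /= lee_fin (le_trans (gh _ tT))// ler_norm.
Qed.

Lemma I0T_le t : I0T t -> 0 <= t <= T.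
Proof. by rewrite /= in_itv. Qed.

Lemma integ_sub t (g : R -> R) : t <= T -> integ g -> leb.-integrable `[0, t]%classic (EFin \o g).
Proof.
move=> tT; apply: integrableS => //.
by apply: subset_itvl; rewrite bnd_simp.
Qed.

Lemma prim_diff (g : R -> R) s t : integ g -> 0 <= s -> s <= t -> t <= T ->
  \int[leb]_(r in `[0, t]) g r - \int[leb]_(r in `[0, s]) g r =
  \int[leb]_(r in `]s, t]) g r.
Proof.
move=> ig s0 st tT; apply: Rintegral_itvB; first exact: integ_sub.
  by rewrite bnd_simp.
by rewrite bnd_simp.
Qed.

Lemma integ_subo s t (g : R -> R) : 0 <= s -> t <= T -> integ g ->
  leb.-integrable `]s, t]%classic (EFin \o g).
Proof.
move=> s0 tT; apply: integrableS => //.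
by apply: subset_itv; rewrite bnd_simp.
Qed.

Lemma prim_cont g : 0 <= T -> integ g -> contT (fun t => \int[leb]_(s in `[0, t]) g s).
Proof. by move=> T0 ig; exact: parameterized_integral_continuous. Qed.

End Integrals.

(** * Gronwall's inequality *)

Section Gronwall.
Context {R : realType} (T : R).
Local Notation leb := (@lebesgue_measure R).
Local Notation I0T := (`[0, T]%classic : set R).

Lemma int_expR (c t : R) : 0 < c -> 0 <= t ->
  \int[leb]_(s in `[0, t]) expR (c * s) = (expR (c * t) - 1) / c.
Proof.
move=> c0; rewrite le_eqVlt => /predU1P[<-|t0].
  by rewrite set_itv1 Rintegral_set1 mulr0 expR0 subrr mul0r.
have dE (x : R) : is_derive x (1 : R) (fun s : R => expR (c * s) / c) (expR (c * x)).
  apply: is_derive_eq; rewrite /GRing.scale/=.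
  by field; rewrite gt_eqF.
have cE : continuous (fun s : R => expR (c * s) / c).
  move=> x; apply/differentiable_continuous/derivable1_diffP.
  by case: (dE x).
rewrite /Rintegral (@continuous_FTC2 _ _ (fun s => expR (c * s) / c))//.
- by rewrite mulr0 expR0 -EFinB/= mulrBl.
- apply: continuous_subspaceT => x.
  apply: (@continuous_comp _ _ _ (fun s => c * s) expR); last exact: continuous_expR.
  exact: mulrl_continuous.
- split; first by move=> x _; case: (dE x).
    by apply: cvg_at_right_filter; exact: cE.
  by apply: cvg_at_left_filter; exact: cE.
- by move=> x _; rewrite derive1E; case: (dE x) => _ ->.
Qed.

Lemma contTM (g h : R -> R) : contT T g -> contT T h -> contT T (fun t => g t * h t).
Proof. by move=> cg ch t; apply: (continuousM (cg t) (ch t)). Qed.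

Lemma contTD (V : normedModType R) (g h : R -> V) :
  contT T g -> contT T h -> contT T (fun t => g t + h t).
Proof. by move=> cg ch t; apply: (continuousD (cg t) (ch t)). Qed.

Lemma contTB (V : normedModType R) (g h : R -> V) :
  contT T g -> contT T h -> contT T (fun t => g t - h t).
Proof. by move=> cg ch t; apply: (continuousB (cg t) (ch t)). Qed.

Lemma contT_cst (V : topologicalType) (c : V) : contT T (fun=> c).
Proof. by apply: continuous_subspaceT => x; exact: cst_continuous. Qed.

Lemma contT_expR (c : R) : contT T (fun t => expR (c * t)).
Proof.
apply: continuous_subspaceT => x.
apply: (@continuous_comp _ _ _ (fun s => c * s) expR); last exact: continuous_expR.
exact: mulrl_continuous.
Qed.

(** The weighted function [e(t) exp(-2Lt)] attains its maximum [S] on the compact interval. At the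
    maximizer the weight integrates to [(E - 1) / (2L)], so the integral term is at most half of
    [S E] and can be absorbed. *)
Lemma gronwall (e : R -> R) (c L : R) : 0 <= T -> 0 <= c -> 0 < L ->
  contT T e ->
  (forall t, I0T t -> e t <= c + L * \int[leb]_(s in `[0, t]) e s) ->
  forall t, I0T t -> e t <= 2 * c * expR (2 * L * T).
Proof.
move=> T0 c0 L0 ce He.
have L20 : 0 < 2 * L by rewrite mulr_gt0.
pose w t := e t * expR (- (2 * L * t)).
have cw : contT T w.
  by rewrite /w; under eq_fun do rewrite -mulNr; exact/contTM/contT_expR.
have [t0 t0T tmax] := EVT_max T0 cw.
set S := w t0 in tmax.
have eS s : I0T s -> e s <= S * expR (2 * L * s).
  move=> sT; have := tmax s sT; rewrite /w expRN ler_pdivrMr ?expR_gt0//.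
have S2c : S <= 2 * c.
  have [S0|S0] := leP S 0; first by rewrite (le_trans S0)// mulr_ge0.
  have /andP[t00 t0T'] : 0 <= t0 <= T by move: t0T; rewrite in_itv.
  have ie : integ T e by apply/bmeas_integ/contT_bmeas.
  have iE : integ T (fun s => S * expR (2 * L * s)).
    by apply/bmeas_integ/contT_bmeas/contTM; [exact: contT_cst|exact: contT_expR].
  have iE1 : leb.-integrable `[0, t0]%classic (EFin \o (fun s => expR (2 * L * s))).
    apply: (@integ_sub _ T) => //.
    exact/bmeas_integ/contT_bmeas/contT_expR.
  have : \int[leb]_(s in `[0, t0]) e s <= S * ((expR (2 * L * t0) - 1) / (2 * L)).
    rewrite -int_expR// -RintegralZl//.
    apply: le_Rintegral => //.
    - exact: integ_sub ie.
    - exact: integ_sub iE.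
    - move=> s /=; rewrite in_itv/= => /andP[s0 st]; apply: eS.
      by rewrite /= in_itv/= s0 (le_trans st).
  move=> I1; have := He _ t0T.
  have -> : e t0 = S * expR (2 * L * t0).
    by rewrite /S /w -mulrA -expRD addNr expR0 mulr1.
  have E1 : 1 <= expR (2 * L * t0) by rewrite -[leLHS]expR0 ler_expR mulr_ge0// ltW.
  move: I1; set I := Rintegral _ _ _; set E := expR _ in E1 * => I1 H.
  have H2 : S * E <= c + S * (E - 1) / 2.
    apply: (le_trans H); rewrite lerD2l.
    apply: (le_trans (ler_wpM2l (ltW L0) I1)).
    by rewrite le_eqVlt; apply/orP; left; apply/eqP; field; rewrite gt_eqF.
  have : S <= S * E by rewrite ler_peMr// ltW.
  by nra.
move=> t tT; have /andP[t00 t0T'] : 0 <= t <= T by move: tT; rewrite /= in_itv.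
apply: (le_trans (eS _ tT)).
(* No sign is assumed on [e], so [S] may be negative, and enlarging the exponent from [t] to [T] is
   monotone only when [S] is positive. *)
have [S0|S0] := leP S 0.
  apply: (@le_trans _ _ 0); first by rewrite mulr_le0_ge0// expR_ge0.
  by rewrite mulr_ge0 ?expR_ge0// mulr_ge0.
apply: ler_pM => //; rewrite ?expR_ge0 ?(ltW S0)//.
rewrite ler_expR ler_wpM2l//; exact: ltW.
Qed.

Definition prim (F f : R -> R) : Prop :=
  integ T f /\ forall t, I0T t -> F t = F 0 + \int[leb]_(s in `[0, t]) f s.

Lemma is_derivP k (x y : R -> 'rV[R]_k) :
  is_deriv T x y <-> forall i, prim (fun t => x t 0 i) (fun t => y t 0 i).
Proof.
split=> [[iy xy] i|H]; first by split=> [|t tT]; [exact: iy|exact: xy].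
by split=> [i|t tT i]; have [iy xy] := H i; [exact: iy|exact: xy].
Qed.

Lemma contT_ext (V : topologicalType) (x y : R -> V) :
  (forall t, I0T t -> x t = y t) -> contT T x -> contT T y.
Proof.
move=> xy; rewrite /contT; apply: subspace_eq_continuous => t; rewrite inE.
exact: xy.
Qed.

Lemma prim_contT F f : 0 <= T -> prim F f -> contT T F.
Proof.
move=> T0 [fi FE]; apply: (@contT_ext _ (fun t => F 0 + \int[leb]_(s in `[0, t]) f s)).
  by move=> t tT; rewrite [RHS]FE.
by apply: contTD; [exact: contT_cst|exact: prim_cont].
Qed.

Lemma contT_comp (U V : topologicalType) (x : R -> U) (g : U -> V) :
  continuous g -> contT T x -> contT T (fun t => g (x t)).
Proof.
by move=> cg cx t; exact: (@continuous_comp (subspace I0T) U V x g t (cx t) (cg _)).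
Qed.

Lemma contT_coord k (x : R -> 'rV[R]_k) i : contT T x -> contT T (fun t => x t 0 i).
Proof.
by apply: (@contT_comp _ _ x (fun M : 'rV[R]_k => M 0 i)); exact: coord_continuous.
Qed.

Lemma rV_norm_le k (x : 'rV[R]_k) M : 0 <= M -> (forall i, `|x 0 i| <= M) -> `|x| <= M.
Proof.
move=> M0 xM; rewrite /Num.norm/= mx_normrE; apply/bigmax_leP; split => // -[i j] _ /=.
by rewrite ord1.
Qed.

Lemma rV_norm_lt k (x : 'rV[R]_k) M : 0 < M -> (forall i, `|x 0 i| < M) -> `|x| < M.
Proof.
move=> M0 xM; rewrite /Num.norm/= mx_normrE; apply/bigmax_ltP; split => // -[i j] _ /=.
by rewrite ord1.
Qed.

Lemma rV_norm_ge k (x : 'rV[R]_k) i : `|x 0 i| <= `|x|.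
Proof.
rewrite [leRHS]/Num.norm/= mx_normrE.
exact: (@le_bigmax _ _ _ (0 : R) (fun ij : 'I_1 * 'I_k => `|x ij.1 ij.2|) (0, i)).
Qed.

Lemma coord_contT k (x : R -> 'rV[R]_k) : (forall i, contT T (fun t => x t 0 i)) -> contT T x.
Proof.
move=> cx t; apply/cvgrPdist_lt => e e0; rewrite near_map.
have H : @nbhs _ (subspace I0T) t (fun s : R => forall i, `|x t 0 i - x s 0 i| < e).
  by apply: (@filter_forall _ _ _ _ (@nbhs_filter (subspace I0T) t)) => i; have /cvgrPdist_lt/(_ e e0) := cx i t.
apply: (filterS _ H) => s {}H; apply: rV_norm_lt => // i; rewrite !mxE.
exact: H.
Qed.

Lemma is_deriv_contT k (x y : R -> 'rV[R]_k) : 0 <= T -> is_deriv T x y -> contT T x.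
Proof.
by move=> T0 /is_derivP xy; apply: coord_contT => i; apply: prim_contT (xy i).
Qed.

Lemma contT_norm k (x : R -> 'rV[R]_k) : contT T x -> contT T (fun t => `|x t|).
Proof. by apply: contT_comp; exact: norm_continuous. Qed.

Lemma Rint_le (t : R) (f g : R -> R) : I0T t -> integ T f -> integ T g ->
  (forall s, I0T s -> f s <= g s) ->
  \int[leb]_(s in `[0, t]) f s <= \int[leb]_(s in `[0, t]) g s.
Proof.
move=> /I0T_le/andP[t0 tT] fi gi fg; apply: le_Rintegral => //.
- exact: integ_sub fi.
- exact: integ_sub gi.
- move=> s /=; rewrite in_itv/= => /andP[s0 st].
  by apply: fg; rewrite /= in_itv/= s0 (le_trans st).
Qed.

Lemma Rint_norm_le (t : R) (f g : R -> R) : I0T t -> integ T f -> integ T g ->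
  (forall s, I0T s -> `|f s| <= g s) ->
  `|\int[leb]_(s in `[0, t]) f s| <= \int[leb]_(s in `[0, t]) g s.
Proof.
move=> tT fi gi fg; have /andP[t0 tT'] := I0T_le tT.
apply: (le_trans (le_normr_Rintegral _ _)) => //; first exact: integ_sub fi.
by apply: Rint_le => //; exact: integ_norm.
Qed.

Lemma Rint_mono (t : R) (g : R -> R) : I0T t -> integ T g -> (forall s, I0T s -> 0 <= g s) ->
  \int[leb]_(s in `[0, t]) g s <= \int[leb]_(s in `[0, T]) g s.
Proof.
move=> /I0T_le/andP[t0 tT] gi g0.
rewrite -subr_ge0 (prim_diff gi)//; apply: Rintegral_ge0 => s /=; rewrite in_itv/= => /andP[ts sT].
by apply: g0; rewrite /= in_itv/= sT andbT (le_trans t0)// ltW.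
Qed.

(** The source enters through its integral only. This is what lets controls that are close in the
    mean, with no uniform bound on their difference, produce uniformly close trajectories. *)
Lemma gronwall_deriv k (x y : R -> 'rV[R]_k) (g : R -> R) (L : R) :
  0 <= T -> 0 < L -> is_deriv T x y -> x 0 = 0 -> integ T g ->
  (forall t, I0T t -> 0 <= g t) ->
  (forall t, I0T t -> `|y t| <= L * `|x t| + g t) ->
  forall t, I0T t -> `|x t| <= 2 * expR (2 * L * T) * \int[leb]_(s in `[0, T]) g s.
Proof.
move=> T0 L0 xy x0 ig g0 yL.
have TT : I0T T by rewrite /= in_itv/= lexx T0.
have cx := contT_norm (is_deriv_contT T0 xy).
have ix : integ T (fun t => `|x t|) by apply/bmeas_integ/contT_bmeas.
have ig0 : 0 <= \int[leb]_(s in `[0, T]) g s by apply: Rintegral_ge0.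
move=> t tT; rewrite mulrAC.
apply: (gronwall (e := fun t => `|x t|)) => // {tT}t tT.
have /andP[t0 tT'] := I0T_le tT.
have nn (h : R -> R) : (forall s, I0T s -> 0 <= h s) -> 0 <= \int[leb]_(s in `[0, t]) h s.
  move=> h0; apply: Rintegral_ge0 => s /=; rewrite in_itv/= => /andP[s0 st].
  by apply: h0; rewrite /= in_itv/= s0 (le_trans st).
apply: rV_norm_le => [|i].
  by rewrite addr_ge0// mulr_ge0 ?(ltW L0)//; apply: (nn (fun s => `|x s|)).
have /is_derivP/(_ i)[iy ->] := xy => //.
rewrite x0 mxE add0r.
apply: (@le_trans _ _ (\int[leb]_(s in `[0, t]) (L * `|x s| + g s))).
  apply: Rint_norm_le => //.
    by apply: integD => //; exact: integZ.
  by move=> s sT; rewrite (le_trans _ (yL _ sT))// rV_norm_ge.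
rewrite RintegralD//; last 2 first.
- exact: (integ_sub tT' (integZ L ix)).
- exact: (integ_sub tT' ig).
rewrite RintegralZl//; last exact: integ_sub ix.
by rewrite addrC lerD2r Rint_mono.
Qed.

End Gronwall.

(** * Integration by parts *)

Section Product.
Context {R : realType} (T : R).
Local Notation leb := (@lebesgue_measure R).
Local Notation I0T := (`[0, T]%classic : set R).

(* Over N equal pieces the increments of D add up to at most [C * (T / N) * K T]. *)
Lemma telescope_const (D K : R -> R) (C : R) : 0 < T -> K 0 = 0 ->
  (forall s t, 0 <= s -> s <= t -> t <= T -> `|D t - D s| <= C * (t - s) * (K t - K s)) ->
  D T = D 0.
Proof.
move=> T0 K0 H.
have part N : (0 < N)%N -> forall k, (k <= N)%N ->
    `|D (T * k%:R / N%:R) - D 0| <= C * (T / N%:R) * K (T * k%:R / N%:R).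
  move=> N0; have Nr : 0 < N%:R :> R by rewrite ltr0n.
  elim=> [_|k IH kN]; first by rewrite mulr0 mul0r subrr K0 normr0 mulr0.
  set s := T * k%:R / N%:R; set t := T * k.+1%:R / N%:R.
  have s0 : 0 <= s by rewrite divr_ge0// mulr_ge0// ltW.
  have ts : t - s = T / N%:R.
    by rewrite /t /s -natr1 mulrDr mulr1 -mulrBl addrC addKr.
  have st : s <= t by rewrite -subr_ge0 ts divr_ge0// ltW.
  have tT : t <= T by rewrite ler_pdivrMr// ler_pM2l// ler_nat.
  have := H s t s0 st tT; have := IH (ltnW kN); rewrite -/s ts => I1 I2.
  rewrite (_ : D t - D 0 = (D t - D s) + (D s - D 0)); last by ring.
  rewrite (le_trans (ler_normD _ _))// (le_trans (lerD I2 I1))// -mulrDr.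
  by rewrite subrK.
apply/eqP; rewrite -subr_eq0 -normr_le0; apply/ler_addgt0Pl => e e0; rewrite addr0.
have [N HN] : exists N : nat, C * T * K T / e < N%:R.
  exists (Num.bound `|C * T * K T / e|).
  exact: le_lt_trans (ler_norm _) (archi_boundP (normr_ge0 _)).
have := part N.+1 isT N.+1 (leqnn _); rewrite mulfK// => /le_trans; apply.
rewrite mulrA mulrAC ler_pdivrMr// [leRHS]mulrC -ler_pdivrMr// (le_trans (ltW HN))//.
by rewrite ler_nat.
Qed.

Lemma int_oc_le (s t : R) (f g : R -> R) : 0 <= s -> t <= T -> integ T f -> integ T g ->
  (forall r, s <= r -> r <= t -> f r <= g r) ->
  \int[leb]_(r in `]s, t]) f r <= \int[leb]_(r in `]s, t]) g r.
Proof.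
move=> s0 tT fi gi fg; apply: le_Rintegral => //.
- exact: integ_subo fi.
- exact: integ_subo gi.
- by move=> r /=; rewrite in_itv/= => /andP[/ltW]; exact: fg.
Qed.

(** Nothing is differentiated pointwise. [G] is Lipschitz because [g] is bounded, and the increments
    of [F] are controlled by those of [K], the primitive of [|f|]. The defect [D] of the formula
    then has increments of order [(t - s) (K t - K s)], and [telescope_const] makes it constant. *)
Lemma prim_mul (F f G g : R -> R) : 0 < T -> prim T F f -> prim T G g -> bmeas T g ->
  F T * G T = F 0 * G 0 + \int[leb]_(t in `[0, T]) (f t * G t + F t * g t).
Proof.
move=> T0 Ff Gg bg; have [fi FE] := Ff; have [gi GE] := Gg.
have bF := contT_bmeas (prim_contT (ltW T0) Ff).
have bG := contT_bmeas (prim_contT (ltW T0) Gg).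
have [_ [M gM]] := bg.
have M0 : 0 <= M by rewrite (le_trans _ (gM 0 _))//= in_itv/= lexx ltW.
have h1 : integ T (fun t => f t * G t) by apply: integMr.
have h2 : integ T (fun t => F t * g t) by apply: integMl.
have ih := integD h1 h2.
pose D t := F t * G t - \int[leb]_(r in `[0, t]) (f r * G r + F r * g r).
pose K t := \int[leb]_(r in `[0, t]) `|f r|.
have int00 (h : R -> R) : \int[leb]_(r in `[0, 0]) h r = 0 by rewrite set_itv1 Rintegral_set1.
have inI (s t r : R) : 0 <= s -> t <= T -> s <= r -> r <= t -> I0T r.
  by move=> s0 tT sr rt; rewrite /= in_itv/= (le_trans s0)// (le_trans rt).
have GL (s t : R) : 0 <= s -> s <= t -> t <= T -> `|G t - G s| <= M * (t - s).
  move=> s0 st tT; have sT := le_trans st tT; have t0 := le_trans s0 st.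
  rewrite (GE _ (inI 0 T t _ _ _ _))// (GE _ (inI 0 T s _ _ _ _))// opprD addrACA subrr add0r (prim_diff gi)//.
  apply: (le_trans (le_normr_Rintegral _ _)) => //; first exact: integ_subo gi.
  apply: (@le_trans _ _ (\int[leb]_(r in `]s, t]) M)).
    apply: int_oc_le => //; first exact: integ_norm.
      exact/bmeas_integ/bmeas_cst.
    by move=> r sr rt; apply: gM; exact: (inI s t).
  rewrite Rintegral_cst//= lebesgue_measure_itv/= lte_fin; case: ltP => //= ts.
  by rewrite mulr0 mulr_ge0// subr_ge0.
have FL (s t : R) : 0 <= s -> s <= t -> t <= T -> `|F t - F s| <= K t - K s.
  move=> s0 st tT; have sT := le_trans st tT; have t0 := le_trans s0 st.
  rewrite (FE _ (inI 0 T t _ _ _ _))// (FE _ (inI 0 T s _ _ _ _))// opprD addrACA subrr add0r (prim_diff fi)//.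
  rewrite (prim_diff (integ_norm fi))//.
  by apply: le_normr_Rintegral => //; exact: integ_subo fi.
suff : D T = D 0 by rewrite /D int00 subr0 => <-; rewrite subrK.
apply: (telescope_const (K := K) (C := 2 * M)) => //; first exact: int00.
move=> s t s0 st tT; have sT := le_trans st tT; have t0 := le_trans s0 st.
have i1 : integ T (fun r => f r * G t + F s * g r).
  by apply: integD; [apply: integMr => //; exact: bmeas_cst|exact: integZ].
(* Writing [F t G t - F s G s] as [(F t - F s) G t + F s (G t - G s)] turns the increment of [D]
   into the integral of [f (G t - G) - (F - F s) g], in which both terms contain a small
   difference. *)
have -> : D t - D s = \int[leb]_(r in `]s, t]) ((f r * G t + F s * g r) - (f r * G r + F r * g r)).
  rewrite RintegralB//; last 2 first.
    exact: integ_subo i1.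
    exact: integ_subo ih.
  rewrite /D -(prim_diff ih)//.
  rewrite [X in _ = X - _]RintegralD//; last 2 first.
    exact: (integ_subo s0 tT (integMr (bmeas_cst T (G t)) fi)).
    exact: (integ_subo s0 tT (integZ (F s) gi)).
  rewrite RintegralZr//; last exact: integ_subo fi.
  rewrite RintegralZl//; last exact: integ_subo gi.
  rewrite -(prim_diff gi)// -(prim_diff fi)//.
  have -> : G t = G 0 + \int[leb]_(r in `[0, t]) g r by rewrite -GE//; exact: (inI 0 T).
  have -> : F t = F 0 + \int[leb]_(r in `[0, t]) f r by rewrite -FE//; exact: (inI 0 T).
  have -> : F s = F 0 + \int[leb]_(r in `[0, s]) f r by rewrite -FE//; exact: (inI 0 T).
  have -> : G s = G 0 + \int[leb]_(r in `[0, s]) g r by rewrite -GE//; exact: (inI 0 T).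
  by ring.
have i2 := integB i1 ih.
have i3 : integ T (fun r => M * (t - s) * `|f r|) by apply/integZ/integ_norm.
have i4 : integ T (fun r : R => M * (K t - K s)) by apply/bmeas_integ/bmeas_cst.
apply: (le_trans (le_normr_Rintegral _ _)) => //; first exact: integ_subo i2.
apply: (@le_trans _ _ (\int[leb]_(r in `]s, t]) (M * (t - s) * `|f r| + M * (K t - K s)))).
  apply: int_oc_le => //; [exact: integ_norm|exact: integD|move=> r sr rt].
  have -> : f r * G t + F s * g r - (f r * G r + F r * g r) =
     f r * (G t - G r) + - ((F r - F s) * g r) by ring.
  have r0 := le_trans s0 sr; have rT := le_trans rt tT.
  rewrite (le_trans (ler_normD _ _))// normrN !normrM lerD//.
    rewrite mulrC ler_pM// (le_trans (GL _ _ _ _ _))// ler_wpM2l//.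
    by rewrite lerD2l lerN2.
  rewrite mulrC ler_pM//; first by apply: gM; exact: (inI s t).
  rewrite (le_trans (FL _ _ _ _ _))// lerD2r /K.
  rewrite -subr_ge0 (prim_diff (integ_norm fi))//.
  by apply: Rintegral_ge0.
rewrite RintegralD//; last 2 first.
- exact: integ_subo i3.
- exact: integ_subo i4.
rewrite RintegralZl//; last exact: (integ_subo s0 tT (integ_norm fi)).
rewrite -(prim_diff (integ_norm fi))// -/(K t) -/(K s).
rewrite Rintegral_cst//= lebesgue_measure_itv/= lte_fin.
have -> : fine (if s < t then (t%:E - s%:E)%E else 0%E) = t - s.
  by case: ltP => //= ts; apply/esym/eqP; rewrite subr_eq0 eq_le st ts.
rewrite le_eqVlt; apply/orP; left; apply/eqP; ring.
Qed.
End Product.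

(** * Existence of solutions by Picard iteration *)

Section Picard.
Context {R : realType} (T : R).
Local Notation leb := (@lebesgue_measure R).
Local Notation I0T := (`[0, T]%classic : set R).

Lemma half_pow_small (E e : R) : 0 < e -> exists N : nat, E * 2^-1 ^+ N < e.
Proof.
move=> e0; exists (Num.bound `|E / e|).
set N := Num.bound _.
have HN : E / e < N%:R.
  exact: le_lt_trans (ler_norm _) (archi_boundP (normr_ge0 _)).
rewrite exprVn ltr_pdivrMr ?exprn_gt0// -ltr_pdivrMl// mulrC (lt_le_trans HN)//.
by rewrite -natrX ler_nat ltnW// ltn_expl.
Qed.

Lemma Rint_cst (t c : R) : I0T t -> \int[leb]_(s in `[0, t]) c = c * t.
Proof.
move=> /I0T_le/andP[t0 _]; rewrite Rintegral_cst//= lebesgue_measure_itv/= lte_fin.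
by case: ltgtP t0 => //= [|<-] _; rewrite ?subr0.
Qed.

Lemma uniform_limit_contT n (X : nat -> R -> 'rV[R]_n) (x : R -> 'rV[R]_n) (E : R) :
  (forall k, contT T (X k)) ->
  (forall k t, I0T t -> `|x t - X k t| <= E * 2^-1 ^+ k) -> contT T x.
Proof.
move=> cX Xx; apply: coord_contT => i.
apply/subspace_continuousP => t tT; apply/cvgrPdist_lt => e e0.
have [k Hk] := half_pow_small E (divr_gt0 e0 (ltr0Sn R 2)).
have /subspace_continuousP/(_ t tT) := @contT_coord _ _ _ _ i (cX k).
move=> /cvgrPdist_lt/(_ _ (divr_gt0 e0 (ltr0Sn R 2))).
rewrite !near_withinE; apply: filterS => s Hs sT; have {}Hs := Hs sT; move: Hs; rewrite /from_subspace => Hs.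
have D1 := le_lt_trans (le_trans (rV_norm_ge _ i) (Xx k _ tT)) Hk.
have D2 := le_lt_trans (le_trans (rV_norm_ge _ i) (Xx k _ sT)) Hk.
move: D1 D2; rewrite !mxE => D1 D2.
have -> : x t 0 i - x s 0 i = (x t 0 i - X k t 0 i) + (X k t 0 i - X k s 0 i) - (x s 0 i - X k s 0 i) by ring.
rewrite (le_lt_trans (ler_normB _ _))// (le_lt_trans (lerD (ler_normD _ _) (lexx _)))//.
by move: Hs D1 D2; lra.
Qed.

(** The weight [exp(2Lt)] makes the Picard operator contract by one half on all of [[0, T]] at once,
    so the interval is not subdivided. Measurability of the right-hand side is asked along
    continuous curves, the class in which the iterates and their limit live. *)
Lemma picard n (h : R -> 'rV[R]_n -> 'rV[R]_n) (L : R) (x0 : 'rV[R]_n) :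
  0 < T -> 0 < L ->
  (forall x, contT T x -> forall i, bmeas T (fun t => h t (x t) 0 i)) ->
  (forall t a b, I0T t -> `|h t a - h t b| <= L * `|a - b|) ->
  exists x, is_deriv T x (fun t => h t (x t)) /\ x 0 = x0.
Proof.
move=> T0 L0 hm hL.
pose P (x : R -> 'rV[R]_n) t := \row_i (x0 0 i + \int[leb]_(s in `[0, t]) h s (x s) 0 i).
pose X k := iter k P (fun=> x0).
have int00 (g : R -> R) : \int[leb]_(r in `[0, 0]) g r = 0 by rewrite set_itv1 Rintegral_set1.
have cP x : contT T x -> contT T (P x).
  move=> cx; apply: coord_contT => i; rewrite /P.
  under eq_fun do rewrite mxE.
  apply: contTD; first exact: contT_cst.
  by apply: prim_cont; [exact: ltW|exact/bmeas_integ/hm].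
have cX k : contT T (X k) by elim: k => [|k IH]; [exact: contT_cst|exact: cP].
have hdif (x y : R -> 'rV[R]_n) i : contT T x -> contT T y -> integ T (fun s => h s (x s) 0 i - h s (y s) 0 i).
  by move=> cx cy; apply: integB; exact/bmeas_integ/hm.
have PL (x y : R -> 'rV[R]_n) (g : R -> R) t : contT T x -> contT T y -> I0T t -> integ T g ->
    (forall s, I0T s -> `|x s - y s| <= g s) ->
    `|P x t - P y t| <= L * \int[leb]_(s in `[0, t]) g s.
  move=> cx cy tT ig xy; have /andP[t0 tT'] := I0T_le tT.
  have g0 s : I0T s -> 0 <= g s by move=> /xy; exact: le_trans.
  apply: rV_norm_le => [|i].
    rewrite mulr_ge0 ?(ltW L0)//; apply: Rintegral_ge0 => s /=; rewrite in_itv/= => /andP[s0 st].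
    by apply: g0; rewrite /= in_itv/= s0 (le_trans st).
  rewrite !mxE opprD addrACA subrr add0r -RintegralB//; last 2 first.
  - exact/(integ_sub tT')/bmeas_integ/hm.
  - exact/(integ_sub tT')/bmeas_integ/hm.
  rewrite -RintegralZl//; last exact: integ_sub ig.
  apply: (Rint_norm_le tT) => //; [exact: (hdif x y i cx cy)|exact: integZ|move=> s sT].
  have := le_trans (hL _ (x s) (y s) sT) (ler_wpM2l (ltW L0) (xy _ sT)).
  by apply: le_trans; have := rV_norm_ge (h s (x s) - h s (y s)) i; rewrite !mxE.
have [_ [C HC]] := contT_bmeas (contT_norm (contTB (cX 1%N) (cX 0%N))).
have C0 : 0 <= C by rewrite (le_trans _ (HC 0 _))//= in_itv/= lexx ltW.
have L20 : 0 < 2 * L by rewrite mulr_gt0.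
(* Integrating [L exp(2Ls)] gives at most half of [exp(2Lt)], which is the factor one half gained at
   each iteration. *)
have Xdif k t : I0T t -> `|X k.+1 t - X k t| <= C * 2^-1 ^+ k * expR (2 * L * t).
  elim: k t => [|k IH] t tT; have /andP[t0 tT'] := I0T_le tT.
    rewrite expr0 mulr1; have := HC _ tT; rewrite normr_id => /le_trans; apply.
    by rewrite ler_peMr// -[leLHS]expR0 ler_expR mulr_ge0// ltW.
  have iE : integ T (fun s => expR (2 * L * s)) by exact/bmeas_integ/contT_bmeas/contT_expR.
  have := PL (X k.+1) (X k) (fun s => C * 2^-1 ^+ k * expR (2 * L * s)) t (cX _) (cX _) tT (integZ _ iE) IH.
  move=> /le_trans; apply; rewrite RintegralZl//; last exact: integ_sub iE.
  rewrite int_expR//; set E := expR _.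
  have C1 : 0 <= C * 2^-1 ^+ k by rewrite mulr_ge0// exprn_ge0// invr_ge0.
  rewrite exprSr; have -> : L * (C * 2^-1 ^+ k * ((E - 1) / (2 * L))) = C * 2^-1 ^+ k * 2^-1 * (E - 1).
    by field; rewrite gt_eqF.
  rewrite mulrA ler_wpM2l ?mulr_ge0 ?exprn_ge0 ?invr_ge0//.
  by rewrite lerBlDr lerDl.
pose E := C * expR (2 * L * T).
have E0 : 0 <= E by rewrite mulr_ge0// expR_ge0.
have Xdif2 k t : I0T t -> `|X k.+1 t - X k t| <= E * 2^-1 ^+ k.
  move=> tT; apply: (le_trans (Xdif k t tT)); rewrite /E mulrAC ler_wpM2r//.
  have /andP[t0 tT'] := I0T_le tT.
  by rewrite ler_wpM2l// ler_expR ler_wpM2l// ltW.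
(* The exact geometric sum, with its factor [1 - 2^-p], is the form that closes the induction on
   [p]. *)
have Xcau k p t : I0T t -> `|X (k + p)%N t - X k t| <= 2 * E * 2^-1 ^+ k * (1 - 2^-1 ^+ p).
  move=> tT; elim: p => [|p IH]; first by rewrite addn0 subrr normr0 expr0 subrr mulr0.
  have -> : X (k + p.+1)%N t - X k t = (X (k + p).+1 t - X (k + p)%N t) + (X (k + p)%N t - X k t).
    by rewrite addnS addrA subrK.
  apply: (le_trans (ler_normD _ _)); apply: (le_trans (lerD (Xdif2 _ _ tT) IH)).
  rewrite exprD exprSr le_eqVlt; apply/orP; left; apply/eqP.
  by field.
have Xcau2 k p t : I0T t -> `|X (k + p)%N t - X k t| <= 2 * E * 2^-1 ^+ k.
  move=> tT; apply: (le_trans (Xcau k p t tT)); rewrite ler_piMr ?lerBlDr ?lerDl//.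
  by rewrite !mulr_ge0// exprn_ge0// invr_ge0.
pose x t : 'rV[R]_n := \row_i limn (fun k => X k t 0 i).
have Xcvg t i : I0T t -> cvgn (fun k => X k t 0 i).
  move=> tT; apply/cauchy_cvgP/cauchy_exP => e e0.
  have [N HN] := half_pow_small (2 * E) e0.
  exists (X N t 0 i); exists N => // k /= Nk.
  rewrite -ball_normE/= distrC (le_lt_trans _ HN)//.
  have := Xcau2 N (k - N)%N t tT; rewrite subnKC// => /(le_trans (rV_norm_ge _ i)).
  by rewrite !mxE.
have Xx k t : I0T t -> `|x t - X k t| <= 2 * E * 2^-1 ^+ k.
  move=> tT; apply: rV_norm_le => [|i].
    by rewrite !mulr_ge0// exprn_ge0// invr_ge0.
  rewrite !mxE.
  have cl : (fun p => `|X p t 0 i - X k t 0 i|) @ \oo --> `|limn (fun k => X k t 0 i) - X k t 0 i|.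
    by apply: cvg_norm; apply: cvgB; [exact: Xcvg|exact: cvg_cst].
  rewrite -(cvg_lim _ cl)//; apply: limr_le; first by apply/cvg_ex; eexists; exact: cl.
  exists k => // p /= kp; have := Xcau2 k (p - k)%N t tT; rewrite subnKC//.
  by move=> /(le_trans (rV_norm_ge _ i)); rewrite !mxE.
have cx : contT T x by exact: uniform_limit_contT cX Xx.
have I00 : I0T 0 by rewrite /= in_itv/= lexx ltW.
have X0 k : X k 0 = x0.
  case: k => [//|k]; apply/rowP => i; rewrite /X iterS -/(X k) mxE int00 addr0//.
have x00 : x 0 = x0.
  apply/rowP => i; rewrite mxE (_ : (fun k => _) = fun=> x0 0 i) ?lim_cst//.
  by apply/funext => k; rewrite X0.
exists x; split => //; split=> [i|t tT i]; first exact/bmeas_integ/hm.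
rewrite x00; have -> : x0 0 i + \int[leb]_(s in `[0, t]) h s (x s) 0 i = P x t 0 i by rewrite mxE.
have /andP[t0 tT'] := I0T_le tT.
apply/eqP; rewrite -subr_eq0 -normr_le0; apply/ler_addgt0Pl => e e0; rewrite addr0.
have [N HN] := half_pow_small (2 * E * (1 + L * T)) e0.
(* The iterate [X N.+1] is [P (X N)] by definition; both differences are small, the second by the
   Lipschitz bound for [P]. *)
have -> : x t 0 i - P x t 0 i = (x t 0 i - X N.+1 t 0 i) + (P (X N) t 0 i - P x t 0 i).
  by rewrite addrA subrK.
apply: (le_trans (ler_normD _ _)); apply/ltW/(le_lt_trans _ HN).
rewrite mulrDr mulr1 mulrDl lerD//.
  have := Xx N.+1 t tT => /(le_trans (rV_norm_ge _ i)); rewrite !mxE => /le_trans; apply.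
  rewrite exprS ler_wpM2l ?mulr_ge0// ler_piMl ?invr_le1 ?unitfE// ?exprn_ge0 ?invr_ge0// ler1n//.
have := PL (X N) x (fun=> 2 * E * 2^-1 ^+ N) t (cX _) cx tT.
move=> /(_ (bmeas_integ (bmeas_cst _ _))) H.
have -> : P (X N) t 0 i - P x t 0 i = (P (X N) t - P x t) 0 i by rewrite !mxE.
apply: (le_trans (rV_norm_ge _ i)); apply: (le_trans (H _)) => [s sT|].
  by rewrite distrC Xx.
rewrite (Rint_cst _ tT).
have -> : L * (2 * E * 2^-1 ^+ N * t) = 2 * E * 2^-1 ^+ N * (L * t) by ring.
have -> : 2 * E * (L * T) * 2^-1 ^+ N = 2 * E * 2^-1 ^+ N * (L * T) by ring.
rewrite ler_wpM2l//; first by rewrite !mulr_ge0// exprn_ge0// invr_ge0.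
by rewrite ler_wpM2l// ltW.
Qed.
End Picard.

(** * Twice differentiable maps on boxes *)

Section Directional.
Context {R : realType} {n : nat}.
Implicit Types (x y h v w : 'rV[R]_n).
Local Notation E k := (delta_mx 0 k : 'rV[R]_n).

Lemma derive_lin (W : normedModType R) (g : 'rV[R]_n -> W) x (c : R) v w :
  differentiable g x -> 'D_(c *: v + w) g x = c *: 'D_v g x + 'D_w g x.
Proof. by move=> dg; rewrite !deriveE// linearP. Qed.

Lemma derive_basis (W : normedModType R) (g : 'rV[R]_n -> W) x v :
  differentiable g x -> 'D_v g x = \sum_(k < n) v 0 k *: 'D_(E k) g x.
Proof.
move=> dg; rewrite deriveE// {1}(row_sum_delta v) linear_sum.
by apply: eq_bigr => k _; rewrite linearZ deriveE.
Qed.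

(** The inner derivative is first written as a combination of partial derivatives at every point, as
    an identity of functions; only then can it be differentiated once more. *)
Lemma derive_basis2 (W : normedModType R) (g : 'rV[R]_n -> W) x v w :
  (forall x, differentiable g x) -> (forall v x, differentiable ('D_v g) x) ->
  'D_w ('D_v g) x = \sum_(k < n) \sum_(l < n) (v 0 k * w 0 l) *: 'D_(E l) ('D_(E k) g) x.
Proof.
move=> dg d2.
have -> : 'D_v g = \sum_(k < n) (v 0 k *: 'D_(E k) g).
  by apply/funext => y; rewrite derive_basis// fct_sumE.
have dk k : derivable (v 0 k *: 'D_(E k) g) x w.
  by apply: derivableZ; exact: diff_derivable.
rewrite derive_sum//; apply: eq_bigr => k _.
rewrite deriveZ; last exact: diff_derivable.
rewrite derive_basis// scaler_sumr; apply: eq_bigr => l _.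
by rewrite scalerA.
Qed.

Lemma derive_basis2_pair (W : normedModType R) (g : 'rV[R]_n -> W) x v w :
  (forall x, differentiable g x) -> (forall v x, differentiable ('D_v g) x) ->
  'D_w ('D_v g) x =
  \sum_(kl : 'I_n * 'I_n) (v 0 kl.1 * w 0 kl.2) *: 'D_(E kl.2) ('D_(E kl.1) g) x.
Proof. by move=> d1 d2; rewrite (derive_basis2 x v w d1 d2) pair_big. Qed.

Lemma derive_coord m (F : 'rV[R]_n -> 'rV[R]_m) x v j :
  derivable F x v -> ('D_v F x) 0 j = 'D_v (fun y => F y 0 j) x.
Proof. by move=> dF; rewrite derive_mx// mxE. Qed.

Lemma differentiable_coordE m (F : 'rV[R]_n -> 'rV[R]_m) x j :
  differentiable F x -> differentiable (fun y => F y 0 j) x.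
Proof.
move=> dF.
exact: (@differentiable_comp _ _ _ _ F (fun M : 'rV[R]_m => M 0 j) x dF (differentiable_coord _ _ _)).
Qed.

Lemma line_is_derive (g : 'rV[R]_n -> R) x h (s : R) : derivable g (x + s *: h) h ->
  is_derive s 1 (fun s : R => g (x + s *: h)) ('D_h g (x + s *: h)).
Proof.
move=> dg.
have Ek : (fun k : R => k^-1 *: (g (x + (k *: 1 + s) *: h) - g (x + s *: h))) =
    (fun k : R => k^-1 *: (g (k *: h + (x + s *: h)) - g (x + s *: h))).
  by apply/funext => k; rewrite scalerDl /= addrCA -[k *: 1]mulr1; congr (_ *: (g (_ + _) - _)); rewrite [k *: 1]mulr1 mulr1.
by split; rewrite /derivable /derive /=; rewrite Ek.
Qed.

Lemma mean_value (g : 'rV[R]_n -> R) x h : (forall x, differentiable g x) ->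
  exists2 c : R, 0 <= c <= 1 & g (x + h) - g x = 'D_h g (x + c *: h).
Proof.
move=> dg.
have D s : is_derive s (1 : R) (fun s : R => g (x + s *: h)) ('D_h g (x + s *: h)).
  by apply: line_is_derive; exact: diff_derivable.
have [|c c01] := @MVT_segment _ (fun s : R => g (x + s *: h)) (fun s => 'D_h g (x + s *: h)) 0 1 ler01 (fun s _ => D s).
  apply: continuous_subspaceT => s.
  by apply/differentiable_continuous/derivable1_diffP; case: (D s).
rewrite scale1r scale0r addr0 subr0 mulr1 => ->.
by exists c => //; move: c01; rewrite in_itv.
Qed.

End Directional.

Section C2.
Context {R : realType} {n : nat}.
Implicit Types (x y h v w : 'rV[R]_n).
Local Notation E k := (delta_mx 0 k : 'rV[R]_n).

Definition box (rho : R) : set 'rV[R]_n := [set x | `|x| <= rho].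

Lemma box_compact rho : compact (box rho).
Proof.
apply: bounded_closed_compact.
  exists rho; split; first exact: num_real.
  by move=> r rr x /= xr; rewrite (le_trans xr)// ltW.
rewrite (_ : box rho = (fun x => `|x|) @^-1` [set r | r <= rho])//.
by apply: closed_comp; [move=> x _; exact: norm_continuous|exact: closed_le].
Qed.

Lemma box_convex rho x h (c : R) : 0 <= c <= 1 -> box rho x -> box rho (x + h) -> box rho (x + c *: h).
Proof.
rewrite /box/= => /andP[c0 c1] xr xhr.
have -> : x + c *: h = (1 - c) *: x + c *: (x + h).
  by rewrite scalerDr addrA -scalerDl subrK scale1r.
rewrite (le_trans (ler_normD _ _))// !normrZ ger0_norm ?subr_ge0// ger0_norm//.
rewrite (@le_trans _ _ ((1 - c) * rho + c * rho))//.
  by rewrite lerD// ler_wpM2l// subr_ge0.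
by rewrite -mulrDl subrK mul1r.
Qed.

Lemma cont_bounded (g : 'rV[R]_n -> R) rho : continuous g ->
  exists2 C, 0 <= C & forall x, box rho x -> `|g x| <= C.
Proof.
move=> cg.
have /compact_bounded[M [_ Mg]] := continuous_compact (continuous_subspaceT cg) (@box_compact rho).
exists (`|M| + 1); first by rewrite addr_ge0.
move=> x xr; apply: (Mg (`|M| + 1)); last by exists x.
by rewrite ltr_pwDr// ler_norm.
Qed.

(** Only [x] is confined to the box; [y] may leave it. Compactness is therefore applied to the base
    points, with the radius [d] tending to 0 as the parameter of the near-covering property. *)
Lemma cont_unif (g : 'rV[R]_n -> R) rho (k : R) : continuous g -> 0 < k ->
  exists2 d, 0 < d & forall x y, box rho x -> `|y - x| < d -> `|g y - g x| < k.
Proof.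
move=> cg k0.
have /compact_near_coveringP := @box_compact rho.
move=> /(_ R (0^'+) (fun d x => forall y, `|y - x| < d -> `|g y - g x| < k) _).
have H : forall x, box rho x -> \forall x' \near x & d \near 0^'+,
    forall y, `|y - x'| < d -> `|g y - g x'| < k.
  move=> x xr; have /cvgrPdist_lt/(_ (k / 2)) := cg x.
  rewrite divr_gt0// => /(_ isT)/nbhs_normP[/= e e0 He].
  exists (ball x (e / 2), [set d | d < e / 2]) => /=.
    split; first by apply: nbhsx_ballx; rewrite divr_gt0.
    by apply: nbhs_right_lt; rewrite divr_gt0.
  move=> [x' d] /= [xx' de] y yx'.
  move: xx'; rewrite -ball_normE /= => xx'.
  have e2 : e / 2 <= e by lra.
  have D1 : `|g x - g x'| < k / 2 by apply: He => /=; rewrite (lt_le_trans xx').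
  have D2 : `|g x - g y| < k / 2.
    apply: He => /=; rewrite (le_lt_trans (ler_distD x' _ _))// (splitr e) ltrD// distrC.
    exact: lt_trans de.
  rewrite (le_lt_trans (ler_distD (g x) _ _))// (splitr k) ltrD// distrC//.
move=> /(_ H) {}H.
have [d [d0 Hd]] : exists d : R, 0 < d /\ (box rho `<=` (fun x => forall y, `|y - x| < d -> `|g y - g x| < k)).
  near (0 : R)^'+ => d; exists d; split; first by [].
  by near: d.
by exists d => // x y xr; exact: Hd.
Unshelve. all: by end_near. Qed.

Definition C2s (g : 'rV[R]_n -> R) :=
  [/\ forall x, differentiable g x,
      forall v x, differentiable ('D_v g) x &
      forall v w, continuous ('D_w ('D_v g))].

Lemma is_C2_coord m (F : 'rV[R]_n -> 'rV[R]_m) j : is_C2 F -> C2s (fun x => F x 0 j).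
Proof.
move=> [d1 [d2 d3]].
have E1 v : 'D_v (fun y => F y 0 j) = (fun x => ('D_v F x) 0 j).
  by apply/funext => x; rewrite derive_coord//; exact: diff_derivable.
have E2 v w : 'D_w ('D_v (fun y => F y 0 j)) = (fun x => ('D_w ('D_v F) x) 0 j).
  by rewrite E1; apply/funext => x; rewrite derive_coord//; exact: diff_derivable.
split=> [x|v x|v w x].
- exact: differentiable_coordE.
- by rewrite E1; exact: differentiable_coordE.
- rewrite E2; apply: (@continuous_comp _ _ _ ('D_w ('D_v F)) (fun M : 'rV[R]_m => M 0 j)).
    exact: d3.
  exact: coord_continuous.
Qed.

Lemma sum_norm_le (I : finType) (a C : I -> R) (r : R) : 0 <= r ->
  (forall i, `|a i| <= C i * r) -> `|\sum_i a i| <= (\sum_i C i) * r.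
Proof.
move=> r0 aC; rewrite (le_trans (ler_norm_sum _ _ _))// mulr_suml.
by apply: ler_sum.
Qed.

Lemma C2_d1 (g : 'rV[R]_n -> R) rho : (forall x, differentiable g x) ->
  (forall v x, differentiable ('D_v g) x) ->
  exists2 C, 0 <= C & forall x v, box rho x -> `|'D_v g x| <= C * `|v|.
Proof.
move=> d1 d2.
have /choice[C HC] : forall k, exists C, 0 <= C /\ forall x, box rho x -> `|'D_(E k) g x| <= C.
  move=> k; have cD : continuous ('D_(E k) g) by move=> x; exact: differentiable_continuous.
  by have [C C0 HC] := cont_bounded rho cD; exists C.
exists (\sum_k C k); first by apply: sumr_ge0 => k _; case: (HC k).
move=> x v xr; rewrite derive_basis//; apply: sum_norm_le => // k.
rewrite normrM mulrC ler_pM//; first by case: (HC k) => _; exact.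
exact: rV_norm_ge.
Qed.

Lemma C2_d2 (g : 'rV[R]_n -> R) rho : C2s g ->
  exists2 C, 0 <= C & forall x v w, box rho x -> `|'D_w ('D_v g) x| <= C * (`|v| * `|w|).
Proof.
move=> [d1 d2 d3].
have /choice[C HC] : forall kl : 'I_n * 'I_n, exists C, 0 <= C /\ forall x, box rho x -> `|'D_(E kl.2) ('D_(E kl.1) g) x| <= C.
  by move=> [k l]; have [C C0 HC] := cont_bounded rho (d3 (E k) (E l)); exists C.
exists (\sum_kl C kl); first by apply: sumr_ge0 => k _; case: (HC k).
move=> x v w xr; rewrite derive_basis2// pair_big/=; apply: sum_norm_le => [|[k l]/=].
  by rewrite mulr_ge0.
rewrite /GRing.scale/= normrM mulrC ler_pM//; first by case: (HC (k, l)) => _; exact.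
by rewrite normrM ler_pM// rV_norm_ge.
Qed.

Lemma mvt_lip (g : 'rV[R]_n -> R) rho C : (forall x, differentiable g x) ->
  (forall x v, box rho x -> `|'D_v g x| <= C * `|v|) ->
  forall x y, box rho x -> box rho y -> `|g x - g y| <= C * `|x - y|.
Proof.
move=> d1 HC x y xr yr; have [c c01] := mean_value y (x - y) d1.
have xy : y + (x - y) = x by rewrite addrC subrK.
by rewrite xy => ->; apply: HC; apply: box_convex; rewrite ?xy.
Qed.

(** By the mean value theorem the difference is the derivative at a point [q] between [y] and [x].
    The derivative is Lipschitz on the box, and [q - z] is a convex combination of [y - z] and
    [x - z]. *)
Lemma C2_strict (g : 'rV[R]_n -> R) rho : C2s g ->
  exists2 C, 0 <= C & forall x y z, box rho x -> box rho y -> box rho z ->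
    `|g x - g y - 'D_(x - y) g z| <= C * (`|x - z| + `|y - z|) * `|x - y|.
Proof.
move=> Cg; have [d1 d2 d3] := Cg; have [C C0 HC] := C2_d2 rho Cg.
exists C => // x y z xr yr zr; have [c c01] := mean_value y (x - y) d1.
have xy : y + (x - y) = x by rewrite addrC subrK.
rewrite xy => ->; set q := y + _.
have qr : box rho q by apply: box_convex => //; rewrite xy.
have := @mvt_lip ('D_(x - y) g) rho (C * `|x - y|) (d2 _).
move=> /(_ _ q z qr zr) H; apply: (le_trans (H _)) => [p w pr|].
  by rewrite -mulrA; exact: HC.
rewrite -!mulrA ler_wpM2l// mulrC ler_wpM2r//.
have -> : q - z = (1 - c) *: (y - z) + c *: (x - z).
  by apply/rowP => i; rewrite !mxE; ring.
move: c01 => /andP[c0 c1].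
rewrite (le_trans (ler_normD _ _))// !normrZ ger0_norm ?subr_ge0// ger0_norm//.
by rewrite addrC lerD// ler_piMl// lerBlDr lerDl.
Qed.

(** The radius [d] serves all base points of the box, because it comes from the uniform continuity
    of the second partial derivatives; a whole trajectory can then be expanded with one [d]. *)
Lemma taylor2 (g : 'rV[R]_n -> R) rho (k : R) : C2s g -> 0 < k ->
  exists2 d, 0 < d & forall x h, box rho x -> `|h| < d ->
    `|g (x + h) - g x - 'D_h g x - 2^-1 * 'D_h ('D_h g) x| <= k * (`|h| * `|h|).
Proof.
move=> Cg k0; have [d1 d2 d3] := Cg.
(* The [n * n] second partial derivatives share the tolerance [k]; adding 1 keeps the quotient
   defined for [n = 0]. *)
pose K := k / ((n * n)%:R + 1).
have K0 : 0 < K by rewrite divr_gt0// ltr_wpDl.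
have /choice[D HD] : forall kl : 'I_n * 'I_n, exists d, 0 < d /\ forall x y, box rho x -> `|y - x| < d ->
   `|'D_(E kl.2) ('D_(E kl.1) g) y - 'D_(E kl.2) ('D_(E kl.1) g) x| < K.
  by move=> [i l]; have [d d0 Hd] := cont_unif rho (d3 (E i) (E l)) K0; exists d.
exists (\big[Num.min/1]_kl D kl).
  by apply/bigmin_gtP; split => // i _; case: (HD i).
move=> x h xr hd.
have D2 (s : R) : 0 <= s <= 1 -> `|'D_h ('D_h g) (x + s *: h) - 'D_h ('D_h g) x| <= k * (`|h| * `|h|).
  move=> /andP[s0 s1]; rewrite (derive_basis2_pair (x + s *: h) h h d1 d2) (derive_basis2_pair x h h d1 d2) -sumrB.
  apply: (@le_trans _ _ ((\sum_(i : 'I_n * 'I_n) K) * (`|h| * `|h|))).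
    apply: sum_norm_le => [|[i l]/=]; first by rewrite mulr_ge0.
    rewrite -scalerBr /GRing.scale/= normrM mulrC ler_pM//; last first.
      by rewrite normrM ler_pM// rV_norm_ge.
    case: (HD (i, l)) => _ /= H; apply/ltW/H => //.
    rewrite addrC addKr normrZ ger0_norm//.
    apply: (@le_lt_trans _ _ `|h|); first by rewrite ler_piMl.
    by apply: (lt_le_trans hd); exact: bigmin_le.
  rewrite ler_wpM2r ?mulr_ge0// sumr_const card_prod !card_ord -mulr_natr /K.
  rewrite mulrAC ler_pdivrMr ?ltr_wpDl// ler_wpM2l ?(ltW k0)//.
  by rewrite lerDl.
(* [q 1] is the Taylor remainder and [q 0 = 0]. The mean value theorem is applied to [q], and then
   to ['D_h g], which leaves a difference of second derivatives. *)
pose q (s : R) := g (x + s *: h) - g x - s * 'D_h g x - 2^-1 * s ^+ 2 * 'D_h ('D_h g) x.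
have Dg s : is_derive s (1 : R) (fun s : R => g (x + s *: h)) ('D_h g (x + s *: h)).
  by apply: line_is_derive; exact: diff_derivable.
have Dq s : is_derive s (1 : R) q ('D_h g (x + s *: h) - 'D_h g x - s * 'D_h ('D_h g) x).
  rewrite /q; apply: is_derive_eq; rewrite /GRing.scale/=.
  by field.
have [|c c01] := @MVT_segment _ q _ 0 1 ler01 (fun s _ => Dq s).
  apply: continuous_subspaceT => s.
  by apply/differentiable_continuous/derivable1_diffP; case: (Dq s).
rewrite /q !mul0r !scale0r !addr0 expr0n/= !mulr0 mul0r subrr !subr0 scale1r mul1r expr1n !mulr1.
move=> ->.
have [c' c'01 HH] := mean_value x (c *: h) (d2 h).
have /andP[c0 c1] : 0 <= c <= 1 by move: c01; rewrite in_itv.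
have /andP[c'0 c'1] := c'01.
have -> : 'D_h g (x + c *: h) - 'D_h g x - c * 'D_h ('D_h g) x =
    c * ('D_h ('D_h g) (x + (c' * c) *: h) - 'D_h ('D_h g) x).
  rewrite HH scalerA -[c *: h]addr0 derive_lin// derive0 addr0.
  by rewrite /GRing.scale/= mulrBr.
rewrite normrM ger0_norm// (le_trans (ler_piMl _ c1))// D2// mulr_ge0//=.
by rewrite mulr_ile1.
Qed.
End C2.

(** * Expansions at one point for functions that are only twice differentiable *)

Section Peano.
Context {R : realType} {n : nat}.
Implicit Types (x y h v w : 'rV[R]_n).
Local Notation E k := (delta_mx 0 k : 'rV[R]_n).

Lemma differentiable_approx (g : 'rV[R]_n -> R) x (k : R) : differentiable g x -> 0 < k ->
  exists2 d, 0 < d & forall h, `|h| < d -> `|g (x + h) - g x - 'D_h g x| <= k * `|h|.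
Proof.
move=> dg k0; have /eqaddoP/(_ k k0) := diff_locally dg.
move=> /nbhs_normP[/= d d0 Hd]; exists d => // h hd.
have := Hd h; rewrite /= sub0r normrN => /(_ hd).
rewrite deriveE//=; congr (`|_| <= _).
by rewrite -[LHS]/(g (h + x) - (g x + 'd g x h)) [h + x]addrC opprD addrA.
Qed.

(** The minimum starts from 1, so that it is positive also over an empty index type. *)
Lemma ex_common_radius (I : finType) (P : I -> R -> Prop) :
  (forall i d d', P i d -> 0 < d' <= d -> P i d') ->
  (forall i, exists2 d, 0 < d & P i d) -> exists2 d, 0 < d & forall i, P i d.
Proof.
move=> Pm H; have /choice[D HD] : forall i, exists d, 0 < d /\ P i d.
  by move=> i; have [d d0 Pd] := H i; exists d.
have D0 : 0 < \big[Num.min/1]_i D i by apply/bigmin_gtP; split => // i _; case: (HD i).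
exists (\big[Num.min/1]_i D i) => // i; apply: (Pm i (D i)); first by case: (HD i).
by rewrite D0/=; exact: bigmin_le.
Qed.

(** Along the segment from [x], differentiability of the partial derivatives at the single point [x]
    controls the derivative of the remainder, so the error is [o(|h|^2)] at [x] alone. *)
Lemma taylor2_pt (g : 'rV[R]_n -> R) x (k : R) : twice_diff g -> 0 < k ->
  exists2 d, 0 < d & forall h, `|h| < d ->
    `|g (x + h) - g x - 'D_h g x - 2^-1 * 'D_h ('D_h g) x| <= k * (`|h| * `|h|).
Proof.
move=> [d1 d2] k0.
pose K := k / (n%:R + 1).
have K0 : 0 < K by rewrite divr_gt0// ltr_wpDl.
have [d d0 HD] : exists2 d, 0 < d & forall i h, `|h| < d ->
    `|'D_(E i) g (x + h) - 'D_(E i) g x - 'D_h ('D_(E i) g) x| <= K * `|h|.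
  apply: ex_common_radius => [i d d' H /andP[_ d'd] h hd|i].
    by apply: H; exact: lt_le_trans d'd.
  exact: differentiable_approx.
exists d => // h hd.
have D2 (s : R) : 0 <= s <= 1 -> `|'D_h g (x + s *: h) - 'D_h g x - s * 'D_h ('D_h g) x| <= k * (`|h| * `|h|).
  move=> /andP[s0 s1].
  have -> : s * 'D_h ('D_h g) x = \sum_(i < n) h 0 i * 'D_(s *: h) ('D_(E i) g) x.
    rewrite derive_basis2// mulr_sumr; apply: eq_bigr => i _.
    rewrite derive_basis// !mulr_sumr; apply: eq_bigr => j _.
    by rewrite mxE /GRing.scale/=; ring.
  rewrite (derive_basis _ (d1 (x + s *: h))) (derive_basis _ (d1 x)) -!sumrB.
  apply: (@le_trans _ _ ((\sum_(i < n) K) * (`|h| * `|h|))).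
    apply: sum_norm_le => [|i]; first by rewrite mulr_ge0.
    rewrite /GRing.scale/= -!mulrBr normrM mulrCA ler_pM//; first exact: rV_norm_ge.
    have sh : `|s *: h| <= `|h| by rewrite normrZ ger0_norm// ler_piMl.
    apply: (le_trans (HD _ _ (le_lt_trans sh hd))).
    by rewrite ler_wpM2l// ltW.
  rewrite ler_wpM2r ?mulr_ge0// sumr_const card_ord -mulr_natr /K.
  rewrite mulrAC ler_pdivrMr ?ltr_wpDl// ler_wpM2l ?(ltW k0)//.
  by rewrite lerDl.
pose q (s : R) := g (x + s *: h) - g x - s * 'D_h g x - 2^-1 * s ^+ 2 * 'D_h ('D_h g) x.
have Dg s : is_derive s (1 : R) (fun s : R => g (x + s *: h)) ('D_h g (x + s *: h)).
  by apply: line_is_derive; exact: diff_derivable.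
have Dq s : is_derive s (1 : R) q ('D_h g (x + s *: h) - 'D_h g x - s * 'D_h ('D_h g) x).
  by rewrite /q; apply: is_derive_eq; rewrite /GRing.scale/=; field.
have [|c c01] := @MVT_segment _ q _ 0 1 ler01 (fun s _ => Dq s).
  apply: continuous_subspaceT => s.
  by apply/differentiable_continuous/derivable1_diffP; case: (Dq s).
rewrite /q !mul0r !scale0r !addr0 expr0n/= !mulr0 mul0r subrr !subr0 scale1r mul1r expr1n !mulr1.
by move=> ->; apply: D2; move: c01; rewrite in_itv.
Qed.

(** The first partial derivatives are differentiable, hence continuous at [x0], and the mean value
    theorem compares two moving points. This gives the Lipschitz estimate for the equality
    constraints in [local_solve]. *)
Lemma strict_diff_pt (g : 'rV[R]_n -> R) x0 (k : R) : twice_diff g -> 0 < k ->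
  exists2 d, 0 < d & forall x y, `|x - x0| < d -> `|y - x0| < d ->
    `|g x - g y - 'D_(x - y) g x0| <= k * `|x - y|.
Proof.
move=> [d1 d2] k0.
pose K := k / (n%:R + 1).
have K0 : 0 < K by rewrite divr_gt0// ltr_wpDl.
have [d d0 HD] : exists2 d, 0 < d & forall i y, `|y - x0| < d ->
    `|'D_(E i) g y - 'D_(E i) g x0| <= K.
  apply: ex_common_radius => [i d d' H /andP[_ d'd] h hd|i].
    by apply: H; exact: lt_le_trans d'd.
  have /cvgrPdist_le/(_ K K0) : 'D_(E i) g @ x0 --> 'D_(E i) g x0.
    exact: (differentiable_continuous (d2 (E i) x0)).
  move=> /nbhs_normP[/= d d0 Hd]; exists d => // y yd.
  by rewrite distrC; apply: Hd; rewrite /= distrC.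
exists d => // x y xd yd.
have [c /andP[c0 c1]] := mean_value y (x - y) d1.
have xy : y + (x - y) = x by rewrite addrC subrK.
rewrite xy => ->; set p := y + _.
have pd : `|p - x0| < d.
  have -> : p - x0 = (1 - c) *: (y - x0) + c *: (x - x0).
    by apply/rowP => i; rewrite !mxE; ring.
  apply: (le_lt_trans (ler_normD _ _)); rewrite !normrZ ger0_norm ?subr_ge0// ger0_norm//.
  (* For [c = 1] the weight of [y] vanishes, and the strict inequality has to come from [x]
     instead. *)
  have [c1'|c1'] := eqVneq c 1.
    by rewrite c1' subrr mul0r add0r mul1r.
  have : (1 - c) * `|y - x0| < (1 - c) * d by rewrite ltr_pM2l// subr_gt0 lt_neqAle c1'.
  have : c * `|x - x0| <= c * d by rewrite ler_wpM2l// ltW.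
  by lra.
rewrite (derive_basis _ (d1 p)) (derive_basis _ (d1 x0)) -!sumrB.
apply: (@le_trans _ _ ((\sum_(i < n) K) * `|x - y|)).
  apply: sum_norm_le => // i.
  rewrite /GRing.scale/= -!mulrBr normrM mulrC ler_pM//; last exact: rV_norm_ge.
  exact: HD.
rewrite ler_wpM2r// sumr_const card_ord -mulr_natr /K.
rewrite mulrAC ler_pdivrMr ?ltr_wpDl// ler_wpM2l ?(ltW k0)//.
by rewrite lerDl.
Qed.
End Peano.

(** * The control system and expansion of the endpoint map *)

Section LinearODE.
Context {R : realType} (T : R) {n : nat}.
Local Notation leb := (@lebesgue_measure R).
Local Notation I0T := (`[0, T]%classic : set R).
Local Notation E k := (delta_mx 0 k : 'rV[R]_n).

Lemma is_deriv_ext k (x y y' : R -> 'rV[R]_k) : (forall t, I0T t -> y t = y' t) ->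
  is_deriv T x y -> is_deriv T x y'.
Proof.
move=> yy' [iy xy]; split=> [i|t tT i].
  by apply: (integ_ext _ (iy i)) => t tT; rewrite yy'.
rewrite xy//; congr (_ + _); apply: eq_Rintegral => s; rewrite inE/= in_itv/= => /andP[s0 st].
by rewrite yy'//= in_itv/= s0 (le_trans st)//; have /andP[] := I0T_le tT.
Qed.

Lemma is_derivD k (x y x' y' : R -> 'rV[R]_k) : is_deriv T x y -> is_deriv T x' y' ->
  is_deriv T (fun t => x t + x' t) (fun t => y t + y' t).
Proof.
move=> [iy xy] [iy' xy']; split=> [i|t tT i].
  by apply: (integ_ext _ (integD (iy i) (iy' i))) => t tT; rewrite mxE.
have /andP[t0 tT'] := I0T_le tT.
rewrite !mxE xy// xy'// addrACA -RintegralD//; last 2 first.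
- exact: integ_sub (iy i).
- exact: integ_sub (iy' i).
by congr (_ + _); apply: eq_Rintegral => s _; rewrite mxE.
Qed.

Lemma is_derivZ k (c : R) (x y : R -> 'rV[R]_k) : is_deriv T x y ->
  is_deriv T (fun t => c *: x t) (fun t => c *: y t).
Proof.
move=> [iy xy]; split=> [i|t tT i].
  by apply: (integ_ext _ (integZ c (iy i))) => t tT; rewrite mxE.
have /andP[t0 tT'] := I0T_le tT.
rewrite !mxE xy// mulrDr -RintegralZl//; last exact: integ_sub (iy i).
by congr (_ + _); apply: eq_Rintegral => s _; rewrite mxE.
Qed.

Lemma is_derivB k (x y x' y' : R -> 'rV[R]_k) : is_deriv T x y -> is_deriv T x' y' ->
  is_deriv T (fun t => x t - x' t) (fun t => y t - y' t).
Proof.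
move=> xy xy'; have := is_derivD xy (is_derivZ (-1) xy').
by congr is_deriv; apply/funext => t; rewrite scaleN1r.
Qed.

Lemma is_deriv_lincomb k (I : Type) (s : seq I) (c : I -> R) (x y : I -> R -> 'rV[R]_k) :
  (forall i, is_deriv T (x i) (y i)) ->
  is_deriv T (fun t => \sum_(i <- s) c i *: x i t) (fun t => \sum_(i <- s) c i *: y i t).
Proof.
move=> xy; elim: s => [|i s IH].
  under eq_fun do rewrite big_nil; under [X in is_deriv _ _ X]eq_fun do rewrite big_nil.
  split=> [j|t tT j]; last first.
    by rewrite !mxE add0r; rewrite (Rint_cst _ tT) mul0r.
  by apply: (integ_ext _ (bmeas_integ (bmeas_cst T 0))) => t _; rewrite mxE.
under eq_fun do rewrite big_cons; under [X in is_deriv _ _ X]eq_fun do rewrite big_cons.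
by apply: is_derivD => //; exact: is_derivZ.
Qed.

Lemma dot_norm_le k (a b : 'rV[R]_k) : `|dot a b| <= k%:R * `|a| * `|b|.
Proof.
rewrite /dot (le_trans (ler_norm_sum _ _ _))//.
apply: (@le_trans _ _ (\sum_(j < k) `|a| * `|b|)).
  by apply: ler_sum => j _; rewrite normrM ler_pM// rV_norm_ge.
by rewrite sumr_const card_ord -mulrA mulr_natl.
Qed.

Lemma dotC k (a b : 'rV[R]_k) : dot a b = dot b a.
Proof. by rewrite /dot; apply: eq_bigr => i _; rewrite mulrC. Qed.

Lemma dot_deltar k (a : 'rV[R]_k) j : dot a (delta_mx 0 j) = a 0 j.
Proof.
rewrite /dot (bigD1 j)//= mxE !eqxx mulr1 big1 ?addr0// => i ij.
by rewrite mxE (negbTE ij) andbF mulr0.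
Qed.

Lemma prim_dot k (x y x' y' : R -> 'rV[R]_k) : 0 < T -> is_deriv T x y -> is_deriv T x' y' ->
  (forall i, bmeas T (fun t => y' t 0 i)) ->
  dot (x T) (x' T) = dot (x 0) (x' 0) + \int[leb]_(t in `[0, T]) (dot (y t) (x' t) + dot (x t) (y' t)).
Proof.
move=> T0 xy xy' by'.
have H i := prim_mul T0 ((is_derivP _ _ _).1 xy i) ((is_derivP _ _ _).1 xy' i) (by' i).
rewrite /dot; under eq_bigr do rewrite H.
rewrite big_split/=; congr (_ + _).
have cx := is_deriv_contT (ltW T0) xy; have cx' := is_deriv_contT (ltW T0) xy'.
have ik i : integ T (fun t => y t 0 i * x' t 0 i + x t 0 i * y' t 0 i).
  apply: integD; last first.
    by apply: integMl; [exact/contT_bmeas/contT_coord|exact/bmeas_integ/by'].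
  by apply: integMr; [exact/contT_bmeas/contT_coord|case: xy => + _; exact].
have S (s : seq 'I_k) : \sum_(i <- s) \int[leb]_(t in `[0, T]) (y t 0 i * x' t 0 i + x t 0 i * y' t 0 i) =
    \int[leb]_(t in `[0, T]) \sum_(i <- s) (y t 0 i * x' t 0 i + x t 0 i * y' t 0 i).
  elim: s => [|i s IH].
    rewrite big_nil; under eq_Rintegral do rewrite big_nil.
    by rewrite (@Rint_cst _ T) ?mul0r//= in_itv/= lexx ltW.
  rewrite big_cons IH; under [in RHS]eq_Rintegral do rewrite big_cons.
  by rewrite [RHS]RintegralD//; [exact: (ik i)|exact: (integ_sum s ik)].
rewrite S; apply: eq_Rintegral => t _.
by rewrite -big_split.
Qed.

Variable A : R -> 'M[R]_n.
Hypothesis bA : forall k l, bmeas T (fun t => A t k l).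
Hypothesis T0 : 0 < T.

Lemma mulmx_row_bound : exists2 L, 0 < L & forall t (h : 'rV[R]_n), I0T t -> `|h *m A t| <= L * `|h|.
Proof.
have /choice[M HM] : forall kl : 'I_n * 'I_n, exists M : R, forall t, I0T t -> `|A t kl.1 kl.2| <= M.
  by move=> [k l]; have [_] := bA k l.
have M0 kl : 0 <= M kl by rewrite (le_trans _ (HM kl 0 _))//= in_itv/= lexx ltW.
have S0 : 0 <= \sum_kl M kl by apply: sumr_ge0.
exists (\sum_kl M kl + 1); first by rewrite ltr_pwDr.
move=> t h tT; apply: rV_norm_le => [|l]; first by rewrite mulr_ge0// addr_ge0.
rewrite mxE mulrDl mul1r (le_trans _ (ler_wpDr _ (lexx _)))//.
apply: (@le_trans _ _ (\sum_k M (k, l) * `|h|)).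
  rewrite -mulr_suml; apply: sum_norm_le => // k; rewrite normrM mulrC ler_pM//.
    exact: (HM (k, l)).
  exact: rV_norm_ge.
rewrite -mulr_suml ler_wpM2r//.
rewrite [leRHS](eq_bigr (fun p => M (p.1, p.2))); last by case.
rewrite -(pair_bigA _ (fun k l => M (k, l)))/=.
by apply: ler_sum => k _; rewrite (bigD1 l)//= lerDl sumr_ge0.
Qed.

Lemma linear_ode (x0 : 'rV[R]_n) : exists x, is_deriv T x (fun t => x t *m A t) /\ x 0 = x0.
Proof.
have [L L0 HL] := mulmx_row_bound.
apply: (@picard R T n (fun t a => a *m A t) L) => //.
  move=> x cx i; under eq_fun do rewrite mxE.
  by apply: bmeas_sum => j; apply: bmeasM => //; exact/contT_bmeas/contT_coord.
by move=> t a b tT; rewrite -mulmxBl; exact: HL.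
Qed.

End LinearODE.

(** * The adjoint equation and its fundamental solutions *)

Section Adjoint.
Context {R : realType} (T : R) {n : nat}.
Local Notation leb := (@lebesgue_measure R).
Local Notation I0T := (`[0, T]%classic : set R).
Local Notation E k := (delta_mx 0 k : 'rV[R]_n).
Variable A : R -> 'M[R]_n.
Hypothesis bA : forall k l, bmeas T (fun t => A t k l).
Hypothesis T0 : 0 < T.

(** Vectors are rows, so the linearized equation is [d' = d A] and its adjoint carries the transpose
    of [A]. *)
Definition adj_sol (psi : R -> 'rV[R]_n) := is_deriv T psi (fun t => - (psi t *m (A t)^T)).

Lemma bmeas_mulmx (psi : R -> 'rV[R]_n) (B : R -> 'M[R]_n) i : contT T psi ->
  (forall k l, bmeas T (fun t => B t k l)) -> bmeas T (fun t => (psi t *m B t) 0 i).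
Proof.
move=> cp bB; under eq_fun do rewrite mxE.
by apply: bmeas_sum => j; apply: bmeasM => //; exact/contT_bmeas/contT_coord.
Qed.

(** The two linear parts cancel in the derivative of [dot psi d], which leaves the pairing with the
    source. *)
Lemma adj_pair psi (d y g : R -> 'rV[R]_n) : adj_sol psi -> is_deriv T d y ->
  (forall t, I0T t -> y t = d t *m A t + g t) ->
  dot (psi T) (d T) = dot (psi 0) (d 0) + \int[leb]_(t in `[0, T]) dot (psi t) (g t).
Proof.
move=> ap dy yE; have cp := is_deriv_contT (ltW T0) ap.
rewrite dotC (prim_dot T0 dy ap); last first.
  move=> i; under eq_fun do rewrite mxE; apply: bmeasN.
  apply: bmeas_mulmx => // k l; under eq_fun do rewrite mxE; exact: bA.
rewrite dotC; congr (_ + _); apply: eq_Rintegral => t; rewrite inE => tT.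
rewrite yE// /dot -big_split/=.
under eq_bigr do rewrite mxE mulrDl.
have -> : \sum_(i < n) psi t 0 i * g t 0 i =
   \sum_(i < n) ((d t *m A t) 0 i * psi t 0 i - d t 0 i * (psi t *m (A t)^T) 0 i + psi t 0 i * g t 0 i).
  rewrite big_split/= sumrB.
  have -> : \sum_(i < n) (d t *m A t) 0 i * psi t 0 i = \sum_(i < n) d t 0 i * (psi t *m (A t)^T) 0 i.
    under eq_bigr do rewrite mxE mulr_suml.
    under [RHS]eq_bigr do rewrite mxE mulr_sumr.
    rewrite exchange_big/=; apply: eq_bigr => i _; apply: eq_bigr => j _.
    by rewrite !mxE; ring.
  by rewrite subrr add0r.
by apply: eq_bigr => i _; rewrite !mxE; ring.
Qed.

(** Terminal values are prescribed, whereas [linear_ode] solves from time 0. The solutions with unit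
    initial values are therefore recombined by the inverse of their matrix at [T]. *)
Lemma adj_fundamental : exists Psi : 'I_n -> R -> 'rV[R]_n,
  (forall j, adj_sol (Psi j)) /\ (forall j, Psi j T = E j).
Proof.
have bAN k l : bmeas T (fun t => (- (A t)^T) k l).
  by under eq_fun do rewrite !mxE; exact: bmeasN.
have /choice[X HX] : forall k, exists x, is_deriv T x (fun t => x t *m A t) /\ x 0 = E k.
  by move=> k; exact: linear_ode.
have /choice[P HP] : forall j, exists x, adj_sol x /\ x 0 = E j.
  move=> k; have [x [dx x0]] := linear_ode bAN T0 (E k).
  exists x; split => //; rewrite /adj_sol.
  by under [X in is_deriv _ _ X]eq_fun do rewrite -mulmxN.
pose PT := \matrix_(j < n) P j T; pose XT := \matrix_(k < n) X k T.
(* Without a source the pairing of an adjoint solution with a solution of the linear equation is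
   constant in time, so at [T] it is what it was at 0; this makes [PT] invertible. *)
have PX : PT *m XT^T = 1%:M.
  apply/matrixP => j k; rewrite !mxE.
  have H0 t : I0T t -> X k t *m A t = X k t *m A t + 0 by rewrite addr0.
  have := adj_pair (HP j).1 (HX k).1 H0.
  rewrite (eq_Rintegral _ (g := fun=> 0)); last first.
    by move=> t _; rewrite /dot big1// => i _; rewrite mxE mulr0.
  rewrite (@Rint_cst _ T) ?mul0r ?addr0; last by rewrite /= in_itv/= lexx ltW.
  rewrite (HP j).2 (HX k).2 dot_deltar mxE eqxx/= eq_sym => <-.
  by rewrite /dot; apply: eq_bigr => i _; rewrite !mxE.
pose C := invmx PT.
exists (fun j t => \sum_(k < n) C j k *: P k t); split=> j.
  have := is_deriv_lincomb (index_enum _) (C j) (fun k => (HP k).1).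
  rewrite /adj_sol; congr is_deriv; apply/funext => t.
  rewrite mulmx_suml -sumrN; apply: eq_bigr => k _.
  by rewrite scalerN scalemxAl.
have /mulmx1_unit[uP _] := PX.
apply/rowP => i; have := mulVmx uP; move=> /matrixP/(_ j i); rewrite !mxE => H.
rewrite eqxx/= eq_sym -H summxE; apply: eq_bigr => k _.
by rewrite !mxE.
Qed.

End Adjoint.

(** * Vector fields affine in the control: algebra and uniform bounds *)

Section Controlled.
Context {R : realType} {n p : nat}.
Local Notation E k := (delta_mx 0 k : 'rV[R]_n).
Variable F : 'I_p -> 'rV[R]_n -> 'rV[R]_n.
Hypothesis HF : forall i, is_C2 (F i).

(** The drift counts as one of the [p] fields, which makes the dynamics linear in [u]; its
    coefficient 1 is supplied later by [vext]. *)
Definition G (x : 'rV[R]_n) (u : 'rV[R]_p) : 'rV[R]_n := \sum_(i < p) u 0 i *: F i x.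
Definition DG (x : 'rV[R]_n) (u : 'rV[R]_p) (h : 'rV[R]_n) : 'rV[R]_n :=
  \sum_(i < p) u 0 i *: 'D_h (F i) x.
Definition D2G (x : 'rV[R]_n) (u : 'rV[R]_p) (v w : 'rV[R]_n) : 'rV[R]_n :=
  \sum_(i < p) u 0 i *: 'D_w ('D_v (F i)) x.

Lemma combo_norm_le (u : 'rV[R]_p) (a : 'I_p -> 'rV[R]_n) (c : 'I_p -> 'I_n -> R) r :
  0 <= r -> (forall i j, 0 <= c i j) -> (forall i j, `|a i 0 j| <= c i j * r) ->
  `|\sum_(i < p) u 0 i *: a i| <= (\sum_(i < p) \sum_(j < n) c i j) * (`|u| * r).
Proof.
move=> r0 c0 ac.
have S0 i : 0 <= \sum_(j < n) c i j by apply: sumr_ge0.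
apply: rV_norm_le => [|j].
  by rewrite !mulr_ge0// sumr_ge0.
rewrite summxE; apply: sum_norm_le => [|i]; first by rewrite mulr_ge0.
rewrite mxE normrM mulrCA ler_pM//; first exact: rV_norm_ge.
apply: (le_trans (ac i j)); rewrite ler_wpM2r//.
by rewrite (bigD1 j)//= lerDl sumr_ge0.
Qed.

Lemma C2_all (g : 'rV[R]_n -> R) rho : C2s g -> exists C : R, [/\ 0 <= C,
  (forall x, box rho x -> `|g x| <= C),
  (forall x v, box rho x -> `|'D_v g x| <= C * `|v|),
  (forall x v w, box rho x -> `|'D_w ('D_v g) x| <= C * (`|v| * `|w|)) &
  (forall x y z, box rho x -> box rho y -> box rho z ->
    `|g x - g y - 'D_(x - y) g z| <= C * ((`|x - z| + `|y - z|) * `|x - y|))].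
Proof.
move=> Cg; have [d1 d2 d3] := Cg.
have cg : continuous g by move=> x; exact: differentiable_continuous.
have [C1 C10 H1] := cont_bounded rho cg.
have [C2 C20 H2] := C2_d1 rho d1 d2.
have [C3 C30 H3] := C2_d2 rho Cg.
have [C4 C40 H4] := C2_strict rho Cg.
exists (C1 + C2 + C3 + C4); split=> [|x xr|x v xr|x v w xr|x y z xr yr zr].
- by rewrite !addr_ge0.
- by rewrite (le_trans (H1 _ xr))// -!addrA lerDl !addr_ge0.
- by rewrite (le_trans (H2 _ _ xr))// ler_wpM2r//; lra.
- by rewrite (le_trans (H3 _ _ _ xr))// ler_wpM2r ?mulr_ge0//; lra.
- rewrite (le_trans (H4 _ _ _ xr yr zr))// -mulrA ler_wpM2r ?mulr_ge0 ?addr_ge0//; lra.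
Qed.

(** Every bound is linear in [|u|], so it applies as well to a difference of controls and to an
    integrable direction with no uniform bound. *)
Definition Gbounds (rho C : R) : Prop := [/\
  (forall x u, box rho x -> `|G x u| <= C * `|u|),
  (forall x u h, box rho x -> `|DG x u h| <= C * (`|u| * `|h|)),
  (forall x u v w, box rho x -> `|D2G x u v w| <= C * (`|u| * (`|v| * `|w|))),
  (forall x y u, box rho x -> box rho y -> `|G x u - G y u| <= C * (`|u| * `|x - y|)) &
  (forall x y z u, box rho x -> box rho y -> box rho z ->
    `|G x u - G y u - DG z u (x - y)| <= C * (`|u| * ((`|x - z| + `|y - z|) * `|x - y|)))].

Lemma dF i x : differentiable (F i) x. Proof. by have [] := HF i. Qed.

Lemma d2F i v x : differentiable ('D_v (F i)) x. Proof. by have [_ []] := HF i. Qed.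

Lemma derF i x v : derivable (F i) x v. Proof. exact/diff_derivable/dF. Qed.

Lemma der2F i w x v : derivable ('D_w (F i)) x v. Proof. exact/diff_derivable/d2F. Qed.

Lemma D2_coord i v w x j : ('D_w ('D_v (F i)) x) 0 j = 'D_w ('D_v (fun y => F i y 0 j)) x.
Proof.
rewrite derive_coord; last exact: der2F.
by congr ('D_w _ x); apply/funext => y; rewrite derive_coord//; exact: derF.
Qed.

Lemma G_bounds rho : exists2 C, 1 <= C & Gbounds rho C.
Proof.
have /choice[c Hc] : forall ij : 'I_p * 'I_n, exists C : R, [/\ 0 <= C,
  (forall x, box rho x -> `|F ij.1 x 0 ij.2| <= C),
  (forall x v, box rho x -> `|('D_v (F ij.1) x) 0 ij.2| <= C * `|v|),
  (forall x v w, box rho x -> `|('D_w ('D_v (F ij.1)) x) 0 ij.2| <= C * (`|v| * `|w|)) &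
  (forall x y z, box rho x -> box rho y -> box rho z ->
    `|(F ij.1 x - F ij.1 y - 'D_(x - y) (F ij.1) z) 0 ij.2| <= C * ((`|x - z| + `|y - z|) * `|x - y|))].
  move=> [i j]/=; have [C [C0 H1 H2 H3 H4]] := C2_all rho (is_C2_coord j (HF i)).
  exists C; split=> // [x v xr|x v w xr|x y z xr yr zr].
  - by rewrite derive_coord ?H2//; exact: derF.
  - by rewrite D2_coord H3.
  - by rewrite !mxE derive_coord ?H4//; exact: derF.
have c0 i j : 0 <= c (i, j) by case: (Hc (i, j)).
pose S := \sum_(i < p) \sum_(j < n) c (i, j).
have S0 : 0 <= S by apply: sumr_ge0 => i _; apply: sumr_ge0.
have up (a b : R) : 0 <= b -> a <= S * b -> a <= (1 + S) * b.
  by move=> b0 /le_trans; apply; rewrite ler_wpM2r// lerDr.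
exists (1 + S); first by rewrite lerDl.
split=> [x u xr|x u h xr|x u v w xr|x y u xr yr|x y z u xr yr zr].
- apply: up => //; rewrite -[`|u|]mulr1; apply: (@combo_norm_le _ _ (fun i j => c (i, j))) => // i j.
  by rewrite mulr1; case: (Hc (i, j)) => _ H _ _ _; exact: H.
- apply: up; first by rewrite mulr_ge0.
  apply: (@combo_norm_le _ _ (fun i j => c (i, j))) => // i j.
  by case: (Hc (i, j)) => _ _ H _ _; exact: H.
- apply: up; first by rewrite !mulr_ge0.
  apply: (@combo_norm_le _ _ (fun i j => c (i, j))) => // i j.
  by case: (Hc (i, j)) => _ _ _ H _; exact: H.
- apply: up; first by rewrite !mulr_ge0.
  rewrite -sumrB; under eq_bigr do rewrite -scalerBr.
  apply: (@combo_norm_le _ _ (fun i j => c (i, j))) => // i j.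
  case: (Hc (i, j)) => _ _ H _ _; rewrite !mxE.
  apply: (@mvt_lip _ _ (fun x => F i x 0 j) rho) => //.
    by move=> q; apply: differentiable_coordE; exact: dF.
  by move=> q v qr; rewrite -derive_coord; [exact: H|exact: derF].
- apply: up; first by rewrite !mulr_ge0// addr_ge0.
  rewrite -sumrB -sumrB; under eq_bigr do rewrite -!scalerBr.
  apply: (@combo_norm_le _ _ (fun i j => c (i, j))) => // i j.
  by case: (Hc (i, j)) => _ _ _ _ H; exact: H.
Qed.

Lemma taylor_entry (a b c d : 'rV[R]_n) (r : R) j :
  (a - b - c - r *: d) 0 j = a 0 j - b 0 j - c 0 j - r * d 0 j.
Proof. by rewrite !mxE. Qed.

Lemma G_taylor rho (k : R) : 0 < k -> exists2 d, 0 < d & forall x h u, box rho x -> `|h| < d ->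
  `|G (x + h) u - G x u - DG x u h - 2^-1 *: D2G x u h h| <= k * (`|u| * (`|h| * `|h|)).
Proof.
move=> k0; pose K := k / ((p * n)%:R + 1).
have K0 : 0 < K by rewrite divr_gt0// ltr_wpDl.
have [d d0 HD] : exists2 d, 0 < d & forall ij : 'I_p * 'I_n, forall x h, box rho x -> `|h| < d ->
   `|(F ij.1 (x + h) - F ij.1 x - 'D_h (F ij.1) x - 2^-1 *: 'D_h ('D_h (F ij.1)) x) 0 ij.2| <= K * (`|h| * `|h|).
  apply: ex_common_radius => [i d d' H /andP[_ d'd] x h xr hd|[i j]/=].
    by apply: H => //; exact: lt_le_trans d'd.
  have [d d0 Hd] := taylor2 rho (is_C2_coord j (HF i)) K0.
  exists d => // x h xr hd.
  rewrite taylor_entry (D2_coord i h h x j) (derive_coord j (@derF i x h)).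
  exact: Hd.
exists d => // x h u xr hd.
rewrite scaler_sumr -!sumrB; under eq_bigr do rewrite scalerA [2^-1 * _]mulrC -scalerA -!scalerBr.
apply: (le_trans (@combo_norm_le _ _ (fun i j => K) (`|h| * `|h|) _ _ _)).
- by rewrite mulr_ge0.
- by move=> _ _; exact: ltW.
- by move=> i j; exact: (HD (i, j)).
rewrite ler_wpM2r ?mulr_ge0//.
under eq_bigr do rewrite sumr_const card_ord.
rewrite sumr_const card_ord -mulrnA mulnC -mulr_natr /K.
rewrite mulrAC ler_pdivrMr ?ltr_wpDl// ler_wpM2l ?(ltW k0)//.
by rewrite lerDl.
Qed.

Lemma G_addu x u v : G x (u + v) = G x u + G x v.
Proof. by rewrite /G -big_split; apply: eq_bigr => i _; rewrite mxE scalerDl. Qed.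

Lemma G_scaleu x c u : G x (c *: u) = c *: G x u.
Proof. by rewrite /G scaler_sumr; apply: eq_bigr => i _; rewrite mxE scalerA. Qed.

Lemma G_subu x u v : G x (u - v) = G x u - G x v.
Proof. by rewrite G_addu -scaleN1r G_scaleu scaleN1r. Qed.

Lemma DG_addu x u v h : DG x (u + v) h = DG x u h + DG x v h.
Proof. by rewrite /DG -big_split; apply: eq_bigr => i _; rewrite mxE scalerDl. Qed.

Lemma DG_scaleu x c u h : DG x (c *: u) h = c *: DG x u h.
Proof. by rewrite /DG scaler_sumr; apply: eq_bigr => i _; rewrite mxE scalerA. Qed.

Lemma DG_subu x u v h : DG x (u - v) h = DG x u h - DG x v h.
Proof. by rewrite DG_addu -scaleN1r DG_scaleu scaleN1r. Qed.

Lemma DG_linh x u c h k : DG x u (c *: h + k) = c *: DG x u h + DG x u k.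
Proof.
rewrite /DG scaler_sumr -big_split; apply: eq_bigr => i _.
by rewrite derive_lin ?scalerDr ?scalerA 1?mulrC//; exact: dF.
Qed.

Lemma DG_subh x u h k : DG x u (h - k) = DG x u h - DG x u k.
Proof. by rewrite addrC -scaleN1r DG_linh scaleN1r addrC. Qed.

Lemma DG_scaleh x u c h : DG x u (c *: h) = c *: DG x u h.
Proof.
have := DG_linh x u c h 0; rewrite addr0 => ->.
by have := DG_subh x u 0 0; rewrite !subrr => ->; rewrite addr0.
Qed.

Lemma D2G_sub2 x u h k w : D2G x u w (h - k) = D2G x u w h - D2G x u w k.
Proof.
rewrite /D2G -sumrB; apply: eq_bigr => i _.
by rewrite addrC -scaleN1r derive_lin ?scaleN1r 1?addrC ?scalerBr//; exact: d2F.
Qed.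

Lemma D2G_sub1 x u h k w : D2G x u (h - k) w = D2G x u h w - D2G x u k w.
Proof.
rewrite /D2G -sumrB; apply: eq_bigr => i _; rewrite -scalerBr; congr (_ *: _).
rewrite (derive_basis2 x (h - k) w (dF i) (d2F i)) (derive_basis2 x h w (dF i) (d2F i)).
rewrite (derive_basis2 x k w (dF i) (d2F i)).
rewrite -sumrB; apply: eq_bigr => a _; rewrite -sumrB; apply: eq_bigr => b _.
by rewrite !mxE mulrBl scalerBl.
Qed.

Lemma D2G_scale x u (c : R) h : D2G x u (c *: h) (c *: h) = c ^+ 2 *: D2G x u h h.
Proof.
rewrite /D2G scaler_sumr; apply: eq_bigr => i _.
rewrite scalerA mulrC -scalerA; congr (_ *: _).
rewrite (derive_basis2 x (c *: h) (c *: h) (dF i) (d2F i)) (derive_basis2 x h h (dF i) (d2F i)).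
rewrite scaler_sumr; apply: eq_bigr => a _; rewrite scaler_sumr; apply: eq_bigr => b _.
by rewrite !mxE scalerA; congr (_ *: _); ring.
Qed.

End Controlled.

(** * Measurability along curves, and truncation to a box *)

Section Measurability.
Context {R : realType} (T : R) {n p : nat}.
Local Notation I0T := (`[0, T]%classic : set R).
Local Notation E k := (delta_mx 0 k : 'rV[R]_n).
Implicit Types (x h z : R -> 'rV[R]_n) (u : R -> 'rV[R]_p).

Lemma contTZ (V : normedModType R) (c : R -> R) (x : R -> V) :
  contT T c -> contT T x -> contT T (fun t => c t *: x t).
Proof. by move=> cc cx t; apply: (continuousZ (cc t) (cx t)). Qed.

Lemma contT_sum (V : normedModType R) (I : Type) (s : seq I) (x : I -> R -> V) :
  (forall i, contT T (x i)) -> contT T (fun t => \sum_(i <- s) x i t).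
Proof.
move=> cx; elim: s => [|i s IH].
  by apply: (@contT_ext _ _ _ (fun=> 0)) => [t _|]; [rewrite big_nil|exact: contT_cst].
apply: (@contT_ext _ _ _ (fun t => x i t + \sum_(i <- s) x i t)); last exact: contTD.
by move=> t _; rewrite big_cons.
Qed.

Lemma contT_derive (W : normedModType R) (g : 'rV[R]_n -> W) x h :
  (forall y, differentiable g y) -> (forall v, continuous ('D_v g)) ->
  contT T x -> contT T h -> contT T (fun t => 'D_(h t) g (x t)).
Proof.
move=> dg cD cx ch.
apply: (@contT_ext _ _ _ (fun t => \sum_(k < n) h t 0 k *: 'D_(E k) g (x t))).
  by move=> t _; rewrite -derive_basis.
apply: contT_sum => k; apply: contTZ; first exact: contT_coord.
by apply: (@contT_comp _ _ _ _ x ('D_(E k) g)) => //; exact: cD.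
Qed.

Lemma contT_derive2 (W : normedModType R) (g : 'rV[R]_n -> W) x h z :
  (forall y, differentiable g y) -> (forall v y, differentiable ('D_v g) y) ->
  (forall v w, continuous ('D_w ('D_v g))) ->
  contT T x -> contT T h -> contT T z -> contT T (fun t => 'D_(z t) ('D_(h t) g) (x t)).
Proof.
move=> d1 d2 cD cx ch cz.
apply: (@contT_ext _ _ _ (fun t => \sum_(k < n) \sum_(l < n) (h t 0 k * z t 0 l) *: 'D_(E l) ('D_(E k) g) (x t))).
  by move=> t _; rewrite -derive_basis2.
apply: contT_sum => k; apply: contT_sum => l; apply: contTZ.
  by apply: contTM; exact: contT_coord.
by apply: (@contT_comp _ _ _ _ x ('D_(E l) ('D_(E k) g))) => //; exact: cD.
Qed.

Lemma comb_bmeas (a : 'I_p -> R -> 'rV[R]_n) u j : (forall i, contT T (a i)) ->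
  (forall i, bmeas T (fun t => u t 0 i)) ->
  bmeas T (fun t => (\sum_(i < p) u t 0 i *: a i t) 0 j).
Proof.
move=> ca bu; under eq_fun do rewrite summxE.
apply: bmeas_sum => i; under eq_fun do rewrite mxE.
by apply: bmeasM => //; exact/contT_bmeas/contT_coord.
Qed.

Lemma comb_integ (a : 'I_p -> R -> 'rV[R]_n) u j : (forall i, contT T (a i)) ->
  (forall i, integ T (fun t => u t 0 i)) ->
  integ T (fun t => (\sum_(i < p) u t 0 i *: a i t) 0 j).
Proof.
move=> ca bu; under eq_fun do rewrite summxE.
apply: integ_sum => i; under eq_fun do rewrite mxE.
by apply: integMr => //; exact/contT_bmeas/contT_coord.
Qed.

Lemma meas_vnorm k (v : R -> 'rV[R]_k) : (forall i, measurable_fun I0T (fun t => v t 0 i)) ->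
  measurable_fun I0T (fun t => `|v t|).
Proof.
move=> mv.
have E t : `|v t| = \big[Num.max/0]_ij `|v t ij.1 ij.2| by rewrite [LHS]/Num.norm/= mx_normrE.
rewrite (_ : (fun t => `|v t|) = fun t => \big[Num.max/0]_ij `|v t ij.1 ij.2|); last exact/funext.
elim: (index_enum _) => [|ij s IH].
  by under [X in measurable_fun _ X]eq_fun do rewrite big_nil; exact: measurable_cst.
under [X in measurable_fun _ X]eq_fun do rewrite big_cons; apply: measurable_maxr => //.
by apply: measurableT_comp => //; rewrite ord1.
Qed.

Lemma integ_vnorm k (v : R -> 'rV[R]_k) : (forall i, integ T (fun t => v t 0 i)) ->
  integ T (fun t => `|v t|).
Proof.
move=> iv; apply: (@integ_le _ _ _ (fun t => \sum_i `|v t 0 i|)).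
- by apply: meas_vnorm => i; exact: integ_meas.
- by apply: integ_sum => i; apply: integ_norm.
- move=> t _; rewrite normr_id; apply: rV_norm_le => [|i].
    by apply: sumr_ge0.
  by rewrite (bigD1 i)//= lerDl sumr_ge0.
Qed.

(** A 1-Lipschitz retraction onto the box: composed with it, a field that is Lipschitz on the box
    becomes globally Lipschitz, as [picard] requires. *)
Definition clamp (rho : R) (x : 'rV[R]_n) : 'rV[R]_n :=
  \row_j Num.max (- rho) (Num.min rho (x 0 j)).

Lemma clamp_box rho (x : 'rV[R]_n) : 0 <= rho -> box rho (clamp rho x).
Proof.
move=> r0; apply: rV_norm_le => // j; rewrite mxE ler_norml; apply/andP; split.
  by rewrite le_max lexx.
by rewrite ge_max ge_min lexx (le_trans _ r0)// oppr_le0.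
Qed.

Lemma clamp_id rho (x : 'rV[R]_n) : box rho x -> clamp rho x = x.
Proof.
move=> xr; apply/rowP => j; rewrite mxE.
have : `|x 0 j| <= rho by exact: le_trans (rV_norm_ge _ _) xr.
by rewrite ler_norml => /andP[a b]; rewrite (min_idPr b) (max_idPr a).
Qed.

Lemma clamp_lip rho (x y : 'rV[R]_n) : `|clamp rho x - clamp rho y| <= `|x - y|.
Proof.
apply: rV_norm_le => // j; rewrite !mxE.
apply: le_trans (rV_norm_ge _ j); rewrite !mxE.
move: (x 0 j) (y 0 j) => a b.
rewrite ler_norml; apply/andP.
have := ler_norm (a - b); have := ler_norm (b - a); rewrite [`|b - a|]distrC.
move: `|a - b| => N.
by case: (leP rho a); case: (leP rho b); case: (leP (- rho) rho);
  case: (leP (- rho) a); case: (leP (- rho) b); split; lra.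
Qed.

Lemma clamp_cont rho : continuous (clamp rho).
Proof.
move=> x; have FF : Filter (nbhs x) by exact: nbhs_filter.
apply/(@cvgrPdist_lt _ _ _ (nbhs x) FF) => e e0.
change (nbhs x (fun y => `|clamp rho x - clamp rho y| < e)).
apply/(@nbhs_normP _ 'rV[R]_n x); exists e => //= y.
exact: le_lt_trans (clamp_lip _ _ _).
Qed.

End Measurability.

(** * Trajectories near the reference one and their endpoints *)

Section Trajectories.
Context {R : realType} (T : R) {n p : nat}.
Local Notation leb := (@lebesgue_measure R).
Local Notation I0T := (`[0, T]%classic : set R).
Local Notation E k := (delta_mx 0 k : 'rV[R]_n).
Variable F : 'I_p -> 'rV[R]_n -> 'rV[R]_n.
Hypothesis HF : forall i, is_C2 (F i).
Hypothesis T0 : 0 < T.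
Variables (xh : R -> 'rV[R]_n) (uh : R -> 'rV[R]_p) (C rho Mu : R).

Definition bm k (u : R -> 'rV[R]_k) := forall i, bmeas T (fun t => u t 0 i).

Hypothesis buh : bm uh.
Hypothesis dxh : is_deriv T xh (fun t => G F (xh t) (uh t)).
Hypothesis C1 : 1 <= C.
Hypothesis GB : Gbounds F rho C.
Hypothesis xhB : forall t, I0T t -> `|xh t| + 1 <= rho.
Hypothesis Mu0 : 0 <= Mu.
Hypothesis uhB : forall t, I0T t -> `|uh t| <= Mu.

Implicit Types (x h z : R -> 'rV[R]_n) (u v : R -> 'rV[R]_p).

(** A Lipschitz constant in the state for all controls within distance 1 of [uh]; [grc] is the
    factor that [gronwall_deriv] attaches to it. *)
Definition lipc := C * (Mu + 1).
Definition grc := 2 * expR (2 * lipc * T).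
(** The tube of radius 1 about [xh] lies in the box of radius [rho], where [Gbounds] applies. *)
Definition sol (u : R -> 'rV[R]_p) (x : R -> 'rV[R]_n) :=
  [/\ is_deriv T x (fun t => G F (x t) (u t)), x 0 = xh 0 &
      forall t, I0T t -> `|x t - xh t| <= 1].

Let C0 : 0 <= C. Proof. exact: le_trans C1. Qed.

Let lipc0 : 0 < lipc.
Proof. by rewrite mulr_gt0// ?(lt_le_trans _ C1)// ltr_wpDl. Qed.

Let grc0 : 0 <= grc. Proof. by rewrite mulr_ge0// expR_ge0. Qed.

Let T0' : 0 <= T. Proof. exact: ltW. Qed.

Let I00 : I0T 0. Proof. by rewrite /= in_itv/= lexx. Qed.

Let ITT : I0T T. Proof. by rewrite /= in_itv/= lexx T0'. Qed.

Let cxh : contT T xh. Proof. exact: is_deriv_contT dxh. Qed.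

Lemma xh_box t : I0T t -> box rho (xh t).
Proof. by move=> tT; have := xhB tT; rewrite /box/=; lra. Qed.

Lemma rho0 : 0 <= rho.
Proof. by rewrite (le_trans _ (xh_box I00)). Qed.

Lemma tube_box (x : R -> 'rV[R]_n) t : I0T t -> `|x t - xh t| <= 1 -> box rho (x t).
Proof.
move=> tT xt; rewrite /box/= (le_trans _ (xhB tT))//.
by rewrite -{1}(subrK (xh t) (x t)) addrC (le_trans (ler_normD _ _))// lerD2l.
Qed.

Lemma contF i x : contT T x -> contT T (fun t => F i (x t)).
Proof.
by move=> cx; apply: contT_comp => // y; apply: differentiable_continuous; exact: dF.
Qed.

Lemma bm_G x u : contT T x -> bm u -> bm (fun t => G F (x t) (u t)).
Proof. by move=> cx bu j; apply: comb_bmeas => // i; exact: contF. Qed.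

Lemma integ_G x u j : contT T x -> (forall i, integ T (fun t => u t 0 i)) ->
  integ T (fun t => G F (x t) (u t) 0 j).
Proof. by move=> cx bu; apply: comb_integ => // i; exact: contF. Qed.

Lemma contDF i (v : 'rV[R]_n) : continuous ('D_v (F i)).
Proof. by move=> y; apply: differentiable_continuous; exact: d2F. Qed.

Lemma bm_DG x u h : contT T x -> bm u -> contT T h -> bm (fun t => DG F (x t) (u t) (h t)).
Proof.
move=> cx bu ch j; apply: comb_bmeas => // i; apply: contT_derive => //.
- by move=> y; exact: dF.
- exact: contDF.
Qed.

Lemma integ_DG x u h j : contT T x -> (forall i, integ T (fun t => u t 0 i)) -> contT T h ->
  integ T (fun t => DG F (x t) (u t) (h t) 0 j).
Proof.
move=> cx bu ch; apply: comb_integ => // i; apply: contT_derive => //.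
- by move=> y; exact: dF.
- exact: contDF.
Qed.

Lemma bm_D2G x u h z : contT T x -> bm u -> contT T h -> contT T z ->
  bm (fun t => D2G F (x t) (u t) (h t) (z t)).
Proof.
move=> cx bu ch cz j; apply: comb_bmeas => // i; have [d1 [d2 d3]] := HF i.
exact: contT_derive2.
Qed.

Lemma bmD k (u v : R -> 'rV[R]_k) : bm u -> bm v -> bm (fun t => u t + v t).
Proof. by move=> bu bv i; under eq_fun do rewrite mxE; exact: bmeasD. Qed.

Lemma bmZ k c (u : R -> 'rV[R]_k) : bm u -> bm (fun t => c *: u t).
Proof. by move=> bu i; under eq_fun do rewrite mxE; exact/bmeasM/bu/bmeas_cst. Qed.

Lemma bmB k (u v : R -> 'rV[R]_k) : bm u -> bm v -> bm (fun t => u t - v t).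
Proof. by move=> bu bv i; under eq_fun do rewrite !mxE; exact: bmeasB. Qed.

Lemma norm_uh u (s t : R) : I0T t -> `|u t - uh t| <= s -> `|u t| <= Mu + s.
Proof.
move=> tT us; rewrite -(subrK (uh t) (u t)) addrC (le_trans (ler_normD _ _))//.
by rewrite lerD// uhB.
Qed.

Lemma int_cstT (c : R) : \int[leb]_(s in `[0, T]) c = c * T.
Proof. exact: (@Rint_cst _ T). Qed.

Lemma integ_cst (c : R) : integ T (fun=> c).
Proof. exact/bmeas_integ/bmeas_cst. Qed.

(** The equation is solved with the clamped state. Gronwall's inequality keeps this solution in the
    tube when the control is close to [uh], and there clamping changes nothing. *)
Lemma sol_exists u s : bm u -> 0 <= s <= 1 -> (forall t, I0T t -> `|u t - uh t| <= s) ->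
  grc * (C * s * T) <= 1 -> exists x, sol u x.
Proof.
move=> bu /andP[s0 s1] us small.
have [b0 _ _ bl _] := GB.
have cb (y : 'rV[R]_n) : box rho (clamp rho y) by exact: (clamp_box _ rho0).
have uM t : I0T t -> `|u t| <= Mu + 1.
  by move=> tT; rewrite (le_trans (norm_uh tT (us _ tT)))// lerD2l.
have [x [dx x0]] : exists x, is_deriv T x (fun t => G F (clamp rho (x t)) (u t)) /\ x 0 = xh 0.
  apply: (@picard R T n (fun t y => G F (clamp rho y) (u t)) lipc) => //.
    by move=> x cx; apply: bm_G => //; apply: contT_comp => //; exact: clamp_cont.
  move=> t a b tT; rewrite (le_trans (bl _ _ _ (cb _) (cb _)))//.
  rewrite /lipc -!mulrA ler_wpM2l// ler_pM// ?uM//.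
  exact: clamp_lip.
have cx := is_deriv_contT T0' dx.
have dd := is_derivB dx dxh.
have H t : I0T t -> `|x t - xh t| <= 1.
  move=> tT; apply: le_trans small.
  have := @gronwall_deriv R T n _ _ (fun=> C * s) lipc T0' lipc0 dd _ (integ_cst _) _ _ t tT.
  rewrite int_cstT => -> //; first by rewrite x0 subrr.
  - by move=> r _; rewrite mulr_ge0.
  - move=> r rT; have xr := xh_box rT.
    have -> : G F (clamp rho (x r)) (u r) - G F (xh r) (uh r) =
      (G F (clamp rho (x r)) (u r) - G F (clamp rho (xh r)) (u r)) + G F (xh r) (u r - uh r).
      by rewrite (clamp_id xr) G_subu addrA subrK.
    rewrite (le_trans (ler_normD _ _))// lerD//.
      rewrite (le_trans (bl _ _ _ (cb _) (cb _)))//.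
      rewrite /lipc -!mulrA ler_wpM2l// ler_pM// ?uM//.
      exact: clamp_lip.
    by rewrite (le_trans (b0 _ _ xr))// ler_wpM2l// us.
exists x; split => //.
by apply: is_deriv_ext dx => t tT; rewrite clamp_id//; apply: tube_box => //; exact: H.
Qed.

Lemma sol_lip u1 u2 x1 x2 s : sol u1 x1 -> sol u2 x2 -> 0 <= s ->
  (forall t, I0T t -> `|u1 t - uh t| <= 1) -> (forall t, I0T t -> `|u1 t - u2 t| <= s) ->
  forall t, I0T t -> `|x1 t - x2 t| <= grc * C * T * s.
Proof.
move=> [d1 x10 B1] [d2 x20 B2] s0 u1B us t tT.
have [b0 _ _ bl _] := GB.
have -> : grc * C * T * s = grc * (C * s * T) by ring.
have := @gronwall_deriv R T n _ _ (fun=> C * s) lipc T0' lipc0 (is_derivB d1 d2) _ (integ_cst _) _ _ t tT.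
rewrite int_cstT => -> //; first by rewrite x10 x20 subrr.
- by move=> r _; rewrite mulr_ge0.
- move=> r rT; have X1 := tube_box rT (B1 _ rT); have X2 := tube_box rT (B2 _ rT).
  have -> : G F (x1 r) (u1 r) - G F (x2 r) (u2 r) =
    (G F (x1 r) (u1 r) - G F (x2 r) (u1 r)) + G F (x2 r) (u1 r - u2 r).
    by rewrite G_subu addrA subrK.
  rewrite (le_trans (ler_normD _ _))// lerD//.
    rewrite (le_trans (bl _ _ _ X1 X2))// /lipc -!mulrA ler_wpM2l// ler_wpM2r//.
    exact: norm_uh (u1B _ rT).
  by rewrite (le_trans (b0 _ _ X2))// ler_wpM2l// us.
Qed.

Lemma sol_xh : sol uh xh.
Proof. by split => // t _; rewrite subrr normr0 ler01. Qed.

Definition Amx (t : R) : 'M[R]_n := \matrix_(k, l) DG F (xh t) (uh t) (E k) 0 l.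

Lemma mul_Amx t (h : 'rV[R]_n) : h *m Amx t = DG F (xh t) (uh t) h.
Proof.
apply/rowP => l; rewrite mxE /DG summxE.
under eq_bigr do rewrite mxE summxE mulr_sumr.
rewrite exchange_big/=; apply: eq_bigr => i _.
rewrite [in RHS](derive_basis _ (dF HF i _)) [RHS]mxE summxE mulr_sumr.
by apply: eq_bigr => k _; rewrite !mxE; ring.
Qed.

Lemma bAmx k l : bmeas T (fun t => Amx t k l).
Proof. by under eq_fun do rewrite mxE; apply: bm_DG => //; exact: contT_cst. Qed.

Variable Psi : 'I_n -> R -> 'rV[R]_n.
Hypothesis PsiS : forall j, adj_sol T Amx (Psi j).
Hypothesis PsiT : forall j, Psi j T = E j.
Variable BP : R.
Hypothesis BP0 : 0 <= BP.
Hypothesis PsiB : forall j t, I0T t -> `|Psi j t| <= BP.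

Definition Y (g : R -> 'rV[R]_n) : 'rV[R]_n := \row_j \int[leb]_(t in `[0, T]) dot (Psi j t) (g t).

Lemma cPsi j : contT T (Psi j). Proof. exact: is_deriv_contT (PsiS j). Qed.

Lemma integ_dot (psi g : R -> 'rV[R]_n) : contT T psi -> (forall i, integ T (fun t => g t 0 i)) ->
  integ T (fun t => dot (psi t) (g t)).
Proof.
move=> cp ig; apply: integ_sum => i; apply: integMl => //.
exact/contT_bmeas/contT_coord.
Qed.

Definition ig (g : R -> 'rV[R]_n) := forall i, integ T (fun t => g t 0 i).

Lemma bm_ig g : bm g -> ig g. Proof. by move=> bg i; exact: bmeas_integ. Qed.

Lemma igD g h : ig g -> ig h -> ig (fun t => g t + h t).
Proof. by move=> gi hi i; under eq_fun do rewrite mxE; exact: integD. Qed.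

Lemma igZ c g : ig g -> ig (fun t => c *: g t).
Proof. by move=> gi i; under eq_fun do rewrite mxE; exact/integZ. Qed.

Lemma igB g h : ig g -> ig h -> ig (fun t => g t - h t).
Proof. by move=> gi hi i; under eq_fun do rewrite !mxE; exact: integB. Qed.

Lemma YD g h : ig g -> ig h -> Y (fun t => g t + h t) = Y g + Y h.
Proof.
move=> gi hi; apply/rowP => j; rewrite !mxE -RintegralD//; last 2 first.
- exact: (integ_dot (@cPsi j) gi).
- exact: (integ_dot (@cPsi j) hi).
apply: eq_Rintegral => t _; rewrite /dot -big_split; apply: eq_bigr => i _.
by rewrite mxE mulrDr.
Qed.

Lemma YZ c g : ig g -> Y (fun t => c *: g t) = c *: Y g.
Proof.
move=> gi; apply/rowP => j; rewrite !mxE -RintegralZl//; last first.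
  exact: (integ_dot (@cPsi j) gi).
apply: eq_Rintegral => t _; rewrite /dot mulr_sumr; apply: eq_bigr => i _.
by rewrite mxE mulrCA.
Qed.

Lemma Y_ext g h : (forall t, I0T t -> g t = h t) -> Y g = Y h.
Proof.
by move=> gh; apply/rowP => j; rewrite !mxE; apply: eq_Rintegral => t; rewrite inE => /gh ->.
Qed.

Lemma YB g h : ig g -> ig h -> Y (fun t => g t - h t) = Y g - Y h.
Proof.
move=> gi hi; rewrite -scaleN1r -YZ// -YD//; last exact: igZ.
by apply: Y_ext => t _; rewrite scaleN1r.
Qed.

Lemma Y_norm_le g (b : R -> R) : ig g -> integ T b -> (forall t, I0T t -> `|g t| <= b t) ->
  `|Y g| <= n%:R * BP * \int[leb]_(t in `[0, T]) b t.
Proof.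
move=> gi ib gb; have b0 t : I0T t -> 0 <= b t by move=> /gb; exact: le_trans.
apply: rV_norm_le => [|j].
  by rewrite !mulr_ge0//; apply: Rintegral_ge0.
rewrite mxE -RintegralZl//.
apply: (Rint_norm_le ITT) => //; [exact: (integ_dot (@cPsi j) gi)|exact: integZ|move=> t tT].
rewrite (le_trans (dot_norm_le _ _))// -!mulrA ler_wpM2l// ler_pM//; first exact: PsiB.
exact: gb.
Qed.

(** Pairing with [Psi j], whose terminal value is a basis vector, extracts the [j]-th coordinate.
    The lemma is also applied to differences of nonlinear trajectories, all that is not linear in
    their equation being counted as source. *)
Lemma Y_sol (d y g : R -> 'rV[R]_n) : is_deriv T d y -> d 0 = 0 ->
  (forall t, I0T t -> y t = DG F (xh t) (uh t) (d t) + g t) -> d T = Y g.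
Proof.
move=> dy d0 yE; apply/rowP => j; rewrite mxE.
have := @adj_pair R T n Amx bAmx T0 (Psi j) d y g (PsiS j) dy.
rewrite PsiT d0 dotC dot_deltar => ->; last by move=> t tT; rewrite mul_Amx yE.
by rewrite /dot big1 ?add0r// => i _; rewrite mxE mulr0.
Qed.

Section Expansion.
Variables (z : R -> 'rV[R]_n) (v : R -> 'rV[R]_p).
Hypothesis iv : forall i, integ T (fun t => v t 0 i).
Hypothesis dz : is_deriv T z (fun t => DG F (xh t) (uh t) (z t) + G F (xh t) (v t)).
Hypothesis z0 : z 0 = 0.

Let cz : contT T z. Proof. exact: is_deriv_contT dz. Qed.

(** The error [u - uh - e v] is bounded by an integrable function [b] rather than by a constant
    because [v] may be unbounded; only the integral of [b] enters the estimate. *)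
Lemma first_order u x (b : R -> R) (s D e : R) : sol u x ->
  (forall t, I0T t -> `|u t - uh t| <= s) -> (forall t, I0T t -> `|x t - xh t| <= D) ->
  integ T b -> (forall t, I0T t -> `|u t - uh t - e *: v t| <= b t) ->
  forall t, I0T t -> `|x t - xh t - e *: z t| <=
    grc * (C * ((Mu * (D * D) + s * D) * T + \int[leb]_(t in `[0, T]) b t)).
Proof.
move=> [dx x0 xB] us xD ib ub t tT.
have [b0 b1 _ bl bs] := GB.
have D0 : 0 <= D by exact: le_trans (normr_ge0 _) (xD _ I00).
have s0 : 0 <= s by exact: le_trans (normr_ge0 _) (us _ I00).
have d0 : x 0 - xh 0 - e *: z 0 = 0 by rewrite x0 z0 subrr scaler0 subr0.
have bb0 r : I0T r -> 0 <= b r by move=> /ub; exact: le_trans.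
have dd := is_derivB (is_derivB dx dxh) (is_derivZ e dz).
have ig1 : integ T (fun t => C * (Mu * (D * D) + s * D) + C * b t).
  by apply: integD; [exact: integ_cst|exact: integZ].
have IE : \int[leb]_(t in `[0, T]) (C * (Mu * (D * D) + s * D) + C * b t) =
  C * ((Mu * (D * D) + s * D) * T + \int[leb]_(t in `[0, T]) b t).
  rewrite RintegralD//; last 2 first.
  - exact: (integ_cst (C * (Mu * (D * D) + s * D))).
  - exact: (integZ C ib).
  by rewrite int_cstT RintegralZl//; ring.
have := gronwall_deriv T0' lipc0 dd d0 ig1; rewrite IE.
move=> /(_ _ _ t tT); apply => r rT.
  by rewrite addr_ge0// mulr_ge0// ?addr_ge0 ?mulr_ge0//; exact: bb0.
have X := tube_box rT (xB _ rT); have XH := xh_box rT.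
(* The terms are the linearized dynamics of the deviation, which Gronwall's inequality absorbs, the
   strict differentiability remainder at [uh], the change of state acting on [u - uh], and the
   control error. *)
have -> : G F (x r) (u r) - G F (xh r) (uh r) - e *: (DG F (xh r) (uh r) (z r) + G F (xh r) (v r)) =
   DG F (xh r) (uh r) (x r - xh r - e *: z r)
   + (G F (x r) (uh r) - G F (xh r) (uh r) - DG F (xh r) (uh r) (x r - xh r))
   + (G F (x r) (u r - uh r) - G F (xh r) (u r - uh r))
   + G F (xh r) (u r - uh r - e *: v r).
  rewrite [DG _ _ _ (_ - e *: _)](DG_subh HF) (DG_scaleh HF) !G_subu G_scaleu.
  have id (a b' c d f g h : 'rV[R]_n) : a - b' - e *: (c + d) =
      (f - e *: c) + (g - b' - f) + (a - g - (h - b')) + (h - b' - e *: d).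
    by apply/rowP => j; rewrite !mxE; ring.
  exact: id.
have -> : lipc * `|x r - xh r - e *: z r| + (C * (Mu * (D * D) + s * D) + C * b r) =
  lipc * `|x r - xh r - e *: z r| + C * (Mu * (D * D)) + C * (s * D) + C * b r by ring.
rewrite (le_trans (ler_normD _ _))// lerD//; last first.
  by rewrite (le_trans (b0 _ _ XH))// ler_wpM2l// ub.
rewrite (le_trans (ler_normD _ _))// lerD//; last first.
  rewrite (le_trans (bl _ _ _ X XH))// ler_wpM2l// ler_pM//; first exact: us.
  exact: xD.
rewrite (le_trans (ler_normD _ _))// lerD//.
  rewrite (le_trans (b1 _ _ _ XH))// /lipc -mulrA ler_wpM2l// ler_wpM2r//.
  by rewrite (le_trans (uhB rT))// lerDl.
rewrite (le_trans (bs _ _ _ _ X XH XH))// subrr normr0 addr0.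
by rewrite ler_wpM2l// ler_pM ?mulr_ge0 ?uhB// ler_pM ?xD.
Qed.

Definition Q2 (t : R) : 'rV[R]_n :=
  2^-1 *: D2G F (xh t) (uh t) (z t) (z t) + DG F (xh t) (v t) (z t).

Lemma ig_Q2 : ig Q2.
Proof.
apply: igD; last by move=> j; exact: integ_DG.
by apply/igZ/bm_ig; exact: bm_D2G.
Qed.

(** The deviation [x - xh] solves the linearized equation with a nonlinear source, so by [Y_sol] the
    whole left side is [Y] of one explicit remainder. Here [s], [D] and [Dl] bound [u - uh],
    [x - xh] and [x - xh - e z]. *)
Lemma endpoint_remainder u x (b : R -> R) (s D e k d Dl Z : R) : sol u x -> bm u ->
  (forall t, I0T t -> `|u t - uh t| <= s) -> (forall t, I0T t -> `|x t - xh t| <= D) ->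
  integ T b -> (forall t, I0T t -> `|u t - uh t - e *: v t| <= b t) ->
  (forall t, I0T t -> `|x t - xh t - e *: z t| <= Dl) ->
  (forall t, I0T t -> `|z t| <= Z) -> 0 <= e -> 0 <= k -> D < d ->
  (forall (y h : 'rV[R]_n) (w : 'rV[R]_p), box rho y -> `|h| < d ->
    `|G F (y + h) w - G F y w - DG F y w h - 2^-1 *: D2G F y w h h| <= k * (`|w| * (`|h| * `|h|))) ->
  `|x T - xh T - Y (fun t => G F (xh t) (u t - uh t)) - e ^+ 2 *: Y Q2| <=
    n%:R * BP * ((k * (Mu * (D * D)) + C * (Mu * (Dl * (D + e * Z))) + C * (s * (D * D))) * T
      + C * D * \int[leb]_(t in `[0, T]) b t + e * C * Dl * \int[leb]_(t in `[0, T]) `|v t|).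
Proof.
move=> [dx x0 xB] bu us xD ib ub xDl zZ e0 k0 Dd Htay.
have [b0 b1 b2 bl bs] := GB.
have D0 : 0 <= D by exact: le_trans (normr_ge0 _) (xD _ I00).
have s0 : 0 <= s by exact: le_trans (normr_ge0 _) (us _ I00).
have Z0 : 0 <= Z by exact: le_trans (normr_ge0 _) (zZ _ I00).
have Dl0 : 0 <= Dl by exact: le_trans (normr_ge0 _) (xDl _ I00).
have bb0 r : I0T r -> 0 <= b r by move=> /ub; exact: le_trans.
have cx := is_deriv_contT T0' dx.
have cd : contT T (fun t => x t - xh t) by exact: contTB.
have iGu : ig (fun t => G F (x t) (u t)) by apply/bm_ig/bm_G.
have iGh : ig (fun t => G F (xh t) (uh t)) by apply/bm_ig/bm_G.
have iDG : ig (fun t => DG F (xh t) (uh t) (x t - xh t)) by apply/bm_ig/bm_DG.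
have iB : ig (fun t => G F (xh t) (u t - uh t)) by apply/bm_ig/bm_G => //; exact: bmB.
have iQ := ig_Q2.
have inv := integ_vnorm iv.
pose g t := G F (x t) (u t) - G F (xh t) (uh t) - DG F (xh t) (uh t) (x t - xh t).
have -> : x T - xh T = Y g.
  apply: (@Y_sol (fun t => x t - xh t) _ _ (is_derivB dx dxh)); first by rewrite x0 subrr.
  by move=> t _; rewrite /g [RHS]addrC subrK.
have igg : ig g by apply: igB => //; apply: igB.
rewrite -YB// -YZ// -YB//; [|exact: igB|exact: igZ].
pose B := (k * (Mu * (D * D)) + C * (Mu * (Dl * (D + e * Z))) + C * (s * (D * D))).
have iB1 : integ T (fun t => B + C * D * b t) by apply: integD; [exact: integ_cst|exact: integZ].
have iB2 : integ T (fun t => e * C * Dl * `|v t|) by exact: integZ.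
have -> : B * T + C * D * \int[leb]_(t in `[0, T]) b t + e * C * Dl * \int[leb]_(t in `[0, T]) `|v t| =
   \int[leb]_(t in `[0, T]) (B + C * D * b t + e * C * Dl * `|v t|).
  rewrite [RHS]RintegralD//.
  rewrite [X in _ = X + _]RintegralD//; last 2 first.
  - exact: (integ_cst B).
  - exact: (integZ (C * D) ib).
  by rewrite int_cstT !RintegralZl//.
apply: Y_norm_le; first by apply: igB; [exact: igB|exact: igZ].
  exact: integD.
move=> t tT; have X := tube_box tT (xB _ tT); have XH := xh_box tT.
(* Besides the two expansion remainders, at control [uh] and at control [u - uh], the terms record
   the replacement of [x - xh] by [e z], one argument of the second derivative at a time, and of
   [u - uh] by [e v]. *)
have -> : g t - G F (xh t) (u t - uh t) - e ^+ 2 *: Q2 t =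
   (G F (xh t + (x t - xh t)) (uh t) - G F (xh t) (uh t) - DG F (xh t) (uh t) (x t - xh t)
     - 2^-1 *: D2G F (xh t) (uh t) (x t - xh t) (x t - xh t))
   + 2^-1 *: (D2G F (xh t) (uh t) (x t - xh t - e *: z t) (x t - xh t)
            + D2G F (xh t) (uh t) (e *: z t) (x t - xh t - e *: z t))
   + (G F (x t) (u t - uh t) - G F (xh t) (u t - uh t) - DG F (xh t) (u t - uh t) (x t - xh t))
   + DG F (xh t) (u t - uh t - e *: v t) (x t - xh t) + e *: DG F (xh t) (v t) (x t - xh t - e *: z t).
  rewrite [xh t + _]addrC subrK.
  set dl := x t - xh t.
  rewrite (D2G_sub1 HF (xh t) (uh t) dl (e *: z t) dl).
  rewrite (D2G_sub2 HF (xh t) (uh t) dl (e *: z t) (e *: z t)).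
  rewrite (D2G_scale HF) (DG_subu F (xh t) (u t - uh t) (e *: v t) dl) DG_scaleu.
  rewrite (DG_subh HF (xh t) (v t) dl (e *: z t)) (DG_scaleh HF (xh t) (v t)).
  rewrite /g /Q2 !G_subu -/dl.
  have id (a c d1 f g1 h k1 l m' o w : 'rV[R]_n) :
    a - f - c - (d1 - f) - e ^+ 2 *: (2^-1 *: g1 + h) =
    w - f - c - 2^-1 *: k1 + 2^-1 *: (k1 - l + (l - e ^+ 2 *: g1)) +
    (a - w - (d1 - f) - m') + (m' - e *: o) + e *: (o - e *: h).
    by apply/rowP => j; rewrite !mxE; field.
  exact: (id (G F (x t) (u t)) (DG F (xh t) (uh t) dl) (G F (xh t) (u t)) (G F (xh t) (uh t))
     (D2G F (xh t) (uh t) (z t) (z t)) (DG F (xh t) (v t) (z t))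
     (D2G F (xh t) (uh t) dl dl) (D2G F (xh t) (uh t) (e *: z t) dl)
     (DG F (xh t) (u t - uh t) dl) (DG F (xh t) (v t) dl) (G F (x t) (uh t))).
have xD' := xD _ tT; have us' := us _ tT; have xDl' := xDl _ tT; have zZ' := zZ _ tT.
rewrite (le_trans (ler_normD _ _))// lerD//; last first.
  rewrite normrZ ger0_norm// -!mulrA ler_wpM2l// (le_trans (b1 _ _ _ XH))// ler_wpM2l//.
  by rewrite mulrC ler_wpM2r.
rewrite (le_trans (ler_normD _ _))// lerD//; last first.
  by rewrite (le_trans (b1 _ _ _ XH))// -mulrA ler_wpM2l// mulrC ler_pM// ub.
rewrite (le_trans (ler_normD _ _))// /B lerD//; last first.
  rewrite (le_trans (bs _ _ _ _ X XH XH))// subrr normr0 addr0.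
  by rewrite ler_wpM2l// ler_pM ?mulr_ge0// ler_pM.
rewrite (le_trans (ler_normD _ _))// lerD//.
  rewrite (le_trans (Htay _ _ _ XH _))//; first exact: le_lt_trans Dd.
  by rewrite ler_wpM2l// ler_pM ?mulr_ge0 ?uhB// ler_pM.
rewrite normrZ ger0_norm ?invr_ge0//.
apply: (@le_trans _ _ (`|D2G F (xh t) (uh t) (x t - xh t - e *: z t) (x t - xh t)
            + D2G F (xh t) (uh t) (e *: z t) (x t - xh t - e *: z t)|)).
  by rewrite ler_piMl// invf_le1// ler1n.
rewrite (le_trans (ler_normD _ _))// mulrDr mulrDr mulrDr lerD//.
  rewrite (le_trans (b2 _ _ _ _ XH))// ler_wpM2l// ler_pM ?mulr_ge0 ?uhB//.
  by rewrite ler_pM.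
rewrite (le_trans (b2 _ _ _ _ XH))// ler_wpM2l// ler_pM ?mulr_ge0 ?uhB//.
rewrite mulrC ler_pM// normrZ ger0_norm// ler_wpM2l//.
Qed.

(** Every later choice of a small parameter goes through this lemma; [M + 1] in the denominator
    admits [M = 0]. *)
Lemma small_eps (M m : R) : 0 <= M -> 0 < m ->
  exists2 e0, 0 < e0 <= 1 & forall e, 0 < e <= e0 -> e * M <= m.
Proof.
move=> M0 m0; have M1 : 0 < M + 1 by rewrite ltr_wpDl.
exists (Num.min 1 (m / (M + 1))).
  by rewrite lt_min ltr01 divr_gt0//= ge_min lexx.
move=> e /andP[e0]; rewrite le_min => /andP[_].
rewrite ler_pdivlMr// mulrDr mulr1 => H; rewrite (le_trans _ H)// lerDl ltW//.
Qed.

(** The order of the quantifiers is the content: [C3] precedes [k], [W] and [Rr], and only [e0]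
    depends on them. A bounded [w] within [k] of [v] may need a bound [W] that grows as [k]
    decreases, and this must not affect the constant. *)
Lemma endpoint_expansion : exists2 C3, 0 <= C3 & forall k W Rr : R, 0 < k <= 1 -> 0 <= W -> 0 <= Rr ->
  exists2 e0, 0 < e0 & forall e w r x, 0 < e <= e0 -> bm w -> bm r ->
    (forall t, I0T t -> `|w t| <= W) -> (forall t, I0T t -> `|r t| <= Rr) ->
    \int[leb]_(t in `[0, T]) `|w t - v t| <= k ->
    sol (fun t => uh t + (e *: w t + e ^+ 2 *: r t)) x ->
    `|x T - xh T - Y (fun t => G F (xh t) (e *: w t + e ^+ 2 *: r t)) - e ^+ 2 *: Y Q2| <= C3 * (k * e ^+ 2).
Proof.
have [_ [Z HZ]] := contT_bmeas (contT_norm cz).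
have {}HZ t : I0T t -> `|z t| <= Z by move=> tT; rewrite -[leLHS]normr_id HZ.
have Z0 : 0 <= Z by exact: le_trans (normr_ge0 _) (HZ _ I00).
pose V := \int[leb]_(t in `[0, T]) `|v t|.
have V0 : 0 <= V by apply: Rintegral_ge0.
(* [c1] is chosen so that [c1 (e k)] bounds [x - xh - e z], and [c2] so that [e c2] bounds [x - xh];
   neither involves [W] or [Rr]. *)
pose c1 := 2 * grc * C.
have c10 : 0 <= c1 by rewrite !mulr_ge0.
pose c2 := c1 + Z + 1.
have c20 : 0 < c2 by rewrite ltr_wpDl// addr_ge0.
have c2_0 := ltW c20.
exists (n%:R * BP * ((Mu * (c2 * c2) + C * Mu * c1 * (c2 + Z) + 1) * T + 2 * C * c2 + C * V * c1)).
  have cZ : 0 <= c2 + Z by rewrite addr_ge0.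
  by rewrite mulr_ge0 ?addr_ge0 ?mulr_ge0 ?addr_ge0 ?mulr_ge0.
move=> k W Rr /andP[k0 k1] W0 Rr0.
have [d d0 Hd] := G_taylor HF rho k0.
pose S := W + Rr; have S0 : 0 <= S by rewrite addr_ge0.
pose K1 := grc * C * T; have K10 : 0 <= K1 by rewrite !mulr_ge0.
pose M1 := (Mu * ((K1 * S) * (K1 * S)) + S * (K1 * S)) * T + Rr * T.
have M10 : 0 <= M1 by rewrite addr_ge0 ?mulr_ge0 ?addr_ge0 ?mulr_ge0.
(* [M] adds up all the coefficients that a factor [e] has to bring below [k] or below [d / 2]. *)
pose M := S + M1 + S * (c2 * c2) * C + Rr * T + c2.
have SC : 0 <= S * (c2 * c2) * C by rewrite !mulr_ge0// ltW.
have RT : 0 <= Rr * T by rewrite mulr_ge0.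
have M0 : 0 <= M by rewrite /M; lra.
have m0 : 0 < Num.min k (d / 2) by rewrite lt_min k0 divr_gt0.
have [e0 /andP[e00 e01] He0] := small_eps M0 m0.
exists e0 => // e w r x /andP[e_gt0 ee0] bw br wW rR wv sx.
have eM : e * M <= Num.min k (d / 2) by apply: He0; rewrite e_gt0.
have e_ge0 := ltW e_gt0.
have e1 : e <= 1 by exact: le_trans ee0 e01.
have {}He a : a <= M -> e * a <= k /\ e * a <= d / 2.
  move=> aM; have := le_trans (ler_wpM2l e_ge0 aM) eM.
  by rewrite le_min => /andP[].
have [eS _] : e * S <= k /\ e * S <= d / 2 by apply: He; rewrite /M; lra.
have [eM1 _] : e * M1 <= k /\ e * M1 <= d / 2 by apply: He; rewrite /M; lra.
have [eSc _] : e * (S * (c2 * c2) * C) <= k /\ e * (S * (c2 * c2) * C) <= d / 2 by apply: He; rewrite /M; lra.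
have [eRT _] : e * (Rr * T) <= k /\ e * (Rr * T) <= d / 2 by apply: He; rewrite /M; lra.
have [_ ec2] : e * c2 <= k /\ e * c2 <= d / 2 by apply: He; rewrite /M; lra.
set u := fun t => uh t + (e *: w t + e ^+ 2 *: r t) in sx.
have uE t : u t - uh t = e *: w t + e ^+ 2 *: r t by rewrite /u addrC addKr.
have us t : I0T t -> `|u t - uh t| <= e * S.
  move=> tT; rewrite uE (le_trans (ler_normD _ _))// !normrZ !ger0_norm ?sqr_ge0//.
  rewrite /S mulrDr lerD// ?ler_wpM2l ?wW// ler_pM ?rR ?sqr_ge0//.
  by rewrite ler_piMl.
have bu : bm u by apply: bmD => //; apply: bmD; exact: bmZ.
have iwv : integ T (fun t => `|w t - v t|).
  apply: integ_vnorm => i; under eq_fun do rewrite !mxE.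
  by apply: integB => //; exact: bmeas_integ.
pose b t := e * `|w t - v t| + e ^+ 2 * Rr.
have ib : integ T b by apply: integD; [exact: integZ|exact: integ_cst].
have ub t : I0T t -> `|u t - uh t - e *: v t| <= b t.
  move=> tT; rewrite uE.
  have -> : e *: w t + e ^+ 2 *: r t - e *: v t = e *: (w t - v t) + e ^+ 2 *: r t.
    by rewrite scalerBr addrAC.
  rewrite (le_trans (ler_normD _ _))// !normrZ !ger0_norm ?sqr_ge0//.
  by rewrite lerD// ler_wpM2l ?sqr_ge0// rR.
have Ib : \int[leb]_(t in `[0, T]) b t <= 2 * (e * k).
  rewrite RintegralD//; last 2 first.
  - exact: (integZ e iwv).
  - exact: (integ_cst (e ^+ 2 * Rr)).
  rewrite RintegralZl// int_cstT.
  have -> : e ^+ 2 * Rr * T = e * (e * (Rr * T)) by ring.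
  have := ler_wpM2l e_ge0 wv; have := ler_wpM2l e_ge0 eRT.
  by lra.
have xD0 t : I0T t -> `|x t - xh t| <= K1 * (e * S).
  move=> tT; apply: (sol_lip sx sol_xh) => //; first by rewrite mulr_ge0.
  by move=> t' tT'; rewrite (le_trans (us _ tT'))// (le_trans eS).
pose Dl := c1 * (e * k).
have xDl t : I0T t -> `|x t - xh t - e *: z t| <= Dl.
  move=> tT; apply: (le_trans (first_order sx us xD0 ib ub tT)).
  have -> : Dl = grc * (C * (2 * (e * k))) by rewrite /Dl /c1; ring.
  rewrite ler_wpM2l// ler_wpM2l//.
  have Ib' : \int[leb]_(t in `[0, T]) b t <= e * k + e * (e * (Rr * T)).
    rewrite RintegralD//; last 2 first.
    - exact: (integZ e iwv).
    - exact: (integ_cst (e ^+ 2 * Rr)).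
    rewrite RintegralZl// int_cstT.
    have -> : e ^+ 2 * Rr * T = e * (e * (Rr * T)) by ring.
    by rewrite lerD2r ler_wpM2l.
  have := ler_wpM2l e_ge0 eM1.
  have -> : e * (e * M1) = (Mu * (K1 * (e * S) * (K1 * (e * S))) + e * S * (K1 * (e * S))) * T + e * (e * (Rr * T)).
    by rewrite /M1; ring.
  by lra.
(* A second bound on the deviation. The earlier one, [K1 (e S)], depends on [W]; passing through
   [e z] gives a bound free of it, which is what keeps [C3] independent of [W]. *)
have xD t : I0T t -> `|x t - xh t| <= e * c2.
  move=> tT; rewrite -(subrK (e *: z t) (x t - xh t)) (le_trans (ler_normD _ _))//.
  rewrite normrZ ger0_norm//.
  have H1 := xDl _ tT; have H2 := ler_wpM2l e_ge0 (HZ _ tT).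
  have H3 : Dl <= e * c1 by rewrite /Dl mulrCA ler_wpM2l// ler_piMr.
  by rewrite /c2 !mulrDr mulr1; lra.
have Dd : e * c2 < d by lra.
have := endpoint_remainder sx bu us xD ib ub xDl HZ e_ge0 (ltW k0) Dd Hd.
rewrite (@Y_ext _ (fun t => G F (xh t) (e *: w t + e ^+ 2 *: r t))); last by move=> t _; rewrite uE.
move=> /le_trans; apply.
rewrite -[leRHS]mulrA ler_wpM2l ?mulr_ge0//.
have t3 : C * (e * S * (e * c2 * (e * c2))) <= k * e ^+ 2.
  have -> : C * (e * S * (e * c2 * (e * c2))) = e ^+ 2 * (e * (S * (c2 * c2) * C)) by ring.
  by rewrite mulrC ler_wpM2r ?sqr_ge0.
have t4 : C * (e * c2) * \int[leb]_(t in `[0, T]) b t <= 2 * C * c2 * (k * e ^+ 2).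
  apply: (le_trans (ler_wpM2l _ Ib)); first by rewrite !mulr_ge0.
  by rewrite le_eqVlt; apply/orP; left; apply/eqP; ring.
rewrite -/V.
have -> : ((Mu * (c2 * c2) + C * Mu * c1 * (c2 + Z) + 1) * T + 2 * C * c2 + C * V * c1) * (k * e ^+ 2) =
   ((k * (Mu * (e * c2 * (e * c2))) + C * (Mu * (Dl * (e * c2 + e * Z)))) + k * e ^+ 2) * T + 2 * C * c2 * (k * e ^+ 2) + e * C * Dl * V.
  by rewrite /Dl; ring.
by rewrite lerD2r lerD// ler_wpM2r// lerD2l.
Qed.

(** The two controls share their first-order part, so they differ by [e^2 (r - r')]. Each remainder
    term contains that difference and, in addition, a distance of order [e] to the reference pair;
    this extra factor is made smaller than [k]. *)
Lemma endpoint_strict (W Rr k : R) : 0 <= W -> 0 <= Rr -> 0 < k ->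
  exists2 e0, 0 < e0 & forall e nu w r r' x x', 0 < e <= e0 -> 0 <= nu -> bm w -> bm r -> bm r' ->
    (forall t, I0T t -> `|w t| <= W) -> (forall t, I0T t -> `|r t| <= Rr) ->
    (forall t, I0T t -> `|r' t| <= Rr) -> (forall t, I0T t -> `|r t - r' t| <= nu) ->
    sol (fun t => uh t + (e *: w t + e ^+ 2 *: r t)) x ->
    sol (fun t => uh t + (e *: w t + e ^+ 2 *: r' t)) x' ->
    `|x T - x' T - e ^+ 2 *: Y (fun t => G F (xh t) (r t - r' t))| <= k * (e ^+ 2 * nu).
Proof.
move=> W0 Rr0 k0.
pose S := W + Rr; have S0 : 0 <= S by rewrite addr_ge0.
pose K1 := grc * C * T; have K10 : 0 <= K1 by rewrite !mulr_ge0.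
pose M1 := n%:R * BP * ((2 * C * Mu * K1 * K1 + C * K1 + C * K1) * T) * S.
have M10 : 0 <= M1 by rewrite !mulr_ge0// !addr_ge0// !mulr_ge0.
have [e1 /andP[e10 e11] He1] := small_eps M10 k0.
have [e2 /andP[e20 e21] He2] := small_eps S0 (@ltr01 R).
exists (Num.min e1 e2); first by rewrite lt_min e10.
move=> e nu w r r' x x' /andP[e_gt0]; rewrite le_min => /andP[ee1 ee2] nu0 bw br br' wW rR r'R rr sx sx'.
have e_ge0 := ltW e_gt0.
have eM1 : e * M1 <= k by apply: He1; rewrite e_gt0.
have eS : e * S <= 1 by apply: He2; rewrite e_gt0.
have e_1 : e <= 1 by exact: le_trans ee1 e11.
have [b0 b1 b2 bl bs] := GB.
set u := fun t => uh t + (e *: w t + e ^+ 2 *: r t) in sx.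
set u' := fun t => uh t + (e *: w t + e ^+ 2 *: r' t) in sx'.
have us (q : R -> 'rV[R]_p) t : (forall t, I0T t -> `|q t| <= Rr) -> I0T t ->
    `|uh t + (e *: w t + e ^+ 2 *: q t) - uh t| <= e * S.
  move=> qR tT; rewrite addrC addKr (le_trans (ler_normD _ _))// !normrZ !ger0_norm ?sqr_ge0//.
  rewrite /S mulrDr lerD// ?ler_wpM2l ?wW// ler_pM ?qR ?sqr_ge0//.
  by rewrite ler_piMl.
have us1 (q : R -> 'rV[R]_p) t : (forall t, I0T t -> `|q t| <= Rr) -> I0T t ->
    `|uh t + (e *: w t + e ^+ 2 *: q t) - uh t| <= 1.
  by move=> qR tT; apply: le_trans (us _ _ qR tT) eS.
have uu t : u t - u' t = e ^+ 2 *: (r t - r' t).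
  by rewrite /u /u' opprD addrACA subrr add0r opprD addrACA subrr add0r scalerBr.
have uu' t : I0T t -> `|u t - u' t| <= e ^+ 2 * nu.
  by move=> tT; rewrite uu normrZ ger0_norm ?sqr_ge0// ler_wpM2l ?sqr_ge0// rr.
have eS0 : 0 <= e * S by rewrite mulr_ge0.
have en0 : 0 <= e ^+ 2 * nu by rewrite mulr_ge0// sqr_ge0.
have xD t : I0T t -> `|x t - xh t| <= K1 * (e * S).
  move=> tT; apply: (sol_lip sx sol_xh) => // t' t'T; [exact: us1|exact: us].
have x'D t : I0T t -> `|x' t - xh t| <= K1 * (e * S).
  move=> tT; apply: (sol_lip sx' sol_xh) => // t' t'T; [exact: us1|exact: us].
have xx t : I0T t -> `|x t - x' t| <= K1 * (e ^+ 2 * nu).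
  by move=> tT; apply: (sol_lip sx sx') => // t' t'T; exact: us1.
have [dx x0 xB] := sx; have [dx' x'0 x'B] := sx'.
have cx := is_deriv_contT T0' dx; have cx' := is_deriv_contT T0' dx'.
have bu : bm u by apply: bmD => //; apply: bmD; exact: bmZ.
have bu' : bm u' by apply: bmD => //; apply: bmD; exact: bmZ.
have iGu : ig (fun t => G F (x t) (u t)) by apply/bm_ig/bm_G.
have iGu' : ig (fun t => G F (x' t) (u' t)) by apply/bm_ig/bm_G.
have cd : contT T (fun t => x t - x' t) by exact: contTB.
have iDG : ig (fun t => DG F (xh t) (uh t) (x t - x' t)) by apply/bm_ig/bm_DG.
have iB : ig (fun t => G F (xh t) (r t - r' t)) by apply/bm_ig/bm_G => //; exact: bmB.
pose g t := G F (x t) (u t) - G F (x' t) (u' t) - DG F (xh t) (uh t) (x t - x' t).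
have -> : x T - x' T = Y g.
  apply: (@Y_sol (fun t => x t - x' t) _ _ (is_derivB dx dx')); first by rewrite x0 x'0 subrr.
  by move=> t _; rewrite /g [RHS]addrC subrK.
have igg : ig g by apply: igB => //; apply: igB.
rewrite -YZ// -YB//; last exact: igZ.
pose B := C * (Mu * ((K1 * (e * S) + K1 * (e * S)) * (K1 * (e ^+ 2 * nu)))) +
   C * (e * S * (K1 * (e ^+ 2 * nu))) + C * (e ^+ 2 * nu * (K1 * (e * S))).
apply: (@le_trans _ _ (n%:R * BP * \int[leb]_(t in `[0, T]) B)); last first.
  rewrite int_cstT.
  have -> : n%:R * BP * (B * T) = e * M1 * (e ^+ 2 * nu) by rewrite /B /M1; ring.
  by rewrite ler_wpM2r.
apply: Y_norm_le; [by apply: igB => //; exact: igZ|exact: integ_cst|].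
move=> t tT; have X := tube_box tT (xB _ tT); have X' := tube_box tT (x'B _ tT); have XH := xh_box tT.
have -> : g t - e ^+ 2 *: G F (xh t) (r t - r' t) =
   (G F (x t) (uh t) - G F (x' t) (uh t) - DG F (xh t) (uh t) (x t - x' t))
   + (G F (x t) (u t - uh t) - G F (x' t) (u t - uh t))
   + (G F (x' t) (u t - u' t) - G F (xh t) (u t - u' t)).
  rewrite -G_scaleu -uu /g [G F (x t) (u t - _)]G_subu [G F (x' t) (u t - uh _)]G_subu.
  rewrite [G F (x' t) (u t - u' _)]G_subu.
  have id (a b' c d f g' h : 'rV[R]_n) : a - b' - c - d = f - g' - c + (a - f - (h - g')) + (h - b' - d).
    by apply/rowP => j; rewrite !mxE; ring.
  exact: id.
rewrite (le_trans (ler_normD _ _))// lerD//; last first.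
  rewrite (le_trans (bl _ _ _ X' XH))// ler_wpM2l// ler_pM//; [exact: uu'|exact: x'D].
rewrite (le_trans (ler_normD _ _))// lerD//; last first.
  rewrite (le_trans (bl _ _ _ X X'))// ler_wpM2l// ler_pM//; [exact: us|exact: xx].
rewrite (le_trans (bs _ _ _ _ X X' XH))// ler_wpM2l// ler_pM ?mulr_ge0 ?addr_ge0 ?uhB//.
by rewrite ler_pM ?addr_ge0// ?xx// lerD ?xD ?x'D.
Qed.

End Expansion.

End Trajectories.

(** * Finite-dimensional tools *)

Section FiniteDim.
Context {R : realType}.

(** On the compact box [|h b - b|] has a minimizer [b]. At [h b] the same quantity is at most half
    as large, so the minimum is 0. *)
Lemma contraction_box k (h : 'rV[R]_k -> 'rV[R]_k) (th : R) : 0 <= th ->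
  (forall b, box th b -> box th (h b)) ->
  (forall b b', box th b -> box th b' -> `|h b - h b'| <= 2^-1 * `|b - b'|) ->
  exists2 b, box th b & h b = b.
Proof.
move=> th0 hB hL.
have ne : (box th : set 'rV[R]_k) !=set0 by exists 0; rewrite /box/= normr0.
have cf : {within (box th : set 'rV[R]_k), continuous (fun b => `|h b - b|)}.
  apply/subspace_continuousP => b bB; apply/cvgrPdist_lt => e e0.
  rewrite near_withinE; apply/(@nbhs_normP _ 'rV[R]_k b).
  exists (e / 2); first by rewrite /= divr_gt0.
  move=> b' /= bb' b'B; rewrite /from_subspace.
  have H : `|(h b - b) - (h b' - b')| < e.
    have -> : (h b - b) - (h b' - b') = (h b - h b') - (b - b').
      by apply/rowP => i; rewrite !mxE; ring.
    rewrite (le_lt_trans (ler_normB _ _))//.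
    have := hL _ _ bB b'B; lra.
  by rewrite (le_lt_trans _ H)// ler_dist_dist.
have [b bB bmin] := compact_EVT_min ne (@box_compact _ _ th) cf.
rewrite inE in bB; exists b => //.
have hbB := hB _ bB.
have := bmin (h b) (mem_set hbB); have := hL _ _ hbB bB => H1 H2.
have : `|h b - b| <= 0 by have := normr_ge0 (h b - b); lra.
by rewrite normr_le0 subr_eq0 => /eqP.
Qed.

(** Rows of [S] outside the current row space are added one by one; each raises the rank, so the
    codimension [k - \rank M] bounds the number of steps. *)
Lemma spanning_rows k (S : set 'rV[R]_k) : exists q (M : 'M[R]_(q, k)),
  (forall i, S (row i M)) /\ forall s, S s -> (s <= M)%MS.
Proof.
suff H j q (M : 'M[R]_(q, k)) : (forall i, S (row i M)) -> (k - \rank M <= j)%N ->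
    exists q (M : 'M[R]_(q, k)), (forall i, S (row i M)) /\ forall s, S s -> (s <= M)%MS.
  by apply: (H k 0%N (0 : 'M[R]_(0, k))) => [[]//|]; exact: leq_subr.
elim: j q M => [|j IH] q M SM rM.
  exists q, M; split => // s _; apply: submx_full.
  by rewrite /row_full eqn_leq rank_leq_col -subn_eq0 -leqn0.
have [all|] := pselect (forall s, S s -> (s <= M)%MS); first by exists q, M.
move=> /existsNP[s /not_implyP[Ss /negP sM]].
apply: (IH _ (col_mx M s)).
  move=> i; rewrite -[i]splitK; case: (fintype.split i) => a /=.
    by rewrite rowKu.
  by rewrite rowKd (_ : row a s = s)//; apply/rowP => l; rewrite mxE ord1.
have lt : (M < col_mx M s)%MS.
  rewrite ltmxE; apply/andP; split.
    by rewrite -addsmxE addsmxSl.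
  apply: contra sM; apply: submx_trans.
  by rewrite -addsmxE addsmxSr.
have := rank_ltmx lt => rk.
by rewrite leq_subLR; move: rM; rewrite leq_subLR => /leq_trans; apply; rewrite addnS -addSn leq_add2r.
Qed.

Lemma dotDl k (a b c : 'rV[R]_k) : dot (a + b) c = dot a c + dot b c.
Proof. by rewrite /dot -big_split; apply: eq_bigr => i _; rewrite mxE mulrDl. Qed.

Lemma dotZl k x (a c : 'rV[R]_k) : dot (x *: a) c = x * dot a c.
Proof. by rewrite /dot mulr_sumr; apply: eq_bigr => i _; rewrite mxE mulrA. Qed.

Lemma dotDr k (a b c : 'rV[R]_k) : dot c (a + b) = dot c a + dot c b.
Proof. by rewrite dotC dotDl !(dotC c). Qed.

Lemma dotZr k x (a c : 'rV[R]_k) : dot c (x *: a) = x * dot c a.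
Proof. by rewrite dotC dotZl (dotC c). Qed.

Lemma dot0r k (c : 'rV[R]_k) : dot c 0 = 0.
Proof. by rewrite /dot big1// => i _; rewrite mxE mulr0. Qed.

Lemma dot_ge0 k (a : 'rV[R]_k) : 0 <= dot a a.
Proof. by apply: sumr_ge0 => i _; rewrite -expr2 sqr_ge0. Qed.

Lemma dot_gt0 k (a : 'rV[R]_k) : a != 0 -> 0 < dot a a.
Proof.
move=> a0; rewrite lt_neqAle dot_ge0 andbT eq_sym; apply: contra a0.
rewrite /dot psumr_eq0; last by move=> i _; rewrite -expr2 sqr_ge0.
move=> /allP H; apply/eqP/rowP => i; rewrite mxE.
have := H i (mem_index_enum _); rewrite mulf_eq0 orbb.
by move=> /eqP.
Qed.

Lemma cont_sum (X : topologicalType) (V : normedModType R) (I : Type) (s : seq I) (f : I -> X -> V) :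
  (forall i, continuous (f i)) -> continuous (fun t => \sum_(i <- s) f i t).
Proof.
move=> cf; elim: s => [|i s IH].
  by rewrite (_ : (fun t => _) = fun=> 0); [exact: cst_continuous|apply/funext => t; rewrite big_nil].
rewrite (_ : (fun t => _) = fun t => f i t + \sum_(j <- s) f j t).
  by move=> t; apply: (continuousD (cf i t) (IH t)).
by apply/funext => t; rewrite big_cons.
Qed.

Lemma dot_cont k (c : 'rV[R]_k) : continuous (fun a => dot a c).
Proof.
apply: cont_sum => i a; apply: continuousM; first exact: coord_continuous.
exact: cst_continuous.
Qed.

Lemma dot_self_cont k : continuous (fun a : 'rV[R]_k => dot a a).
Proof.
by apply: cont_sum => i a; apply: continuousM; exact: coord_continuous.
Qed.

(* The functional is the point of least norm in the convex hull of the [w_j]. *)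
Lemma finite_separation N m (S : set 'rV[R]_N) (w : 'I_m.+1 -> 'rV[R]_N) :
  (forall a b, S a -> S b -> S (a + b)) -> (forall c a, 0 < c -> S a -> S (c *: a)) -> ~ S 0 ->
  (forall j, S (w j)) -> exists2 p, p != 0 & forall j, 0 <= dot p (w j).
Proof.
move=> SD SZ S0 Sw.
pose D : set 'rV[R]_m.+1 := [set t | (forall j, 0 <= t 0 j) /\ \sum_j t 0 j = 1].
have cD : compact D.
  apply: bounded_closed_compact.
    exists 1; split; first exact: num_real.
    move=> r r1 t [t0 t1] /=; rewrite (le_trans _ (ltW r1))//.
    apply: rV_norm_le => // j; rewrite ger0_norm//.
    by rewrite -t1 (bigD1 j)//= lerDl sumr_ge0.
  rewrite (_ : D = \bigcap_j [set t | 0 <= t 0 j] `&` [set t | \sum_j t 0 j = 1]); last first.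
    apply/seteqP; split=> [t [t0 t1]|t [t0 t1]]; first by split => // j _; exact: t0.
    by split => // j; exact: t0.
  apply: closedI.
    apply: closed_bigI => j _.
    apply: (@closed_comp _ _ (fun t : 'rV[R]_m.+1 => t 0 j) [set x | 0 <= x]).
      by move=> t _; exact: coord_continuous.
    exact: closed_ge.
  apply: (@closed_comp _ _ (fun t : 'rV[R]_m.+1 => \sum_j t 0 j) [set x | x = 1]).
    by move=> t _; apply: cont_sum => j; exact: coord_continuous.
  exact: closed_eq.
pose h (t : 'rV[R]_m.+1) := \sum_j t 0 j *: w j.
have ne : D !=set0.
  exists (delta_mx 0 ord0); split=> [j|]; first by rewrite mxE ler0n.
  by rewrite (bigD1 ord0)//= mxE !eqxx big1 ?addr0// => j /negbTE j0; rewrite mxE j0 andbF.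
have ch : continuous (fun t => dot (h t) (h t)).
  move=> t; apply: (@continuous_comp _ _ _ h (fun a => dot a a)); last exact: dot_self_cont.
  apply: cont_sum => j t'; apply: continuousZ; last exact: cst_continuous.
  exact: coord_continuous.
have [t tD tmin] := compact_EVT_min ne cD (continuous_subspaceT ch).
rewrite inE in tD; have [t0 t1] := tD.
(* [S] does not contain 0, so a partial sum whose coefficients all vanish has to be treated
   apart. *)
have SS (s : seq 'I_m.+1) : \sum_(j <- s) t 0 j *: w j = 0 \/ S (\sum_(j <- s) t 0 j *: w j).
  elim: s => [|j s IH]; first by left; rewrite big_nil.
  rewrite big_cons; have := t0 j; rewrite le_eqVlt => /predU1P[<-|tj].
    by rewrite scale0r add0r.
  right; case: IH => [->|IH]; first by rewrite addr0; exact: SZ.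
  by apply: SD => //; exact: SZ.
have Sh : S (h t).
  have [j tj] : exists j, 0 < t 0 j.
    apply/existsP; apply: contraPT (@ltr01 R) => /existsPn H.
    rewrite -t1 big1 ?ltxx// => j _; apply/eqP; rewrite eq_le t0 andbT.
    by rewrite leNgt; exact: H.
  rewrite /h (bigD1 j)//= -big_filter.
  case: (SS [seq i <- index_enum _ | i != j]) => [->|H].
    by rewrite addr0; exact: SZ.
  by apply: SD => //; exact: SZ.
exists (h t).
  by apply: contraPneq S0 => <- /(_ Sh).
move=> j; rewrite leNgt; apply/negP => neg.
pose a := h t; pose b := w j - h t.
have ab : dot a b < 0.
  rewrite /b dotDr -scaleN1r dotZr mulN1r.
  by have := dot_ge0 (h t); rewrite /a; lra.
have bb : 0 <= dot b b by exact: dot_ge0.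
(* Moving from [h t] towards [w j] by [s] changes the squared norm by [s (2 dot a b + s dot b b)],
   which is negative for this [s] and contradicts minimality. *)
pose s := Num.min 1 (- dot a b / (dot b b + 1)).
have b1 : 0 < dot b b + 1 by rewrite ltr_wpDl.
have s0 : 0 < s by rewrite lt_min ltr01/= divr_gt0// oppr_gt0.
have s1 : s <= 1 by rewrite ge_min lexx.
have sb : s * (dot b b + 1) <= - dot a b by rewrite -ler_pdivlMr// ge_min lexx orbT.
have tD' : D ((1 - s) *: t + s *: delta_mx 0 j).
  split=> [i|].
    by rewrite !mxE addr_ge0// mulr_ge0 ?subr_ge0 ?ler0n ?(ltW s0)//; exact: t0.
  under eq_bigr do rewrite !mxE; rewrite big_split/= -!mulr_sumr t1.
  by rewrite (bigD1 j)//= eqxx big1 ?addr0 ?mulr1 ?subrK// => i /negbTE ->.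
have := tmin _ (mem_set tD').
have -> : h ((1 - s) *: t + s *: delta_mx 0 j) = a + s *: b.
  rewrite /h; under eq_bigr do rewrite !mxE scalerDl -!scalerA.
  rewrite big_split/= -!scaler_sumr -/(h t).
  rewrite (bigD1 j)//= !eqxx big1 ?addr0; last first.
    by move=> i /negbTE ->; rewrite scale0r.
  by rewrite scale1r /a /b scalerBr scalerBl scale1r addrAC addrA.
rewrite dotDl !dotDr !dotZl !dotZr (dotC b a) -/a => H.
have : s * (2 * dot a b + s * dot b b) < 0.
  rewrite pmulr_rlt0//.
  have : s * dot b b <= - dot a b by lra.
  by lra.
by lra.
Qed.

(** [S] may fail to be closed. If no unit vector works, the open sets of the [p] with [dot p w < 0],
    for [w] in [S], cover the unit sphere; a finite subcover contradicts [finite_separation]. *)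
Lemma cone_separation N (S : set 'rV[R]_N.+1) :
  (forall a b, S a -> S b -> S (a + b)) -> (forall c a, 0 < c -> S a -> S (c *: a)) -> ~ S 0 ->
  exists2 p, p != 0 & forall w, S w -> 0 <= dot p w.
Proof.
move=> SD SZ S0.
pose K : set 'rV[R]_N.+1 := [set p | dot p p = 1].
have cK : compact K.
  apply: bounded_closed_compact.
    exists 1; split; first exact: num_real.
    move=> r r1 p /= p1; rewrite (le_trans _ (ltW r1))//.
    apply: rV_norm_le => // j; rewrite -[leLHS]ger0_norm// -sqrtr_sqr -[leRHS]sqrtr1.
    rewrite ler_sqrt// real_normK ?num_real// -p1 /dot (bigD1 j)//= expr2 lerDl.
    by apply: sumr_ge0 => i _; rewrite -expr2 sqr_ge0.
  apply: (@closed_comp _ _ (fun p : 'rV[R]_N.+1 => dot p p) [set x | x = 1]).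
    by move=> t _; exact: dot_self_cont.
  exact: closed_eq.
apply: contrapT => no.
have no' p : p != 0 -> exists2 w, S w & dot p w < 0.
  move=> p0; apply: contrapT => nw; apply: no; exists p => // w Sw.
  by rewrite leNgt; apply/negP => pw; apply: nw; exists w.
move: cK; rewrite compact_cover => /(_ _ S (fun w => [set p | dot p w < 0])) [].
- move=> w _; apply: (@open_comp _ _ (fun p : 'rV[R]_N.+1 => dot p w) [set x | x < 0]).
    by move=> t _; exact: dot_cont.
  exact: open_lt.
- move=> p /= p1; have [|w Sw pw] := no' p; last by exists w.
  by apply: contra_eq_neq p1 => ->; rewrite dot0r eq_sym oner_neq0.
move=> D DS KD.
(* An empty family cannot cover the sphere, which is nonempty since the dimension is [N.+1]. *)
have [D0|] := eqVneq (size (finmap.enum_fset D)) 0%N.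
  have := KD (delta_mx 0 ord0); rewrite /K/= dot_deltar mxE !eqxx => /(_ erefl)[w /= wD].
  by have : w \in finmap.enum_fset D by []; rewrite (size0nil D0).
case E : (size (finmap.enum_fset D)) => [//|m] _.
pose w (j : 'I_m.+1) := nth 0 (finmap.enum_fset D) j.
have Sw j : S (w j).
  by have := DS (w j); rewrite inE; apply; apply: mem_nth; rewrite E.
have [p p0 pw] := finite_separation SD SZ S0 Sw.
have pp := dot_gt0 p0.
pose c := (Num.sqrt (dot p p))^-1.
have c0 : 0 < c by rewrite invr_gt0 sqrtr_gt0.
have := KD (c *: p); rewrite /K/= dotZl dotZr.
have -> : c * (c * dot p p) = 1.
  rewrite mulrA -expr2 /c exprVn sqr_sqrtr ?dot_ge0// mulVf// gt_eqF//.
move=> /(_ erefl)[a /= aD]; rewrite dotZl pmulr_rlt0// ltNge.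
have ai : (index a (finmap.enum_fset D) < m.+1)%N by rewrite -E index_mem.
by have := pw (Ordinal ai); rewrite /w/= nth_index// => ->.
Qed.

End FiniteDim.

Section Arithmetic.
Context {R : realType}.
Implicit Types (N Q B x y m : R).

Lemma half_sum_le N N1 N2 Q B x : N <= N1 + N2 -> N1 <= Q -> N2 <= Q -> B <= x -> B = 2 * Q ->
  0 <= N -> 2^-1 * N <= x.
Proof. by lra. Qed.

Lemma near_arith N1 N2 c3 x y pz Pb e : N1 <= x -> x <= c3 * e -> N2 <= e * pz + y -> y <= e * Pb ->
  N1 + N2 <= e * (pz + Pb + c3).
Proof. by move=> *; rewrite !mulrDr; lra. Qed.

Lemma descent_arith x y w m : x + y <= - m -> w <= m / 2 -> x + w + y <= - (m / 2).
Proof. by lra. Qed.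

Lemma negative_arith x1 x2 x3 B m e2 : x1 - x2 - x3 <= B -> B <= e2 * (m / 4) -> x2 <= 0 ->
  x3 <= e2 * (- (m / 2)) -> 0 < e2 * m -> x1 < 0.
Proof. by rewrite mulrN !mulrA; lra. Qed.

Lemma sub_eq_self x y : x - y = x -> y = 0.
Proof. by lra. Qed.
End Arithmetic.

(** * Second-order expansion of scalar functions along curves *)

Section SecondOrderExpansion.
Context {R : realType} {n : nat}.
Local Notation E k := (delta_mx 0 k : 'rV[R]_n).
Implicit Types (x y z v w p : 'rV[R]_n).

Lemma mulmx_bound q k (A : 'M[R]_(q, k)) :
  exists2 L, 0 < L & forall h : 'rV[R]_q, `|h *m A| <= L * `|h|.
Proof.
exists (\sum_i \sum_j `|A i j| + 1).
  by rewrite ltr_wpDl// sumr_ge0// => i _; rewrite sumr_ge0.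
have S0 : 0 <= \sum_i \sum_j `|A i j| by rewrite sumr_ge0// => i _; rewrite sumr_ge0.
move=> h; apply: rV_norm_le => [|l]; first by rewrite mulr_ge0// addr_ge0.
rewrite mxE mulrDl mul1r (le_trans _ (ler_wpDr _ (lexx _)))//.
apply: sum_norm_le => // i; rewrite normrM mulrC ler_pM//; last exact: rV_norm_ge.
by rewrite (bigD1 l)//= lerDl sumr_ge0.
Qed.

Lemma derive_bound (g : 'rV[R]_n -> R) x : differentiable g x ->
  exists2 C, 0 <= C & forall v, `|'D_v g x| <= C * `|v|.
Proof.
move=> dg; exists (\sum_k `|'D_(E k) g x|); first exact: sumr_ge0.
move=> v; rewrite derive_basis//; apply: sum_norm_le => // k.
by rewrite normrM mulrC ler_pM// rV_norm_ge.
Qed.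

Lemma derive2_bound (g : 'rV[R]_n -> R) x : twice_diff g ->
  exists2 C, 0 <= C & forall v w, `|'D_w ('D_v g) x| <= C * (`|v| * `|w|).
Proof.
move=> [d1 d2]; exists (\sum_(kl : 'I_n * 'I_n) `|'D_(E kl.2) ('D_(E kl.1) g) x|); first exact: sumr_ge0.
move=> v w; rewrite derive_basis2// pair_big/=; apply: sum_norm_le => [|[k l]/=].
  by rewrite mulr_ge0.
rewrite /GRing.scale/= normrM mulrC ler_pM//.
by rewrite normrM ler_pM// rV_norm_ge.
Qed.

Lemma derive_sub (g : 'rV[R]_n -> R) x v w : differentiable g x ->
  'D_(v - w) g x = 'D_v g x - 'D_w g x.
Proof. by move=> dg; rewrite !deriveE// linearB. Qed.

Lemma derive_add (g : 'rV[R]_n -> R) x v w : differentiable g x ->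
  'D_(v + w) g x = 'D_v g x + 'D_w g x.
Proof. by move=> dg; rewrite !deriveE// linearD. Qed.

Lemma derive_scale (g : 'rV[R]_n -> R) x c v : differentiable g x ->
  'D_(c *: v) g x = c * 'D_v g x.
Proof. by move=> dg; rewrite !deriveE// linearZ. Qed.

Lemma derive_lincomb (g : 'rV[R]_n -> R) x (I : Type) (s : seq I) (a : I -> R) (ys : I -> 'rV[R]_n) :
  differentiable g x -> 'D_(\sum_(i <- s) a i *: ys i) g x = \sum_(i <- s) a i * 'D_(ys i) g x.
Proof.
move=> dg; rewrite deriveE// linear_sum; apply: eq_bigr => i _.
by rewrite linearZ deriveE.
Qed.

Lemma derive2_sub1 (g : 'rV[R]_n -> R) x v v' w : twice_diff g ->
  'D_w ('D_(v - v') g) x = 'D_w ('D_v g) x - 'D_w ('D_v' g) x.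
Proof.
move=> [d1 d2]; rewrite (derive_basis2 x (v - v') w d1 d2) (derive_basis2 x v w d1 d2) (derive_basis2 x v' w d1 d2).
rewrite -sumrB; apply: eq_bigr => i _.
rewrite -sumrB; apply: eq_bigr => j _.
by rewrite !mxE mulrBl scalerBl.
Qed.

(** As in [endpoint_expansion], the constant [C5] is independent of the accuracy [k]. The parameter
    [p] ranges over a ball, because the second-order part of the endpoint will vary with the unknown
    of the contraction. *)
Lemma scalar_expansion (g : 'rV[R]_n -> R) (q0 : 'rV[R]_n) z (Pb : R) : twice_diff g -> 0 <= Pb ->
  exists2 C5, 0 <= C5 & forall k, 0 < k <= 1 -> exists2 e0, 0 < e0 & forall e h p,
    0 < e <= e0 -> `|p| <= Pb -> `|h - e *: z - e ^+ 2 *: p| <= k * e ^+ 2 ->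
    `|g (q0 + h) - g q0 - e * 'D_z g q0 - e ^+ 2 * ('D_p g q0 + 2^-1 * 'D_z ('D_z g) q0)| <= C5 * (k * e ^+ 2).
Proof.
move=> tg Pb0; have [d1 d2] := tg.
have [C1 C10 H1] := derive_bound (d1 q0).
have [C2 C20 H2] := derive2_bound q0 tg.
pose H := `|z| + Pb + 1.
have H0 : 0 < H by rewrite ltr_wpDl// addr_ge0.
exists (H * H + C1 + 1); first by rewrite !addr_ge0// mulr_ge0// ltW.
move=> k /andP[k0 k1].
have [d d0 Hd] := taylor2_pt q0 tg k0.
pose M := C2 * ((Pb + 1) * (2 * H)).
have M0 : 0 <= M by rewrite !mulr_ge0// ?addr_ge0// ltW.
have [e1 /andP[e10 e11] He1] := small_eps M0 k0.
have [e2 /andP[e20 e21] He2] := small_eps (ltW H0) (divr_gt0 d0 (ltr0Sn R 1)).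
exists (Num.min e1 e2); first by rewrite lt_min e10.
move=> e h p /andP[e_gt0]; rewrite le_min => /andP[ee1 ee2] pP hp.
have eM : e * M <= k by apply: He1; rewrite e_gt0.
have eH : e * H <= d / 2 by apply: He2; rewrite e_gt0.
have e_ge0 := ltW e_gt0; have e1' := le_trans ee1 e11.
have sq0 : 0 <= e ^+ 2 by rewrite sqr_ge0.
have sqe : e ^+ 2 <= e by rewrite expr2 ler_piMl.
have hez : `|h - e *: z| <= e ^+ 2 * (Pb + 1).
  rewrite -(subrK (e ^+ 2 *: p) (h - e *: z)) (le_trans (ler_normD _ _))//.
  rewrite normrZ ger0_norm// mulrDr addrC lerD// ?ler_wpM2l//.
  by rewrite (le_trans hp)// mulr1 ler_piMl.
have hH : `|h| <= e * H.
  rewrite -(subrK (e *: z) h) (le_trans (ler_normD _ _))// normrZ ger0_norm//.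
  have -> : e * H = e * (Pb + 1) + e * `|z| by rewrite /H; ring.
  by rewrite lerD// (le_trans hez)// ler_wpM2r ?addr_ge0.
have hd : `|h| < d.
  apply: (le_lt_trans hH); apply: (le_lt_trans eH).
  by rewrite ltr_pdivrMr// ltr_pMr// ltr1n.
have T := Hd h hd.
have E1 : 'D_(h - e *: z - e ^+ 2 *: p) g q0 = 'D_h g q0 - e * 'D_z g q0 - e ^+ 2 * 'D_p g q0.
  rewrite (derive_sub (h - e *: z) (e ^+ 2 *: p) (d1 q0)) (derive_sub h (e *: z) (d1 q0)).
  by rewrite (derive_scale e z (d1 q0)) (derive_scale (e ^+ 2) p (d1 q0)).
have E2 := derive2_sub1 q0 h (e *: z) h tg.
have E3 : 'D_(h - e *: z) ('D_(e *: z) g) q0 = 'D_h ('D_(e *: z) g) q0 - e ^+ 2 * 'D_z ('D_z g) q0.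
  rewrite (derive_sub h (e *: z) (d2 (e *: z) q0)); congr (_ - _).
  rewrite (derive_basis2 q0 (e *: z) (e *: z) d1 d2) (derive_basis2 q0 z z d1 d2) mulr_sumr; apply: eq_bigr => i _.
  rewrite mulr_sumr; apply: eq_bigr => j _; rewrite !mxE.
  by move: ('D_(E j) _ _) => A; rewrite /GRing.scale/=; ring.
have id (a b c p1 p2 p3 p4 p5 ee : R) : a - b - e * c - ee * (p1 + 2^-1 * p2) =
    (a - b - p3 - 2^-1 * p4) + (p3 - e * c - ee * p1) + 2^-1 * (p4 - p5 + (p5 - ee * p2)) by field.
(* After Taylor's formula in [h], the first derivative is corrected in the direction
   [h - e z - e^2 p], and each argument of the second derivative is changed from [h] to [e z] in
   turn. Since [h - e z] is of order [e^2], these last changes are of order [e^3]. *)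
have eq1 : g (q0 + h) - g q0 - e * 'D_z g q0 - e ^+ 2 * ('D_p g q0 + 2^-1 * 'D_z ('D_z g) q0) =
   (g (q0 + h) - g q0 - 'D_h g q0 - 2^-1 * 'D_h ('D_h g) q0)
   + 'D_(h - e *: z - e ^+ 2 *: p) g q0
   + 2^-1 * ('D_h ('D_(h - e *: z) g) q0 + 'D_(h - e *: z) ('D_(e *: z) g) q0).
  rewrite E1 E2 E3.
  exact: (id (g (q0 + h)) (g q0) ('D_z g q0) ('D_p g q0) ('D_z ('D_z g) q0) ('D_h g q0)
    ('D_h ('D_h g) q0) ('D_h ('D_(e *: z) g) q0)).
have -> : (H * H + C1 + 1) * (k * e ^+ 2) = k * ((e * H) * (e * H)) + C1 * (k * e ^+ 2) + k * e ^+ 2 by ring.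
rewrite eq1 (le_trans (ler_normD _ _))// lerD//.
  rewrite (le_trans (ler_normD _ _))// lerD//.
    rewrite (le_trans T)// ler_wpM2l ?(ltW k0)//.
    by rewrite ler_pM.
  by rewrite (le_trans (H1 _))// ler_wpM2l.
rewrite normrM ger0_norm ?invr_ge0//.
have zH : e * `|z| <= e * H by rewrite ler_wpM2l// /H -addrA lerDl addr_ge0.
have B1 : `|'D_h ('D_(h - e *: z) g) q0| <= C2 * (e ^+ 2 * (Pb + 1) * (e * H)).
  by rewrite (le_trans (H2 _ _))// ler_wpM2l// ler_pM.
have B2 : `|'D_(h - e *: z) ('D_(e *: z) g) q0| <= C2 * (e ^+ 2 * (Pb + 1) * (e * H)).
  rewrite (le_trans (H2 _ _))// ler_wpM2l// mulrC ler_pM//.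
  by rewrite normrZ ger0_norm.
have B3 : e ^+ 2 * (e * M) <= e ^+ 2 * k by rewrite ler_wpM2l.
have B4 : e ^+ 2 * (e * M) = 2 * (C2 * (e ^+ 2 * (Pb + 1) * (e * H))) by rewrite /M; ring.
rewrite [k * _]mulrC; exact: (half_sum_le (ler_normD _ _) B1 B2 B3 B4 (normr_ge0 _)).
Qed.

End SecondOrderExpansion.

(** * Solving the nonlinear endpoint constraints *)

Section LocalSolution.
Context {R : realType} {n : nat}.

Lemma ex_common_small (I : finType) (P : I -> R -> Prop) :
  (forall i, exists2 e0, 0 < e0 & forall e, 0 < e <= e0 -> P i e) ->
  exists2 e0, 0 < e0 & forall i e, 0 < e <= e0 -> P i e.
Proof.
move=> H; apply: (ex_common_radius (P := fun i d => forall e, 0 < e <= d -> P i e)) => //.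
move=> i d d' Pd /andP[_ d'd] e /andP[e0 ed]; apply: Pd.
by rewrite e0 (le_trans ed).
Qed.

(* [X a] stands for the endpoint reached with the control perturbation of second-order part
   [y0 + \sum_l a_l ys_l]; the equality constraints are solved for [a] by a contraction. *)
Lemma local_solve (dphi deta q : nat) (phi : 'I_dphi -> 'rV[R]_n -> R) (eta : 'I_deta -> 'rV[R]_n -> R)
  (q0 z qv y0 : 'rV[R]_n) (ys : 'I_q -> 'rV[R]_n) (th C3 : R) (Reach : 'rV[R]_n -> Prop) :
  (forall i, twice_diff (phi i)) -> (forall j, twice_diff (eta j)) ->
  (forall i, phi i q0 = 0) -> (forall j, eta j q0 = 0) ->
  (forall i, 'D_z (phi i) q0 <= 0) -> (forall j, 'D_z (eta j) q0 = 0) ->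
  (forall i, 'D_(qv + y0) (phi i) q0 + 2^-1 * 'D_z ('D_z (phi i)) q0 < 0) ->
  (forall j, 'D_(qv + y0) (eta j) q0 + 2^-1 * 'D_z ('D_z (eta j)) q0 = 0) ->
  row_full (\matrix_(l < q, j < deta) 'D_(ys l) (eta j) q0) ->
  0 < th -> 0 <= C3 ->
  (forall k, 0 < k <= 1 -> exists2 W : R, 0 <= W & forall k2, 0 < k2 ->
     exists2 e0, 0 < e0 & forall e, 0 < e <= e0 -> exists X : 'rV[R]_q -> 'rV[R]_n,
      (forall a, `|a| <= th -> Reach (X a) /\
         `|X a - q0 - e *: z - e ^+ 2 *: (qv + y0 + \sum_(l < q) a 0 l *: ys l)| <= C3 * (k * e ^+ 2)) /\
      (forall a a', `|a| <= th -> `|a'| <= th ->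
         `|X a - X a' - e ^+ 2 *: \sum_(l < q) (a - a') 0 l *: ys l| <= k2 * (e ^+ 2 * `|a - a'|))) ->
  exists x, [/\ Reach x, forall i, phi i x < 0 & forall j, eta j x = 0].
Proof.
move=> tphi teta phi0 eta0 zphi zeta cphi ceta full th0 C30 HX.
have dphi_ i x : differentiable (phi i) x by case: (tphi i).
have deta_ j x : differentiable (eta j) x by case: (teta j).
set M := \matrix_(l < q, j < deta) _ in full.
pose ya (a : 'rV[R]_q) := \sum_(l < q) a 0 l *: ys l.
have yaB a a' : ya (a - a') = ya a - ya a'.
  by rewrite /ya -sumrB; apply: eq_bigr => l _; rewrite !mxE scalerBl.
have [Cy Cy0 HCy] : exists2 Cy, 0 <= Cy & forall a, `|ya a| <= Cy * `|a|.
  exists (\sum_l `|ys l|); first exact: sumr_ge0.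
  move=> a; rewrite (le_trans (ler_norm_sum _ _ _))// mulr_suml.
  by apply: ler_sum => l _; rewrite normrZ mulrC ler_wpM2l// rV_norm_ge.
have etaya j a : 'D_(ya a) (eta j) q0 = (a *m M) 0 j.
  by rewrite derive_lincomb// mxE; apply: eq_bigr => l _; rewrite mxE.
have [Lp Lp0 HLp] := mulmx_bound (pinvmx M).
have pinvK b : b *m pinvmx M *m M = b by rewrite mulmxKpV// submx_full.
pose Pb := `|qv + y0| + Cy * th.
have Pb0 : 0 <= Pb by rewrite addr_ge0// mulr_ge0// ltW.
have pB a : `|a| <= th -> `|qv + y0 + ya a| <= Pb.
  move=> ath; rewrite (le_trans (ler_normD _ _))// lerD2l.
  by rewrite (le_trans (HCy _))// ler_wpM2l.
have /choice[Cp HCp] : forall i, exists C, 0 <= C /\ forall k, 0 < k <= 1 -> exists2 e0, 0 < e0 & forall e, 0 < e <= e0 -> forall h p,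
    `|p| <= Pb -> `|h - e *: z - e ^+ 2 *: p| <= k * e ^+ 2 ->
    `|phi i (q0 + h) - phi i q0 - e * 'D_z (phi i) q0 - e ^+ 2 * ('D_p (phi i) q0 + 2^-1 * 'D_z ('D_z (phi i)) q0)| <= C * (k * e ^+ 2).
  move=> i; have [C C0 HC] := scalar_expansion q0 z (tphi i) Pb0.
  exists C; split => // k k01; have [e0 e00 He] := HC k k01.
  by exists e0 => // e ee h p; exact: He.
have /choice[Ce HCe] : forall j, exists C, 0 <= C /\ forall k, 0 < k <= 1 -> exists2 e0, 0 < e0 & forall e, 0 < e <= e0 -> forall h p,
    `|p| <= Pb -> `|h - e *: z - e ^+ 2 *: p| <= k * e ^+ 2 ->
    `|eta j (q0 + h) - eta j q0 - e * 'D_z (eta j) q0 - e ^+ 2 * ('D_p (eta j) q0 + 2^-1 * 'D_z ('D_z (eta j)) q0)| <= C * (k * e ^+ 2).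
  move=> j; have [C C0 HC] := scalar_expansion q0 z (teta j) Pb0.
  exists C; split => // k k01; have [e0 e00 He] := HC k k01.
  by exists e0 => // e ee h p; exact: He.
have Cp0 i : 0 <= Cp i by case: (HCp i).
have Ce0 j : 0 <= Ce j by case: (HCe j).
pose C5 := \sum_i Cp i + \sum_j Ce j.
have C50 : 0 <= C5 by rewrite addr_ge0// sumr_ge0.
have CpC5 i : Cp i <= C5.
  by rewrite /C5 (bigD1 i)//= -addrA lerDl addr_ge0// sumr_ge0.
have CeC5 j : Ce j <= C5.
  by rewrite /C5 (bigD1 j)//= addrCA lerDl addr_ge0// sumr_ge0.
have /choice[Bp HBp] : forall i, exists C, 0 <= C /\ forall v, `|'D_v (phi i) q0| <= C * `|v|.
  by move=> i; have [C C0 HC] := derive_bound (dphi_ i q0); exists C.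
have /choice[Be HBe] : forall j, exists C, 0 <= C /\ forall v, `|'D_v (eta j) q0| <= C * `|v|.
  by move=> j; have [C C0 HC] := derive_bound (deta_ j q0); exists C.
have Bp0 i : 0 <= Bp i by case: (HBp i).
have Be0 j : 0 <= Be j by case: (HBe j).
pose C1 := \sum_i Bp i + \sum_j Be j.
have C10 : 0 <= C1 by rewrite addr_ge0// sumr_ge0.
have HC1p i v : `|'D_v (phi i) q0| <= C1 * `|v|.
  case: (HBp i) => _ H; apply: (le_trans (H v)); rewrite ler_wpM2r//.
  by rewrite /C1 (bigD1 i)//= -addrA lerDl addr_ge0// sumr_ge0.
have HC1e j v : `|'D_v (eta j) q0| <= C1 * `|v|.
  case: (HBe j) => _ H; apply: (le_trans (H v)); rewrite ler_wpM2r//.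
  by rewrite /C1 (bigD1 j)//= addrCA lerDl addr_ge0// sumr_ge0.
have [mu mu0 Hmu] : exists2 mu, 0 < mu & forall i,
    'D_(qv + y0) (phi i) q0 + 2^-1 * 'D_z ('D_z (phi i)) q0 <= - mu.
  apply: (ex_common_radius (P := fun i mu => 'D_(qv + y0) (phi i) q0 + 2^-1 * 'D_z ('D_z (phi i)) q0 <= - mu)).
    by move=> i d d' H /andP[_ d'd]; rewrite (le_trans H)// lerN2.
  by move=> i; exists (- ('D_(qv + y0) (phi i) q0 + 2^-1 * 'D_z ('D_z (phi i)) q0)); rewrite ?oppr_gt0 ?opprK.
(* radius of the ball for the residual b = a M *)
have [vt /andP[vt0 _] Hvt] := small_eps (ltW Lp0) th0.
have CC0 : 0 <= C1 * (Cy * Lp) by rewrite !mulr_ge0// ltW.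
have [vt2 /andP[vt20 _] Hvt2] := small_eps CC0 (divr_gt0 mu0 (ltr0Sn R 1)).
pose V := Num.min vt vt2.
have V0 : 0 < V by rewrite lt_min vt0.
(* The first bound on [V] keeps the coefficients [a] in the ball of radius [th]; the second lets
   them use up at most half of the margin [mu] by which the [phi i] decrease. *)
have VL : V * Lp <= th by apply: Hvt; rewrite V0 ge_min lexx.
have VC : V * (C1 * (Cy * Lp)) <= mu / 2 by apply: Hvt2; rewrite V0 ge_min lexx orbT.
have K50 : 0 <= C5 * (C3 + 1) by rewrite mulr_ge0// addr_ge0.
have mV : 0 < Num.min (mu / 4) V by rewrite lt_min V0 divr_gt0.
have [k1 /andP[k10 k11] Hk1] := small_eps K50 mV.
have C31 : 0 < C3 + 1 by rewrite ltr_wpDl.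
have [k3 /andP[k30 k31] Hk3] := small_eps (ltW C31) (@ltr01 R).
pose k := Num.min k1 k3.
have k0 : 0 < k by rewrite lt_min k10.
have kk : k * (C5 * (C3 + 1)) <= Num.min (mu / 4) V by apply: Hk1; rewrite k0 ge_min lexx.
have kC3 : k * (C3 + 1) <= 1 by apply: Hk3; rewrite k0 ge_min lexx orbT.
have k_1 : 0 < k <= 1 by rewrite k0 ge_min k11.
(* The scalar expansions need a positive accuracy not above 1, while [C3] may be 0; hence
   [C3 + 1]. *)
pose kC := (C3 + 1) * k.
have kC0 : 0 < kC <= 1 by rewrite /kC mulr_gt0//= mulrC.
have C5kC : C5 * kC <= mu / 4 /\ C5 * kC <= V.
  have -> : C5 * kC = k * (C5 * (C3 + 1)) by rewrite /kC; ring.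
  by move: kk; rewrite le_min => /andP[].
have [W W0 {}HX] := HX k k_1.
(* [k2 C7] will be the contraction factor: strict differentiability of [eta] costs at most
   [k2 (Cy + 1)], the linearization error of [X] costs [C1 k2], and [Lp] passes from [b] to [a]. *)
pose C7 := ((Cy + 1) + C1) * Lp.
have C70 : 0 <= C7.
  by apply: mulr_ge0; [apply: addr_ge0 => //; apply: addr_ge0|exact: ltW].
have half0 : 0 < 2^-1 :> R by rewrite invr_gt0.
have [k2 /andP[k20 k21] Hk2] := small_eps C70 half0.
have k2C7 : k2 * C7 <= 2^-1 by apply: Hk2; rewrite k20 lexx.
have [eX eX0 {}HX] := HX k2 k20.
have [ep ep0 Hep] := ex_common_small (fun i => (HCp i).2 kC kC0).
have [ee ee0 Hee] := ex_common_small (fun j => (HCe j).2 kC kC0).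
have [ds ds0 Hds] : exists2 d, 0 < d & forall j x y, `|x - q0| < d -> `|y - q0| < d ->
    `|eta j x - eta j y - 'D_(x - y) (eta j) q0| <= k2 * `|x - y|.
  apply: (ex_common_radius (P := fun j d => forall x y, `|x - q0| < d -> `|y - q0| < d ->
    `|eta j x - eta j y - 'D_(x - y) (eta j) q0| <= k2 * `|x - y|)).
    by move=> j d d' H /andP[_ d'd] x y xd yd; apply: H; exact: lt_le_trans d'd.
  by move=> j; exact: strict_diff_pt.
pose H := `|z| + Pb + C3.
have H0 : 0 <= H by apply: addr_ge0 => //; apply: addr_ge0.
have [eh /andP[eh0 eh1] Heh] := small_eps H0 (divr_gt0 ds0 (ltr0Sn R 1)).
pose e := Num.min (Num.min eX eh) (Num.min ep ee).
have e0 : 0 < e by rewrite !lt_min eX0 eh0 ep0 ee0.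
have eeX : 0 < e <= eX by rewrite e0 /e !ge_min lexx.
have eeh : 0 < e <= eh by rewrite e0 /e !ge_min lexx !orbT.
have eep : 0 < e <= ep by rewrite e0 /e !ge_min lexx !orbT.
have eee : 0 < e <= ee by rewrite e0 /e !ge_min lexx !orbT.
have e_ge0 := ltW e0.
have e1 : e <= 1 by case/andP: eeh => _ h; exact: le_trans eh1.
have sq0 : 0 < e ^+ 2 by rewrite exprn_gt0.
have sqn : e ^+ 2 != 0 by rewrite gt_eqF.
have en : e != 0 by rewrite gt_eqF.
have sqe : e ^+ 2 <= e by rewrite expr2 ler_piMl.
have [X [HX1 HX2]] := HX e eeX.
have Xexp a : `|a| <= th -> `|(X a - q0) - e *: z - e ^+ 2 *: (qv + y0 + ya a)| <= kC * e ^+ 2.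
  move=> ath; have [_ Hx] := HX1 a ath; apply: (le_trans Hx).
  rewrite mulrA ler_wpM2r ?(ltW sq0)// /kC ler_wpM2r ?(ltW k0)//.
  by rewrite lerDl.
have Xq a : q0 + (X a - q0) = X a by rewrite addrC subrK.
have Xnear a : `|a| <= th -> `|X a - q0| < ds.
  move=> ath; have [_ Hx] := HX1 a ath.
  apply: (@le_lt_trans _ _ (e * H)); last first.
    apply: (le_lt_trans (Heh _ eeh)).
    by rewrite ltr_pdivrMr// ltr_pMr// ltr1n.
  have -> : X a - q0 = (X a - q0 - e *: z - e ^+ 2 *: (qv + y0 + ya a)) + (e *: z + e ^+ 2 *: (qv + y0 + ya a)).
    by rewrite -[X a - q0 - _ - _]addrA -opprD subrK.
  rewrite (le_trans (ler_normD _ _))//.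
  have N1 := ler_normD (e *: z) (e ^+ 2 *: (qv + y0 + ya a)).
  rewrite !normrZ !ger0_norm ?(ltW sq0)// in N1.
  have N2 : e ^+ 2 * `|qv + y0 + ya a| <= e * Pb by rewrite ler_pM ?(ltW sq0)// pB.
  have N3 : C3 * (k * e ^+ 2) <= C3 * e.
    rewrite ler_wpM2l// (le_trans _ sqe)// ler_piMl ?(ltW sq0)//.
    by case/andP: k_1.
  exact: near_arith Hx N3 N1 N2.
(* The coefficients [a] with [a *m M = b], available because [M] has full row space; [b] is the
   second-order change of the equality constraints that they produce. *)
pose A (b : 'rV[R]_deta) : 'rV[R]_q := b *m pinvmx M.
have AB b b' : A b - A b' = A (b - b') by rewrite /A mulmxBl.
have Ath b : box V b -> `|A b| <= th.
  move=> bV; apply: le_trans VL; rewrite (le_trans (HLp b))// mulrC ler_wpM2r//.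
  exact: ltW.
pose et x : 'rV[R]_deta := \row_j eta j x.
have etaX b j : box V b -> `|eta j (X (A b)) - e ^+ 2 * b 0 j| <= C5 * (kC * e ^+ 2).
  move=> bV; have ath := Ath b bV.
  have := Hee j e eee (X (A b) - q0) (qv + y0 + ya (A b)) (pB _ ath) (Xexp _ ath).
  rewrite Xq eta0 zeta mulr0 !subr0 (derive_add (qv + y0) (ya (A b)) (deta_ j q0)) addrAC ceta add0r etaya /A pinvK.
  move=> /le_trans; apply; rewrite ler_wpM2r// mulr_ge0 ?(ltW sq0)//.
  by case/andP: kC0 => /ltW.
(* Since [eta (X (A b))] is [e^2 b] up to a small error, this map is nearly constant, and its fixed
   points are exactly the zeros of [eta (X (A b))]. *)
pose h b := b - (e ^+ 2)^-1 *: et (X (A b)).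
have hV b : box V b -> box V (h b).
  move=> bV; apply: rV_norm_le => [|j]; first exact: ltW.
  rewrite !mxE; have -> : b 0 j - (e ^+ 2)^-1 * eta j (X (A b)) =
    - ((e ^+ 2)^-1 * (eta j (X (A b)) - e ^+ 2 * b 0 j)) by field.
  rewrite normrN normrM ger0_norm ?invr_ge0 ?(ltW sq0)//.
  rewrite ler_pdivrMl//; apply: (le_trans (etaX b j bV)).
  rewrite mulrA mulrC ler_wpM2l ?(ltW sq0)//.
  by case: C5kC.
have hL b b' : box V b -> box V b' -> `|h b - h b'| <= 2^-1 * `|b - b'|.
  move=> bV b'V; have ath := Ath b bV; have a'th := Ath b' b'V.
  set a := A b in ath *; set a' := A b' in a'th *.
  have HX2' := HX2 a a' ath a'th; rewrite -/(ya (a - a')) in HX2'.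
  set Dx := X a - X a' in HX2'.
  have aa : `|a - a'| <= Lp * `|b - b'| by rewrite /a /a' AB; exact: HLp.
  have Dxn : `|Dx| <= e ^+ 2 * ((Cy + k2) * `|a - a'|).
    have -> : Dx = (Dx - e ^+ 2 *: ya (a - a')) + e ^+ 2 *: ya (a - a') by rewrite subrK.
    rewrite (le_trans (ler_normD _ _))// normrZ ger0_norm ?(ltW sq0)//.
    have -> : e ^+ 2 * ((Cy + k2) * `|a - a'|) = k2 * (e ^+ 2 * `|a - a'|) + e ^+ 2 * (Cy * `|a - a'|) by ring.
    by rewrite lerD// ler_wpM2l ?(ltW sq0)// HCy.
  apply: rV_norm_le => [|j]; first by rewrite mulr_ge0 ?invr_ge0.
  have -> : (h b - h b') 0 j = - ((e ^+ 2)^-1 * ((eta j (X a) - eta j (X a') - 'D_Dx (eta j) q0)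
       + 'D_(Dx - e ^+ 2 *: ya (a - a')) (eta j) q0)).
    rewrite (derive_sub Dx (e ^+ 2 *: ya (a - a')) (deta_ j q0)) (derive_scale (e ^+ 2) (ya (a - a')) (deta_ j q0)) etaya /a /a' AB /A pinvK /h !mxE -/(A b) -/(A b') -/a -/a'.
    by field.
  rewrite normrN normrM ger0_norm ?invr_ge0 ?(ltW sq0)// ler_pdivrMl//.
  rewrite (le_trans (ler_normD _ _))//.
  have N1 := Hds j (X a) (X a') (Xnear _ ath) (Xnear _ a'th).
  have N2 := le_trans (HC1e j (Dx - e ^+ 2 *: ya (a - a'))) (ler_wpM2l C10 HX2').
  have N3 := le_trans N1 (ler_wpM2l (ltW k20) Dxn).
  apply: (le_trans (lerD N3 N2)).
  have -> : k2 * (e ^+ 2 * ((Cy + k2) * `|a - a'|)) + C1 * (k2 * (e ^+ 2 * `|a - a'|)) =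
    e ^+ 2 * (k2 * ((Cy + k2) + C1) * `|a - a'|) by ring.
  rewrite ler_wpM2l ?(ltW sq0)//.
  apply: (@le_trans _ _ (k2 * ((Cy + 1) + C1) * (Lp * `|b - b'|))).
    apply: ler_pM => //; first by apply: mulr_ge0; [exact: ltW|apply: addr_ge0 => //; apply: addr_ge0 => //; exact: ltW].
    by rewrite ler_wpM2l ?(ltW k20)// lerD2r lerD2l.
  have -> : k2 * ((Cy + 1) + C1) * (Lp * `|b - b'|) = k2 * C7 * `|b - b'| by rewrite /C7; ring.
  by rewrite ler_wpM2r.
have [b bV hb] := contraction_box (ltW V0) hV hL.
have ath := Ath b bV.
exists (X (A b)); split.
- by case: (HX1 _ ath).
- move=> i; have := Hep i e eep (X (A b) - q0) (qv + y0 + ya (A b)) (pB _ ath) (Xexp _ ath).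
  rewrite Xq phi0 subr0 (derive_add (qv + y0) (ya (A b)) (dphi_ i q0)) ler_norml => /andP[_ D0].
  have D1 : 'D_(ya (A b)) (phi i) q0 <= mu / 2.
    apply: (le_trans (ler_norm _)); apply: (le_trans (HC1p _ _)).
    have T1 := le_trans (HCy (A b)) (ler_wpM2l Cy0 (le_trans (HLp b) (ler_wpM2l (ltW Lp0) bV))).
    apply: (le_trans (ler_wpM2l C10 T1)); apply: le_trans VC.
    by rewrite le_eqVlt; apply/orP; left; apply/eqP; ring.
  have D2 : Cp i * (kC * e ^+ 2) <= e ^+ 2 * (mu / 4).
    have -> : Cp i * (kC * e ^+ 2) = e ^+ 2 * (Cp i * kC) by ring.
    rewrite ler_wpM2l ?(ltW sq0)//; apply: le_trans C5kC.1; rewrite ler_wpM2r//.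
    by case/andP: kC0 => /ltW.
  have D3 := Hmu i.
  have D4 : e * 'D_z (phi i) q0 <= 0 by rewrite mulr_ge0_le0.
  have D5 : e ^+ 2 * ('D_(qv + y0) (phi i) q0 + 'D_(ya (A b)) (phi i) q0 + 2^-1 * 'D_z ('D_z (phi i)) q0) <= e ^+ 2 * (- (mu / 2)).
    by rewrite ler_wpM2l ?(ltW sq0)//; exact: descent_arith D3 D1.
  have D6 : 0 < e ^+ 2 * mu by rewrite mulr_gt0.
  exact: negative_arith D0 D2 D4 D5 D6.
- move=> j; have := congr1 (fun x : 'rV[R]_deta => x 0 j) hb; rewrite /h !mxE => /sub_eq_self.
  by move=> /eqP; rewrite mulf_eq0 invr_eq0 (negbTE sqn)/= => /eqP.
Qed.

End LocalSolution.

(** * Cones of control variations *)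

Section AlmostEverywhere.
Context {R : realType} (T : R).
Local Notation leb := (@lebesgue_measure R).
Local Notation I0T := (`[0, T]%classic : set R).

Let aeF : Filter (almost_everywhere leb) := ae_filter_ringOfSetsType leb.

Lemma ae_onS (P Q : R -> Prop) : (forall t, I0T t -> P t -> Q t) -> ae_on T P -> ae_on T Q.
Proof.
by move=> PQ; rewrite /ae_on; apply: (@filterS _ _ aeF) => t Pt tT; exact: PQ (Pt tT).
Qed.

Lemma ae_onS2 (P Q S : R -> Prop) : (forall t, I0T t -> P t -> Q t -> S t) ->
  ae_on T P -> ae_on T Q -> ae_on T S.
Proof.
by move=> PQ; rewrite /ae_on; apply: (@filterS2 _ _ aeF) => t Pt Qt tT; exact: PQ (Pt tT) (Qt tT).
Qed.

Lemma ae_onW (P : R -> Prop) : (forall t, I0T t -> P t) -> ae_on T P.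
Proof. by move=> PT; apply: aeW => t tT; exact: PT. Qed.

Lemma ae_on_forall (I : finType) (P : I -> R -> Prop) : (forall i, ae_on T (P i)) ->
  ae_on T (fun t => forall i, P i t).
Proof.
move=> H; have : {ae leb, forall t, forall i, I0T t -> P i t} by apply: (@filter_forall _ _ _ _ aeF).
by rewrite /ae_on; apply: (@filterS _ _ aeF) => t Pt tT i; exact: Pt.
Qed.

Lemma ae_int_eq (f g : R -> R) t : integ T f -> integ T g -> ae_on T (fun t => f t = g t) -> I0T t ->
  \int[leb]_(s in `[0, t]) f s = \int[leb]_(s in `[0, t]) g s.
Proof.
move=> fi gi fg tT; have /andP[t0 tT'] := I0T_le tT; congr fine.
apply: ae_eq_integral => //.
- exact: (measurable_int _ (integ_sub tT' fi)).
- exact: (measurable_int _ (integ_sub tT' gi)).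
- move: fg; rewrite /ae_on; apply: (@filterS _ _ aeF) => s H /=; rewrite in_itv/= => /andP[s0 st].
  by rewrite H//= in_itv/= s0 (le_trans st).
Qed.

Lemma is_deriv_ae k (x y y' : R -> 'rV[R]_k) : ig T y' -> ae_on T (fun t => y t = y' t) ->
  is_deriv T x y -> is_deriv T x y'.
Proof.
move=> iy' yy' [iy xy]; split=> [i|t tT i]; first exact: iy'.
rewrite xy//; congr (_ + _); apply: ae_int_eq => //; first exact: iy.
by apply: ae_onS yy' => s _ ->.
Qed.

Lemma int_le0_ae (f : R -> R) : integ T f -> (forall t, I0T t -> 0 <= f t) ->
  \int[leb]_(t in `[0, T]) f t <= 0 -> ae_on T (fun t => f t = 0).
Proof.
move=> fi f0 If.
have I0 : (\int[leb]_(t in I0T) (f t)%:E = 0)%E.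
  have fin := @integrable_fin_num _ _ _ leb I0T (measurable_itv _) (EFin \o f) fi.
  rewrite -[LHS]fineK//; congr EFin; apply/eqP; rewrite eq_le If/=.
  exact: (Rintegral_ge0 leb).
have := @ae_eq_integral_abs _ _ _ leb I0T (measurable_itv _) (EFin \o f) (measurable_int _ fi).
case => + _ => /(_ _).
have -> : (\int[leb]_(x in I0T) `|(EFin \o f) x| = 0)%E.
  rewrite -[RHS]I0; apply: eq_integral => t; rewrite inE => tT /=.
  by rewrite ger0_norm// f0.
move=> /(_ erefl); rewrite /ae_on; apply: (@filterS _ _ aeF) => t H tT.
by have := H tT; rewrite /= => -[].
Qed.

Lemma bmeas_max (f g : R -> R) : bmeas T f -> bmeas T g -> bmeas T (fun t => Num.max (f t) (g t)).
Proof.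
move=> [mf [M fM]] [mg [N gN]]; split; first exact: measurable_maxr.
exists (M + N) => t tT; rewrite (le_trans _ (lerD (fM _ tT) (gN _ tT)))//.
by case: (leP (f t) (g t)) => _; rewrite ?lerDl ?lerDr.
Qed.

Lemma bmeas_clip (f g : R -> R) : bmeas T g -> measurable_fun I0T f -> (forall t, I0T t -> 0 <= g t) ->
  bmeas T (fun t => Num.max (- g t) (Num.min (g t) (f t))).
Proof.
move=> bg mf g0; have [mg [M gM]] := bg; split.
  apply: measurable_maxr; first exact: measurable_funN.
  exact: measurable_minr.
exists M => t tT; apply: le_trans (gM _ tT); rewrite [leRHS]ger0_norm ?g0//.
rewrite ler_norml; apply/andP; split; first by rewrite le_max lexx.
by rewrite ge_max ge_min lexx (le_trans _ (g0 _ tT))// oppr_le0 g0.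
Qed.

(** Clipping each [v_i] at [k u_i] gives a bounded direction along which a small step keeps the
    control nonnegative. *)
Definition clipv m (uc v : R -> 'rV[R]_m) (k : nat) (t : R) : 'rV[R]_m :=
  \row_i Num.max (- (k%:R * uc t 0 i)) (Num.min (k%:R * uc t 0 i) (v t 0 i)).

Lemma clip_dist (a b : R) : 0 <= a -> `|Num.max (- a) (Num.min a b) - b| <= `|b|.
Proof.
move=> a0; rewrite ler_norml; apply/andP.
have := ler_norm b; have := ler_norm (- b); rewrite normrN; move: `|b| => N.
by case: (leP a b); case: (leP (- a) a); case: (leP (- a) b); split; lra.
Qed.

Lemma clip_eq (a b : R) : `|b| <= a -> Num.max (- a) (Num.min a b) = b.
Proof.
by rewrite ler_norml => /andP[A B]; rewrite (min_idPr B) (max_idPr A).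
Qed.

(** Dominated convergence with bound [|v|]. At each time the clipped value equals [v] from some
    level on: where [u_i] is positive the level outgrows [v_i], and where [u_i] is 0 so is [v_i]. *)
Lemma clipv_cvg m (uc v : R -> 'rV[R]_m) (e : R) :
  (forall t i, I0T t -> 0 <= uc t 0 i) -> bm T uc -> (forall i, integ T (fun t => v t 0 i)) ->
  (forall t i, I0T t -> uc t 0 i = 0 -> v t 0 i = 0) -> 0 < e ->
  exists k, \int[leb]_(t in `[0, T]) `|clipv uc v k t - v t| <= e.
Proof.
move=> uc0 buc iv v0 e0.
have bc k i : bmeas T (fun t => clipv uc v k t 0 i).
  under eq_fun do rewrite mxE; apply: bmeas_clip => [||t tT].
  - exact/bmeasM/buc/bmeas_cst.
  - exact: integ_meas (iv i).
  - by rewrite mulr_ge0// uc0.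
have dle k t : I0T t -> `|clipv uc v k t - v t| <= `|v t|.
  move=> tT; apply: rV_norm_le => // i; rewrite !mxE.
  apply: le_trans (rV_norm_ge _ i); apply: clip_dist.
  by rewrite mulr_ge0// uc0.
have id k : integ T (fun t => `|clipv uc v k t - v t|).
  apply: integ_vnorm => i; apply: (@integ_ext _ _ (fun t => clipv uc v k t 0 i - v t 0 i)).
    by move=> t _; rewrite !mxE.
  by apply: integB => //; exact: bmeas_integ.
have A1 k : measurable_fun I0T (fun t => (`|clipv uc v k t - v t|)%:E).
  exact: (measurable_int _ (id k)).
have A3 : {ae leb, forall t, I0T t -> (fun k => (`|clipv uc v k t - v t|)%:E) @ \oo --> 0%E}.
  apply: aeW => t tT; apply: cvg_near_cst.
  have [K HK] : exists K : nat, forall i, `|v t 0 i| <= K%:R * uc t 0 i.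
    have /choice[K HK] : forall i, exists K : nat, `|v t 0 i| <= K%:R * uc t 0 i.
      move=> i; have [u0|u0] := eqVneq (uc t 0 i) 0.
        by exists 0%N; rewrite v0// normr0 mul0r.
      have up : 0 < uc t 0 i by rewrite lt0r u0 uc0.
      exists (Num.bound (`|v t 0 i| / uc t 0 i)).
      by rewrite -ler_pdivrMr// ltW// archi_boundP// divr_ge0// ltW.
    exists (\max_i K i)%N => i; apply: (le_trans (HK i)); rewrite ler_wpM2r ?uc0// ler_nat.
    exact: leq_bigmax.
  exists K => // k /= Kk; congr EFin; apply/eqP; rewrite normr_eq0 subr_eq0; apply/eqP/rowP => i.
  by rewrite mxE clip_eq// (le_trans (HK i))// ler_wpM2r ?uc0// ler_nat.
have A5 : {ae leb, forall t k, I0T t -> (`|(`|clipv uc v k t - v t|)%:E| <= (`|v t|)%:E)%E}.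
  by apply: aeW => t k tT; rewrite /= lee_fin normr_id dle.
have [_ _] := @dominated_convergence _ _ _ leb I0T (measurable_itv _) _ (cst 0%E) (fun t => (`|v t|)%:E) A1 (measurable_cst _) A3 (integ_vnorm iv) A5.
rewrite integral0 => /fine_cvgP[_ /cvgrPdist_le/(_ e e0)][K _ HK].
exists K; have := HK K (leqnn K); rewrite /= sub0r normrN.
by apply: le_trans; exact: ler_norm.
Qed.

End AlmostEverywhere.

(** * The drift as a control of constant value *)

Section Drift.
Context {R : realType} {n m : nat}.
Variables (f0 : 'rV[R]_n -> 'rV[R]_n) (f : 'I_m -> 'rV[R]_n -> 'rV[R]_n).
Implicit Types (x h k : 'rV[R]_n) (u v : 'rV[R]_m) (c d : R).

Definition Fx (i : 'I_m.+1) : 'rV[R]_n -> 'rV[R]_n := if unlift ord0 i is Some j then f j else f0.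
(** The leading coefficient [c] is 1 for controls and 0 for variations, which leave the drift
    alone. *)
Definition vext c u : 'rV[R]_m.+1 := \row_i (if unlift ord0 i is Some j then u 0 j else c).

Lemma Fx_C2 : is_C2 f0 -> (forall i, is_C2 (f i)) -> forall i, is_C2 (Fx i).
Proof. by move=> H0 H i; rewrite /Fx; case: (unlift _ _). Qed.

Lemma vext_ord0 c u : vext c u 0 ord0 = c.
Proof. by rewrite mxE unlift_none. Qed.

Lemma vext_lift c u i : vext c u 0 (lift ord0 i) = u 0 i.
Proof. by rewrite mxE liftK. Qed.

Lemma Fx_ord0 : Fx ord0 = f0.
Proof. by rewrite /Fx unlift_none. Qed.

Lemma Fx_lift i : Fx (lift ord0 i) = f i.
Proof. by rewrite /Fx liftK. Qed.

Lemma vext_sum (g : ('rV[R]_n -> 'rV[R]_n) -> 'rV[R]_n) c u :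
  \sum_(i < m.+1) vext c u 0 i *: g (Fx i) = c *: g f0 + \sum_(i < m) u 0 i *: g (f i).
Proof.
rewrite big_ord_recl vext_ord0 Fx_ord0; congr (_ + _).
by apply: eq_bigr => i _; rewrite vext_lift Fx_lift.
Qed.

Lemma G_vext x c u : G Fx x (vext c u) = c *: f0 x + \sum_(i < m) u 0 i *: f i x.
Proof. exact: (vext_sum (fun g => g x)). Qed.

Lemma DG_vext x c u h : DG Fx x (vext c u) h = c *: 'D_h f0 x + \sum_(i < m) u 0 i *: 'D_h (f i) x.
Proof. exact: (vext_sum (fun g => 'D_h g x)). Qed.

Lemma D2G_vext x c u h k : D2G Fx x (vext c u) h k =
  c *: 'D_k ('D_h f0) x + \sum_(i < m) u 0 i *: 'D_k ('D_h (f i)) x.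
Proof. exact: (vext_sum (fun g => 'D_k ('D_h g) x)). Qed.

Lemma vextD c d u v : vext (c + d) (u + v) = vext c u + vext d v.
Proof. by apply/rowP => i; rewrite !mxE; case: (unlift _ _) => [j|]; rewrite ?mxE. Qed.

Lemma vextZ c d u : vext (c * d) (c *: u) = c *: vext d u.
Proof. by apply/rowP => i; rewrite !mxE; case: (unlift _ _) => [j|]; rewrite ?mxE. Qed.

Lemma vext0Z c u : vext 0 (c *: u) = c *: vext 0 u.
Proof. by rewrite -vextZ mulr0. Qed.

Lemma vext0B u v : vext 0 (u - v) = vext 0 u - vext 0 v.
Proof. by rewrite -[in RHS]scaleN1r -vext0Z -vextD addr0 scaleN1r. Qed.

Lemma vext_norm c u : `|vext c u| <= `|c| + `|u|.
Proof.
apply: rV_norm_le => [|i]; first by rewrite addr_ge0.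
rewrite mxE; case: (unlift _ _) => [j|]; last by rewrite lerDl.
by rewrite (le_trans (rV_norm_ge _ _))// lerDr.
Qed.

Lemma vext0_norm u : `|vext 0 u| <= `|u|.
Proof. by have := vext_norm 0 u; rewrite normr0 add0r. Qed.

Lemma bm_vext (T c : R) (u : R -> 'rV[R]_m) : bm T u -> bm T (fun t => vext c (u t)).
Proof.
move=> bu i; under eq_fun do rewrite mxE.
by case: (unlift _ _) => [j|]; [exact: bu|exact: bmeas_cst].
Qed.

Lemma integ_vext (T c : R) (u : R -> 'rV[R]_m) : (forall i, integ T (fun t => u t 0 i)) ->
  forall i, integ T (fun t => vext c (u t) 0 i).
Proof.
move=> bu i; under eq_fun do rewrite mxE.
by case: (unlift _ _) => [j|]; [exact: bu|exact/bmeas_integ/bmeas_cst].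
Qed.

End Drift.

Lemma Rint_lincomb {R : realType} (T : R) (I : Type) (s : seq I) (c : I -> R) (g : I -> R -> R) :
  (forall i, integ T (g i)) ->
  \int[@lebesgue_measure R]_(t in `[0, T]) (\sum_(i <- s) c i * g i t) =
  \sum_(i <- s) c i * \int[@lebesgue_measure R]_(t in `[0, T]) g i t.
Proof.
move=> ig; elim: s => [|i s IH].
  rewrite big_nil (_ : (fun t => _) = fun=> 0); last by apply/funext => t; rewrite big_nil.
  by rewrite Rintegral_cst// mul0r.
rewrite (_ : (fun t => _) = fun t => c i * g i t + \sum_(j <- s) c j * g j t); last first.
  by apply/funext => t; rewrite big_cons.
rewrite big_cons -IH RintegralD//.
- by rewrite RintegralZl//; exact: ig.
- exact: (integZ _ (ig i)).
- by apply: integ_sum => j; exact: (integZ _ (ig j)).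
Qed.

(** * Admissible variations and their endpoint effect *)

Section Cones.
Context {R : realType} {n m : nat} (T : R).
Local Notation leb := (@lebesgue_measure R).
Local Notation I0T := (`[0, T]%classic : set R).
Local Notation E k := (delta_mx 0 k : 'rV[R]_n).
Variables (f0 : 'rV[R]_n -> 'rV[R]_n) (f : 'I_m -> 'rV[R]_n -> 'rV[R]_n).
Local Notation F := (Fx f0 f).
Hypothesis HF : forall i, is_C2 (F i).
Hypothesis T0 : 0 < T.
Variables (xh : R -> 'rV[R]_n) (uc : R -> 'rV[R]_m) (C rho : R).
Local Notation U := (fun t => vext 1 (uc t)).
Hypothesis buc : bm T uc.
Hypothesis uc0 : forall t i, I0T t -> 0 <= uc t 0 i.
Hypothesis dxh : is_deriv T xh (fun t => G F (xh t) (U t)).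
Hypothesis C1 : 1 <= C.
Hypothesis GB : Gbounds F rho C.
Hypothesis xhB : forall t, I0T t -> `|xh t| + 1 <= rho.
Variable Psi : 'I_n -> R -> 'rV[R]_n.
Hypothesis PsiS : forall j, adj_sol T (Amx F xh U) (Psi j).
Hypothesis PsiT : forall j, Psi j T = E j.
Variable BP : R.
Hypothesis BP0 : 0 <= BP.
Hypothesis PsiB : forall j t, I0T t -> `|Psi j t| <= BP.
Implicit Types (r w : R -> 'rV[R]_m).

Let cxh : contT T xh. Proof. exact: is_deriv_contT (ltW T0) dxh. Qed.

Definition Yr r : 'rV[R]_n := Y T Psi (fun t => G F (xh t) (vext 0 (r t))).

Lemma ig_Gr r : ig T r -> ig T (fun t => G F (xh t) (vext 0 (r t))).
Proof. by move=> ir j; apply: integ_G => //; exact: integ_vext. Qed.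

Lemma YrD r w : ig T r -> ig T w -> Yr (fun t => r t + w t) = Yr r + Yr w.
Proof.
move=> ir iw; rewrite /Yr -(YD T0 PsiS (ig_Gr ir) (ig_Gr iw)); apply: Y_ext => t _.
by rewrite -G_addu -vextD addr0.
Qed.

Lemma YrZ c r : ig T r -> Yr (fun t => c *: r t) = c *: Yr r.
Proof.
move=> ir; rewrite /Yr -(YZ T0 PsiS c (ig_Gr ir)); apply: Y_ext => t _.
by rewrite -G_scaleu vext0Z.
Qed.

Lemma YrB r w : ig T r -> ig T w -> Yr (fun t => r t - w t) = Yr r - Yr w.
Proof.
move=> ir iw; have iN := igZ (-1) iw.
rewrite -[X in _ + X](scaleN1r (Yr w)) -(YrZ (-1) iw) -(YrD ir iN).
by congr (Yr _); apply/funext => t; rewrite scaleN1r.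
Qed.

Lemma Yr_lincomb q (a : 'I_q -> R) (rs : 'I_q -> R -> 'rV[R]_m) : (forall l, ig T (rs l)) ->
  ig T (fun t => \sum_l a l *: rs l t) /\
  Yr (fun t => \sum_l a l *: rs l t) = \sum_l a l *: Yr (rs l).
Proof.
move=> ir.
suff S (s : seq 'I_q) : ig T (fun t => \sum_(l <- s) a l *: rs l t) /\
  Yr (fun t => \sum_(l <- s) a l *: rs l t) = \sum_(l <- s) a l *: Yr (rs l) by exact: S.
elim: s => [|l s [IH1 IH2]].
  rewrite (_ : (fun t => _) = fun=> 0); last by apply/funext => t; rewrite big_nil.
  have i0 : ig T (fun=> 0 : 'rV[R]_m).
    by move=> i; apply: (integ_ext _ (bmeas_integ (bmeas_cst T 0))) => t _; rewrite mxE.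
  split => //; rewrite big_nil -[RHS](scale0r (Yr (fun=> 0))) -(YrZ 0 i0).
  by congr (Yr _); apply/funext => t; rewrite scaler0.
rewrite (_ : (fun t => _) = fun t => a l *: rs l t + \sum_(l <- s) a l *: rs l t); last first.
  by apply/funext => t; rewrite big_cons.
split; first by apply: igD => //; exact: igZ.
rewrite YrD//; last exact: igZ.
by rewrite IH2 big_cons YrZ.
Qed.

Lemma Yr_norm r : ig T r -> `|Yr r| <= n%:R * BP * C * \int[leb]_(t in `[0, T]) `|r t|.
Proof.
move=> ir; have inr := integ_vnorm ir.
rewrite -mulrA -RintegralZl//.
apply: (Y_norm_le T0 PsiS BP0 PsiB (ig_Gr ir) (integZ C inr)) => t tT.
have [b0 _ _ _ _] := GB.
rewrite (le_trans (b0 _ _ (xh_box xhB tT)))// ler_wpM2l ?(le_trans ler01)//.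
exact: vext0_norm.
Qed.

(** [Rcone] is one-sided, since a control may be increased anywhere; it is only a convex cone. The
    two-sided [Dcone] is a linear space, as the corrections by linear combinations in [density]
    require. *)
Definition Rcone r := bm T r /\ exists2 K, 0 <= K & forall t i, I0T t -> - (K * uc t 0 i) <= r t 0 i.
Definition Dcone w := bm T w /\ exists2 K, 0 <= K & forall t i, I0T t -> `|w t 0 i| <= K * uc t 0 i.

Lemma RconeD r w : Rcone r -> Rcone w -> Rcone (fun t => r t + w t).
Proof.
move=> [br [K K0 HK]] [bw [K' K'0 HK']]; split; first exact: bmD.
exists (K + K'); first exact: addr_ge0.
by move=> t i tT; rewrite mxE mulrDl opprD lerD ?HK ?HK'.
Qed.

Lemma RconeZ c r : 0 <= c -> Rcone r -> Rcone (fun t => c *: r t).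
Proof.
move=> c0 [br [K K0 HK]]; split; first exact: bmZ.
exists (c * K); first exact: mulr_ge0.
by move=> t i tT; rewrite mxE -mulrA -mulrN ler_wpM2l ?HK.
Qed.

Lemma Rcone0 : Rcone (fun=> 0).
Proof.
split; first by move=> i; under eq_fun do rewrite mxE; exact: bmeas_cst.
by exists 0 => // t i tT; rewrite mul0r mxE oppr0.
Qed.

Lemma DconeD r w : Dcone r -> Dcone w -> Dcone (fun t => r t + w t).
Proof.
move=> [br [K K0 HK]] [bw [K' K'0 HK']]; split; first exact: bmD.
exists (K + K'); first exact: addr_ge0.
by move=> t i tT; rewrite mxE mulrDl (le_trans (ler_normD _ _))// lerD ?HK ?HK'.
Qed.

Lemma DconeZ c r : Dcone r -> Dcone (fun t => c *: r t).
Proof.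
move=> [br [K K0 HK]]; split; first exact: bmZ.
exists (`|c| * K); first exact: mulr_ge0.
by move=> t i tT; rewrite mxE -mulrA normrM ler_wpM2l ?HK.
Qed.

Lemma Dcone0 : Dcone (fun=> 0).
Proof.
split; first by move=> i; under eq_fun do rewrite mxE; exact: bmeas_cst.
by exists 0 => // t i tT; rewrite mul0r mxE normr0.
Qed.

Lemma Dcone_lincomb q (a : 'I_q -> R) (rs : 'I_q -> R -> 'rV[R]_m) :
  (forall l, Dcone (rs l)) -> Dcone (fun t => \sum_l a l *: rs l t).
Proof.
move=> Rr.
suff S (s : seq 'I_q) : Dcone (fun t => \sum_(l <- s) a l *: rs l t) by exact: S.
elim: s => [|l s IH].
  rewrite (_ : (fun t => _) = fun=> 0); last by apply/funext => t; rewrite big_nil.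
  exact: Dcone0.
rewrite (_ : (fun t => _) = fun t => a l *: rs l t + \sum_(l <- s) a l *: rs l t); last first.
  by apply/funext => t; rewrite big_cons.
by apply: DconeD => //; exact: DconeZ.
Qed.

Lemma clipv_Dcone (v : R -> 'rV[R]_m) k : ig T v -> Dcone (clipv uc v k).
Proof.
move=> iv; split.
  move=> i; under eq_fun do rewrite mxE; apply: bmeas_clip => [||t tT].
  - exact/bmeasM/buc/bmeas_cst.
  - exact: integ_meas (iv i).
  - by rewrite mulr_ge0// uc0.
exists k%:R => // t i tT; rewrite mxE ler_norml; apply/andP; split.
  by rewrite le_max lexx.
rewrite ge_max ge_min lexx andbT.
by rewrite (@le_trans _ _ 0)// ?oppr_le0 mulr_ge0// uc0.
Qed.

(* A dense subspace has the same image as the whole space under a linear map of finite rank. *)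
Lemma density (v : R -> 'rV[R]_m) (k : R) : ig T v ->
  (forall t i, I0T t -> uc t 0 i = 0 -> v t 0 i = 0) -> 0 < k ->
  exists w, [/\ Dcone w, \int[leb]_(t in `[0, T]) `|w t - v t| <= k & Yr w = Yr v].
Proof.
move=> iv v0 k0.
have [q [M [MS Mspan]]] := spanning_rows [set s | exists2 w, Dcone w & s = Yr w].
have /choice[ws Hws] : forall l, exists w, Dcone w /\ row l M = Yr w.
  by move=> l; have [w Dw ->] := MS l; exists w.
have Dws l := (Hws l).1.
have iws l : ig T (ws l) by apply: bm_ig; case: (Dws l).
pose c := n%:R * BP * C.
have c0 : 0 <= c by rewrite !mulr_ge0// (le_trans ler01).
have near w : ig T w -> `|Yr v - Yr w| <= c * \int[leb]_(t in `[0, T]) `|w t - v t|.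
  move=> iw; rewrite distrC -YrB//; apply: Yr_norm; exact: igB.
(* The row space of [M] is the kernel of [cokermx M], hence closed, and [Yr v] is a limit of the
   vectors [Yr (clipv uc v K)] that lie in it. *)
have vM : (Yr v <= M)%MS.
  rewrite submxE; apply/eqP/rowP => j; rewrite [RHS]mxE.
  have [L L0 HL] := mulmx_bound (cokermx M).
  apply/eqP; rewrite -normr_le0; apply/ler_addgt0Pl => e e0; rewrite addr0.
  have [e1 /andP[e10 _] He1] := small_eps (mulr_ge0 (ltW L0) c0) e0.
  have [K HK] := clipv_cvg uc0 buc iv v0 e10.
  have Dw := clipv_Dcone K iv.
  have iw : ig T (clipv uc v K) by apply: bm_ig; case: Dw.
  have : (Yr (clipv uc v K) <= M)%MS by apply: Mspan; exists (clipv uc v K).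
  rewrite submxE => /eqP wK.
  rewrite (le_trans (rV_norm_ge _ j))// -[Yr v *m _]subr0 -wK -mulmxBl.
  rewrite (le_trans (HL _))//; apply: (le_trans _ (He1 e1 _)); last by rewrite e10 lexx.
  rewrite [leRHS]mulrCA ler_wpM2l ?(ltW L0)// (le_trans (near _ iw))//.
  by rewrite [leRHS]mulrC ler_wpM2l.
have [L L0 HL] := mulmx_bound (pinvmx M).
pose S := \sum_l \int[leb]_(t in `[0, T]) `|ws l t|.
have S0 : 0 <= S by apply: sumr_ge0 => l _; apply: Rintegral_ge0.
(* The term 1 accounts for the clipping error. The other term accounts for the correction: its
   coefficients are at most [L c e1], and [S] sums the norms of the directions [ws l]. *)
have B0 : 0 <= 1 + L * c * S by apply: addr_ge0 => //; apply: mulr_ge0 => //; exact: (mulr_ge0 (ltW L0)).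
have [e1 /andP[e10 _] He1] := small_eps B0 k0.
have [K HK] := clipv_cvg uc0 buc iv v0 e10.
set wk := clipv uc v K in HK.
have Dw : Dcone wk by exact: clipv_Dcone.
have iw : ig T wk by apply: bm_ig; case: Dw.
pose a := (Yr v - Yr wk) *m pinvmx M.
have aM : a *m M = Yr v - Yr wk.
  apply: mulmxKpV; apply: addmx_sub => //; rewrite eqmx_opp.
  by apply: Mspan; exists wk.
have [ia Ya] := Yr_lincomb (fun l => a 0 l) iws.
have aE : \sum_l a 0 l *: Yr (ws l) = Yr v - Yr wk.
  rewrite -aM mulmx_sum_row; apply: eq_bigr => l _.
  by rewrite (Hws l).2.
exists (fun t => wk t + \sum_l a 0 l *: ws l t); split.
- by apply: DconeD => //; exact: Dcone_lincomb.
- have i1 : integ T (fun t => `|wk t - v t|) by apply: integ_vnorm; exact: igB.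
  have i2 : integ T (fun t => \sum_l `|a 0 l| * `|ws l t|).
    by apply: integ_sum => l; exact: (integZ _ (integ_vnorm (iws l))).
  apply: (@le_trans _ _ (\int[leb]_(t in `[0, T]) (`|wk t - v t| + \sum_l `|a 0 l| * `|ws l t|))).
    apply: le_Rintegral => //.
    + exact: (integ_vnorm (igB (igD iw ia) iv)).
    + exact: (integD i1 i2).
    + move=> t _; rewrite addrAC (le_trans (ler_normD _ _))// lerD2l.
      rewrite (le_trans (ler_norm_sum _ _ _))//; apply: ler_sum => l _.
      by rewrite normrZ.
  rewrite RintegralD//.
  rewrite (Rint_lincomb _ (fun l => `|a 0 l|) (fun l => integ_vnorm (iws l))); apply: (le_trans _ (He1 e1 _)); last by rewrite e10 lexx.
  rewrite mulrDr mulr1 lerD//.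
  apply: (@le_trans _ _ (`|a| * S)).
    rewrite mulr_sumr; apply: ler_sum => l _; rewrite ler_wpM2r//; last exact: rV_norm_ge.
    exact: Rintegral_ge0.
  rewrite mulrA ler_wpM2r// (le_trans (HL _))// [leRHS]mulrCA ler_wpM2l ?(ltW L0)//.
  by rewrite [leRHS]mulrC (le_trans (near _ iw))// ler_wpM2l.
- by rewrite YrD// Ya aE addrC subrK.
Qed.

End Cones.

(** * Multipliers and the second variation *)

Section Lagrangian.
Context {R : realType} {n : nat}.
Implicit Types (g h : 'rV[R]_n -> R) (v w : 'rV[R]_n).

Lemma twice_diffD g h : twice_diff g -> twice_diff h ->
  [/\ twice_diff (fun q => g q + h q),
      forall v, 'D_v (fun q => g q + h q) = (fun q => 'D_v g q + 'D_v h q) &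
      forall v w x, 'D_w ('D_v (fun q => g q + h q)) x = 'D_w ('D_v g) x + 'D_w ('D_v h) x].
Proof.
move=> [g1 g2] [h1 h2].
have E1 v : 'D_v (fun q => g q + h q) = (fun q => 'D_v g q + 'D_v h q).
  by apply/funext => q; apply: deriveD; exact: diff_derivable.
split=> [|//|v w x]; last by rewrite E1; apply: deriveD; exact: diff_derivable.
split=> [x|v x]; first exact: differentiableD.
by rewrite E1; exact: differentiableD.
Qed.

Lemma twice_diffZ g (c : R) : twice_diff g ->
  [/\ twice_diff (fun q => c * g q),
      forall v, 'D_v (fun q => c * g q) = (fun q => c * 'D_v g q) &
      forall v w x, 'D_w ('D_v (fun q => c * g q)) x = c * 'D_w ('D_v g) x].
Proof.
move=> [g1 g2].
have E1 v : 'D_v (fun q => c * g q) = (fun q => c * 'D_v g q).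
  by apply/funext => q; apply: deriveZ; exact: diff_derivable.
split=> [|//|v w x]; last by rewrite E1; apply: deriveZ; exact: diff_derivable.
split=> [x|v x]; first exact: differentiableZ.
by rewrite E1; exact: differentiableZ.
Qed.

Lemma twice_diff_lincomb (I : Type) (s : seq I) (a : I -> R) (g : I -> 'rV[R]_n -> R) :
  (forall i, twice_diff (g i)) ->
  [/\ twice_diff (fun q => \sum_(i <- s) a i * g i q),
      forall v, 'D_v (fun q => \sum_(i <- s) a i * g i q) = (fun q => \sum_(i <- s) a i * 'D_v (g i) q) &
      forall v w x, 'D_w ('D_v (fun q => \sum_(i <- s) a i * g i q)) x =
        \sum_(i <- s) a i * 'D_w ('D_v (g i)) x].
Proof.
move=> tg; elim: s => [|i s [IH1 IH2 IH3]].
  rewrite (_ : (fun q => _) = cst 0); last by apply/funext => q; rewrite big_nil.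
  have D0 v : 'D_v (cst 0 : 'rV[R]_n -> R) = cst 0 by apply/funext => q; rewrite derive_cst.
  split=> [|v|v w x]; last by rewrite (D0 v) big_nil derive_cst.
  - by split=> [x|v x]; [|rewrite (D0 v)]; exact: differentiable_cst.
  - by rewrite (D0 v); apply/funext => q; rewrite big_nil.
have E (b : I -> R) : \sum_(j <- i :: s) a j * b j = a i * b i + \sum_(j <- s) a j * b j.
  by rewrite big_cons.
rewrite (_ : (fun q => _) = fun q => a i * g i q + \sum_(j <- s) a j * g j q); last first.
  by apply/funext => q; exact: E.
have [Z1 Z2 Z3] := twice_diffZ (a i) (tg i).
have [D1 D2 D3] := twice_diffD Z1 IH1.
split=> [//|v|v w x].
- rewrite D2; apply/funext => q; rewrite [RHS]E; congr (_ + _).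
    exact: (congr1 (@^~ q) (Z2 v)).
  exact: (congr1 (@^~ q) (IH2 v)).
- by rewrite D3 Z3 IH3 E.
Qed.

End Lagrangian.

(** * Adjoint arcs, the minimum condition and the second variation *)

Section Multipliers.
Context {R : realType} {n m : nat} (T : R).
Local Notation leb := (@lebesgue_measure R).
Local Notation I0T := (`[0, T]%classic : set R).
Local Notation E k := (delta_mx 0 k : 'rV[R]_n).
Variables (f0 : 'rV[R]_n -> 'rV[R]_n) (f : 'I_m -> 'rV[R]_n -> 'rV[R]_n).
Local Notation F := (Fx f0 f).
Hypothesis HF : forall i, is_C2 (F i).
Hypothesis T0 : 0 < T.
Variables (xh : R -> 'rV[R]_n) (uc uh : R -> 'rV[R]_m) (C rho : R).
Local Notation U := (fun t => vext 1 (uc t)).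
Hypothesis buc : bm T uc.
Hypothesis uc0 : forall t i, I0T t -> 0 <= uc t 0 i.
Hypothesis uhE : ae_on T (fun t => uh t = uc t).
Hypothesis dxh : is_deriv T xh (fun t => G F (xh t) (U t)).
Hypothesis C1 : 1 <= C.
Hypothesis GB : Gbounds F rho C.
Hypothesis xhB : forall t, I0T t -> `|xh t| + 1 <= rho.
Variable Psi : 'I_n -> R -> 'rV[R]_n.
Hypothesis PsiS : forall j, adj_sol T (Amx F xh U) (Psi j).
Hypothesis PsiT : forall j, Psi j T = E j.
Local Notation Yr := (Yr T f0 f xh Psi).

Let T0' : 0 <= T. Proof. exact: ltW. Qed.

Let cxh : contT T xh. Proof. exact: is_deriv_contT T0' dxh. Qed.

Let bU : bm T U. Proof. exact: bm_vext. Qed.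

Let bA k l : bmeas T (fun t => Amx F xh U t k l).
Proof. exact: (bAmx HF T0 bU dxh). Qed.

Let ITT : I0T T. Proof. by rewrite /= in_itv/= T0' lexx. Qed.

Let I00 : I0T 0. Proof. by rewrite /= in_itv/= T0' lexx. Qed.

(** The adjoint solution with terminal value [p]; pairing [p] with [Y g] becomes the integral of its
    pairing with [g]. *)
Definition psi_of (p : 'rV[R]_n) t := \sum_k p 0 k *: Psi k t.

Lemma psi_of_adj p : adj_sol T (Amx F xh U) (psi_of p).
Proof.
have := is_deriv_lincomb (index_enum 'I_n) (fun k => p 0 k) PsiS.
apply: is_deriv_ext => t _; rewrite /psi_of mulmx_suml -sumrN.
by apply: eq_bigr => k _; rewrite scalerN scalemxAl.
Qed.

Lemma psi_ofT p : psi_of p T = p.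
Proof.
by rewrite /psi_of [RHS]row_sum_delta; apply: eq_bigr => k _; rewrite PsiT.
Qed.

Lemma psi_of_cont p : contT T (psi_of p).
Proof. exact: is_deriv_contT T0' (psi_of_adj p). Qed.

Lemma dot_Y p g : ig T g -> dot p (Y T Psi g) = \int[leb]_(t in `[0, T]) dot (psi_of p t) (g t).
Proof.
move=> igg; rewrite /dot; under eq_bigr do rewrite mxE.
have ik k : integ T (fun t => dot (Psi k t) (g t)).
  by apply: integ_dot => //; exact: (@cPsi _ _ _ _ _ T0 _ _ _ PsiS).
rewrite -(Rint_lincomb _ (fun k => p 0 k) ik); congr Rintegral; apply/funext => t.
transitivity (\sum_k \sum_j p 0 k * (Psi k t 0 j * g t 0 j)).
  by apply: eq_bigr => k _; rewrite mulr_sumr.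
rewrite exchange_big/=; apply: eq_bigr => j _.
rewrite /psi_of summxE mulr_suml; apply: eq_bigr => k _.
by rewrite mxE mulrA.
Qed.

Definition Hui p i t := dot (psi_of p t) (f i (xh t)).

Lemma Fx_cont i : contT T (fun t => f i (xh t)).
Proof. by rewrite -(Fx_lift f0 f i); apply: (contF HF). Qed.

Lemma dot_contT k (a b : R -> 'rV[R]_k) : contT T a -> contT T b -> contT T (fun t => dot (a t) (b t)).
Proof.
by move=> ca cb; apply: contT_sum => i; apply: contTM; exact: contT_coord.
Qed.

Lemma Hui_cont p i : contT T (Hui p i).
Proof. by apply: dot_contT; [exact: psi_of_cont|exact: Fx_cont]. Qed.

Lemma dot_vext0 p t (r : 'rV[R]_m) :
  dot (psi_of p t) (G F (xh t) (vext 0 r)) = \sum_i r 0 i * Hui p i t.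
Proof.
rewrite G_vext scale0r add0r dotC.
elim/big_ind2 : _ => [|a a' b b' <- <-|i _]; first by rewrite dotC dot0r.
  exact: dotDl.
by rewrite dotZl dotC.
Qed.

Lemma dot_Yr p r : ig T r -> dot p (Yr r) = \int[leb]_(t in `[0, T]) (\sum_i r t 0 i * Hui p i t).
Proof.
move=> ir; rewrite dot_Y; last exact: (ig_Gr HF T0 dxh).
by congr Rintegral; apply/funext => t; rewrite dot_vext0.
Qed.

Definition coordv (i : 'I_m) (h : R -> R) t : 'rV[R]_m := h t *: delta_mx 0 i.

Lemma coordvE i h t j : coordv i h t 0 j = if j == i then h t else 0.
Proof. by rewrite !mxE eqxx/=; case: eqP => _; rewrite ?mulr1 ?mulr0. Qed.

Lemma coordv_Rcone i h K : bmeas T h -> 0 <= K -> (forall t, I0T t -> - (K * uc t 0 i) <= h t) ->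
  Rcone T uc (coordv i h).
Proof.
move=> bh K0 hK; split.
  move=> j; have [->|ji] := eqVneq j i.
    by apply: (bmeas_ext _ bh) => t _; rewrite coordvE eqxx.
  by apply: (bmeas_ext _ (bmeas_cst T 0)) => t _; rewrite coordvE (negbTE ji).
exists K => // t j tT; rewrite coordvE; have [->|ji] := eqVneq j i; first exact: hK.
by rewrite oppr_le0 mulr_ge0// uc0.
Qed.

Lemma dot_Yr_coordv p i h : bmeas T h ->
  dot p (Yr (coordv i h)) = \int[leb]_(t in `[0, T]) (h t * Hui p i t).
Proof.
move=> bh; rewrite dot_Yr.
  congr Rintegral; apply/funext => t; rewrite (bigD1 i)//= coordvE eqxx big1 ?addr0// => j ji.
  by rewrite coordvE (negbTE ji) mul0r.
move=> j; have [->|ji] := eqVneq j i.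
  by apply: (integ_ext _ (bmeas_integ bh)) => t _; rewrite coordvE eqxx.
by apply: (integ_ext _ (bmeas_integ (bmeas_cst T 0))) => t _; rewrite coordvE (negbTE ji).
Qed.

(** Two test variations for each coordinate: [max(0, -H_i)], which is nonnegative, and [-u_i H_i],
    which lies in the cone because [H_i] is bounded. Their pairings are minus the integrals of
    [max(0, -H_i)^2] and of [u_i H_i^2], so both integrands vanish almost everywhere. *)
Lemma Hui_sign p : (forall r, Rcone T uc r -> 0 <= dot p (Yr r)) ->
  ae_on T (fun t => forall i, 0 <= Hui p i t /\ uc t 0 i * Hui p i t = 0).
Proof.
move=> Hp; apply: ae_on_forall => i.
have bH : bmeas T (Hui p i) by apply: contT_bmeas; exact: Hui_cont.
have bp : bmeas T (fun t => Num.max 0 (- Hui p i t)).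
  by apply: bmeas_max; [exact: bmeas_cst|exact: bmeasN].
have A1 : ae_on T (fun t => - (Num.max 0 (- Hui p i t) * Hui p i t) = 0).
  apply: int_le0_ae => [|t tT|].
  - by apply: bmeas_integ; apply: bmeasN; exact: bmeasM.
  - rewrite -mulrN; case: (leP 0 (- Hui p i t)) => h; first exact: mulr_ge0.
    by rewrite mul0r.
  - have bpH := bmeas_integ (bmeasM bp bH).
    rewrite (_ : (fun t => _) = fun t => (-1) * (Num.max 0 (- Hui p i t) * Hui p i t)); last first.
      by apply/funext => t; rewrite mulN1r.
    rewrite RintegralZl// mulN1r oppr_le0 -dot_Yr_coordv//; apply: Hp.
    apply: (coordv_Rcone (K := 0)) => // t tT; rewrite mul0r oppr0.
    by rewrite le_max lexx.
have bu : bmeas T (fun t => - (uc t 0 i * Hui p i t)) by apply: bmeasN; apply: bmeasM.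
have [_ [K HK]] := bH.
have K0 : 0 <= K by rewrite (le_trans _ (HK _ I00)).
have A2 : ae_on T (fun t => uc t 0 i * Hui p i t * Hui p i t = 0).
  apply: int_le0_ae => [|t tT|].
  - by apply: bmeas_integ; apply: bmeasM => //; apply: bmeasM.
  - by rewrite -mulrA mulr_ge0// ?uc0// -expr2 sqr_ge0.
  - have := bmeas_integ (bmeasM bu bH) => ib.
    rewrite (_ : (fun t => _) = fun t => (-1) * (- (uc t 0 i * Hui p i t) * Hui p i t)); last first.
      by apply/funext => t; rewrite mulN1r mulNr opprK.
    rewrite RintegralZl// mulN1r oppr_le0 -dot_Yr_coordv//; apply: Hp.
    apply: (coordv_Rcone (K := K)) => // t tT.
    rewrite lerN2 mulrC ler_wpM2r ?uc0// (le_trans (ler_norm _))// HK//.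
apply: (ae_onS2 _ A1 A2) => t tT h1 h2; split.
  rewrite leNgt; apply/negP => Hn; move: h1.
  rewrite max_r; last by rewrite oppr_ge0 ltW.
  by rewrite mulNr opprK => /eqP; rewrite mulf_eq0 orbb => /eqP h; rewrite h ltxx in Hn.
have /eqP := h2; rewrite mulf_eq0 => /orP[/eqP//|/eqP->].
by rewrite mulr0.
Qed.

Lemma is_deriv_lip k (x y : R -> 'rV[R]_k) M : 0 <= M -> is_deriv T x y ->
  (forall t i, I0T t -> `|y t 0 i| <= M) ->
  forall s t, I0T s -> I0T t -> `|x s - x t| <= M * `|s - t|.
Proof.
move=> M0 [iy Dx] yM.
have H s t : I0T s -> I0T t -> s <= t -> `|x s - x t| <= M * `|s - t|.
  move=> sT tT st; have /andP[s0 _] := I0T_le sT; have /andP[t0 tT'] := I0T_le tT.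
  apply: rV_norm_le => [|i]; first exact: mulr_ge0.
  rewrite !mxE (Dx s sT) (Dx t tT) opprD addrACA subrr add0r distrC.
  rewrite (prim_diff (iy i) s0 st tT') (distrC s t) (@ger0_norm _ (t - s)) ?subr_ge0//.
  have cI (c : R) : \int[leb]_(r in `]s, t]) c = c * (t - s).
    rewrite -(prim_diff (g := fun=> c) (integ_cst T c) s0 st tT').
    by rewrite (Rint_cst _ tT) (Rint_cst _ sT) mulrBr.
  have yb r : s <= r -> r <= t -> - M <= y r 0 i <= M.
    by move=> sr rt; rewrite -ler_norml; apply: yM; rewrite /= in_itv/= (le_trans s0 sr) (le_trans rt).
  rewrite ler_norml -mulNr -!cI; apply/andP; split; apply: (int_oc_le s0 tT') => [||r sr rt];
    solve [exact: iy|exact: integ_cst|by have /andP[] := yb r sr rt].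
move=> s t sT tT; have [st|/ltW ts] := leP s t; first exact: H.
by rewrite distrC [`|s - t|]distrC; exact: H.
Qed.

Lemma psi_of_lip p : exists L : R, forall s t, I0T s -> I0T t ->
  `|psi_of p s - psi_of p t| <= L * `|s - t|.
Proof.
have bM i : bmeas T (fun t => (- (psi_of p t *m (Amx F xh U t)^T)) 0 i).
  have bAT k l : bmeas T (fun t => (Amx F xh U t)^T k l).
    by apply: (bmeas_ext _ (bA l k)) => t _; rewrite [RHS]mxE.
  have bpA : bmeas T (fun t => (psi_of p t *m (Amx F xh U t)^T) 0 i).
    by apply: bmeas_mulmx => //; exact: psi_of_cont.
  apply: (bmeas_ext _ (bmeasN bpA)) => t _.
  by rewrite [RHS]mxE.
have /choice[Ms HM] : forall i, exists M, forall t, I0T t ->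
    `|(- (psi_of p t *m (Amx F xh U t)^T)) 0 i| <= M by move=> i; have [_] := bM i.
exists (\sum_i `|Ms i|); apply: (is_deriv_lip _ (psi_of_adj p)) => [|t i tT].
  by apply: sumr_ge0.
rewrite (le_trans (HM i t tT))// (le_trans (ler_norm _))// (bigD1 i)//= lerDl.
exact: sumr_ge0.
Qed.

Section Lambda.
Variables (dphi deta : nat) (phi : 'I_dphi.+1 -> 'rV[R]_n -> R) (eta : 'I_deta -> 'rV[R]_n -> R).
Hypothesis Tphi : forall i, twice_diff (phi i).
Hypothesis Teta : forall j, twice_diff (eta j).
Implicit Types (a : 'I_dphi.+1 -> R) (b : 'I_deta -> R).

Lemma ell_facts a b (ps : R -> 'rV[R]_n) : let g := ell phi eta (Mult a b ps) in
  [/\ twice_diff g,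
      forall h x, 'D_h g x = \sum_i a i * 'D_h (phi i) x + \sum_j b j * 'D_h (eta j) x &
      forall v w x, 'D_w ('D_v g) x =
        \sum_i a i * 'D_w ('D_v (phi i)) x + \sum_j b j * 'D_w ('D_v (eta j)) x].
Proof.
have [p1 p2 p3] := twice_diff_lincomb (index_enum 'I_dphi.+1) a Tphi.
have [e1 e2 e3] := twice_diff_lincomb (index_enum 'I_deta) b Teta.
have [g1 g2 g3] := twice_diffD p1 e1.
split=> [//|h x|v w x].
- rewrite (congr1 (@^~ x) (g2 h)); congr (_ + _).
    exact: (congr1 (@^~ x) (p2 h)).
  exact: (congr1 (@^~ x) (e2 h)).
- by rewrite g3 p3 e3.
Qed.

(** The zero arc is a placeholder: [ell] reads only [alpha] and [beta], so the terminal value is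
    available before the arc [psi_of (grad a b)] that it determines. *)
Definition grad a b : 'rV[R]_n := ell' phi eta (Mult a b (fun=> 0)) (xh T).

Lemma dot_grad a b h :
  dot (grad a b) h = \sum_i a i * 'D_h (phi i) (xh T) + \sum_j b j * 'D_h (eta j) (xh T).
Proof.
have [[d1 _] g2 _] := ell_facts a b (fun=> 0).
rewrite -(g2 h (xh T)) (derive_basis h (d1 (xh T))).
by apply: eq_bigr => k _; rewrite mulrC [X in _ * X]mxE.
Qed.

Definition lam a b : @mult R n dphi deta := Mult a b (psi_of (grad a b)).

Lemma lam_in_Lambda a b : \sum_i `|a i| + \sum_j `|b j| = 1 -> (forall i, 0 <= a i) ->
  (forall r, Rcone T uc r -> 0 <= dot (grad a b) (Yr r)) ->
  in_Lambda T f0 f phi eta xh uh (lam a b).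
Proof.
move=> ab1 a0 Hp; set p := grad a b in Hp *.
split=> //; split=> //; split; first exact: psi_of_lip.
split.
  exists (fun t => - (psi_of p t *m (Amx F xh U t)^T)); split; first exact: psi_of_adj.
  apply: (ae_onS _ uhE) => t tT ut; congr (- _); apply/rowP => k.
  rewrite [LHS]mxE [RHS]mxE; apply: eq_bigr => l _; congr (_ * _).
  by rewrite [LHS]mxE [LHS]mxE DG_vext scale1r /Aop ut.
split; first exact: psi_ofT.
apply: (ae_onS2 _ uhE (Hui_sign Hp)) => t tT ut Ht v v0; rewrite ut.
have HamE (w : 'rV[R]_m) : Ham f0 f (lam a b) (xh t) w t =
    dot (psi_of p t) (f0 (xh t)) + \sum_i w 0 i * Hui p i t.
  rewrite /Ham /dyn dotDr; congr (_ + _); rewrite -dot_vext0 G_vext scale0r add0r//.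
(* The control-dependent part of the Hamiltonian is 0 at [uh] by complementarity and nonnegative at
   every admissible [v]. *)
rewrite !HamE lerD2l; apply: (@le_trans _ _ 0).
  by rewrite big1// => i _; have [_ ->] := Ht i.
by apply: sumr_ge0 => i _; apply: mulr_ge0 => //; have [] := Ht i.
Qed.

Section SecondVariation.
Variables (z : R -> 'rV[R]_n) (v vh : R -> 'rV[R]_m).
Hypothesis iv : ig T v.
Hypothesis dz : is_deriv T z (fun t => DG F (xh t) (U t) (z t) + G F (xh t) (vext 0 (v t))).
Hypothesis vhE : ae_on T (fun t => vh t = v t).
Hypothesis mvh : forall i, measurable_fun I0T (fun t => vh t 0 i).
Hypothesis muh : forall i, measurable_fun I0T (fun t => uh t 0 i).
Let cz : contT T z. Proof. exact: is_deriv_contT T0' dz. Qed.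

Local Notation Q t := (Q2 F xh U z (fun t => vext 0 (v t)) t).

Lemma ae_int_eqT (g h : R -> R) : measurable_fun I0T g -> measurable_fun I0T h ->
  ae_on T (fun t => g t = h t) -> \int[leb]_(t in `[0, T]) g t = \int[leb]_(t in `[0, T]) h t.
Proof.
move=> mg mh gh; congr fine; apply: ae_eq_integral => //.
- exact/measurable_EFinP.
- exact/measurable_EFinP.
- by move: gh; rewrite /ae_on; apply: (@filterS _ _ (ae_filter_ringOfSetsType leb)) => s H /= /H->.
Qed.

Lemma meas_comb k (u : R -> 'rV[R]_k) (b : 'I_k -> R -> R) :
  (forall i, measurable_fun I0T (fun t => u t 0 i)) -> (forall i, contT T (b i)) ->
  measurable_fun I0T (fun t => \sum_i u t 0 i * b i t).
Proof.
move=> mu cb; apply: measurable_sum => i; apply: measurable_funM => //.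
by have [] := contT_bmeas (cb i).
Qed.

Let igQ : ig T (fun t => Q t).
Proof. exact: (ig_Q2 HF T0 bU dxh (integ_vext 0 iv) dz). Qed.

Lemma dot_sumr k (I : Type) (s : seq I) (c : I -> R) (x : 'rV[R]_k) (y : I -> 'rV[R]_k) :
  dot x (\sum_(i <- s) c i *: y i) = \sum_(i <- s) c i * dot x (y i).
Proof.
elim: s => [|i s IH]; first by rewrite !big_nil dot0r.
by rewrite !big_cons dotDr dotZr IH.
Qed.

Let Dz_cont i : contT T (fun t => 'D_(z t) (F i) (xh t)).
Proof.
have [d1 [d2 d3]] := HF i; apply: contT_derive => // v' x.
by apply: differentiable_continuous; exact: d2.
Qed.

Let DDz_cont i : contT T (fun t => 'D_(z t) ('D_(z t) (F i)) (xh t)).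
Proof. by have [d1 [d2 d3]] := HF i; apply: contT_derive2. Qed.

(** The integrand equals [2 dot psi Q] almost everywhere, since [Q] carries the factor one half on
    the second derivative only. The adjoint equation then moves the integral to the endpoint. *)
Lemma int_Hxx a b : 2^-1 * \int[leb]_(t in `[0, T])
    (Hxx f0 f xh uh (lam a b) t (z t) + 2 * Hux f xh (lam a b) t (z t) (vh t)) =
  dot (grad a b) (Y T Psi (fun t => Q t)).
Proof.
rewrite dot_Y//; set ps := psi_of (grad a b).
have cps : contT T ps := @psi_of_cont (grad a b).
have iQ : integ T (fun t => dot (ps t) (Q t)) by exact: integ_dot.
rewrite (_ : \int[leb]_(t in `[0, T]) _ = \int[leb]_(t in `[0, T]) (2 * dot (ps t) (Q t))).
  by rewrite RintegralZl// mulrA mulVf// mul1r.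
have cD i : contT T (fun t => dot (ps t) ('D_(z t) (f i) (xh t))).
  by apply: dot_contT => //; have := @Dz_cont (lift ord0 i); rewrite Fx_lift.
have cDD i : contT T (fun t => dot (ps t) ('D_(z t) ('D_(z t) (f i)) (xh t))).
  by apply: dot_contT => //; have := @DDz_cont (lift ord0 i); rewrite Fx_lift.
have cDD0 : contT T (fun t => dot (ps t) ('D_(z t) ('D_(z t) f0) (xh t))).
  by apply: dot_contT => //; have := @DDz_cont ord0; rewrite Fx_ord0.
have HxxE t : Hxx f0 f xh uh (lam a b) t (z t) = dot (ps t) ('D_(z t) ('D_(z t) f0) (xh t)) +
    \sum_i uh t 0 i * dot (ps t) ('D_(z t) ('D_(z t) (f i)) (xh t)).
  by rewrite /Hxx dotDr dot_sumr.
apply: ae_int_eqT.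
- apply: measurable_funD.
    rewrite (funext HxxE); apply: measurable_funD; last exact: meas_comb.
    by have [] := contT_bmeas cDD0.
  by apply: measurable_funM; [exact: measurable_cst|exact: (meas_comb mvh cD)].
- by apply: integ_meas; exact: integZ.
apply: (ae_onS2 _ uhE vhE) => t tT ut vt.
rewrite HxxE /Q2 dotDr dotZr mulrDr mulrA mulfV// mul1r; congr (_ + 2 * _).
- by rewrite D2G_vext scale1r dotDr dot_sumr ut.
- by rewrite DG_vext scale0r add0r dot_sumr /Hux vt.
Qed.

(** Writes [Omega] as a combination with weights [a], [b] of the quantities called [curv] below,
    that is, as the expression that [alternative] makes nonnegative. *)
Lemma Omega_lam a b : Omega T f0 f phi eta xh uh (lam a b) z vh =
  \sum_i a i * ('D_(Y T Psi (fun t => Q t)) (phi i) (xh T) + 2^-1 * 'D_(z T) ('D_(z T) (phi i)) (xh T)) +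
  \sum_j b j * ('D_(Y T Psi (fun t => Q t)) (eta j) (xh T) + 2^-1 * 'D_(z T) ('D_(z T) (eta j)) (xh T)).
Proof.
have [_ _ g3] := ell_facts a b (psi_of (grad a b)).
have E I (s : seq I) (c A B : I -> R) :
  \sum_(i <- s) c i * (A i + 2^-1 * B i) = \sum_(i <- s) c i * A i + 2^-1 * \sum_(i <- s) c i * B i.
  rewrite mulr_sumr -big_split; apply: eq_bigr => i _.
  by rewrite mulrDr mulrCA.
rewrite /Omega (g3 (z T) (z T) (xh T)) int_Hxx dot_grad !E addrACA -mulrDr addrC.
by [].
Qed.
End SecondVariation.

End Lambda.

End Multipliers.

(** * The multiplier rule by separation of a convex cone *)

Lemma ge0_lim {R : realType} (x y : R) : (forall e, 0 < e -> 0 <= x + e * y) -> 0 <= x.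
Proof.
move=> H; rewrite leNgt; apply/negP => x0.
have m0 : 0 < - x / 2 by rewrite divr_gt0// oppr_gt0.
have [e /andP[e0 _] He] := small_eps (normr_ge0 y) m0.
have := H e e0; rewrite leNgt => /negP; apply.
have := He e; rewrite e0 lexx => /(_ isT) h.
have := ler_wpM2l (ltW e0) (ler_norm y); lra.
Qed.

Section MultiplierRule.
Context {R : realType}.

Lemma dot_mulmx k (a b : 'rV[R]_k) : dot a b = (b *m a^T) 0 0.
Proof. by rewrite mxE; apply: eq_bigr => j _; rewrite [in RHS]mxE mulrC. Qed.

Lemma norm_sum_gt0 k (a : 'rV[R]_k) : a != 0 -> 0 < \sum_j `|a 0 j|.
Proof.
apply: contraNT; rewrite -leNgt => H; apply/eqP/rowP => j; rewrite mxE.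
apply/normr0_eq0/eqP; rewrite eq_le normr_ge0 andbT (le_trans _ H)//.
by rewrite (bigD1 j)//= lerDl sumr_ge0.
Qed.

Lemma norm_sumZ k (x : R) (a : 'rV[R]_k) : \sum_j `|(x *: a) 0 j| = `|x| * \sum_j `|a 0 j|.
Proof. by rewrite mulr_sumr; apply: eq_bigr => j _; rewrite mxE normrM. Qed.

Lemma dot_row_mx k l (P : 'rV[R]_(k + l)) a b :
  dot P (row_mx a b) = dot (lsubmx P) a + dot (rsubmx P) b.
Proof.
rewrite /dot big_split_ord/=; congr (_ + _); apply: eq_bigr => i _.
  by rewrite row_mxEl mxE.
by rewrite row_mxEr mxE.
Qed.

Lemma not_row_full_annihilator q k (M : 'M[R]_(q, k)) : ~~ row_full M ->
  exists2 b : 'rV[R]_k, b != 0 & M *m b^T = 0.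
Proof.
rewrite (_ : row_full M = row_free M^T) /row_free ?mxrank_tr// -mxrank_tr -/(row_free M^T) -kermx_eq0 => /rowV0Pn[b /sub_kermxP bM b0].
by exists b => //; rewrite -[M]trmxK -trmx_mul bM trmx0.
Qed.

Section Rule.
Variables (n p d : nat) (K : set 'rV[R]_n) (A : 'M[R]_(n, p.+1)) (B : 'M[R]_(n, d)).
Variables (c : 'rV[R]_p.+1) (e : 'rV[R]_d).
Hypothesis K0 : K 0.
Hypothesis KD : forall y y', K y -> K y' -> K (y + y').
Hypothesis KZ : forall x y, 0 <= x -> K y -> K (x *: y).

Let mult_exists := exists (a : 'rV[R]_p.+1) (b : 'rV[R]_d),
  [/\ \sum_i `|a 0 i| + \sum_j `|b 0 j| = 1, forall i, 0 <= a 0 i,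
      forall y, K y -> 0 <= dot a (y *m A) + dot b (y *m B) & 0 <= dot a c + dot b e].

Lemma normalize_multiplier (a : 'rV[R]_p.+1) (b : 'rV[R]_d) :
  0 < \sum_i `|a 0 i| + \sum_j `|b 0 j| -> (forall i, 0 <= a 0 i) ->
  (forall y, K y -> 0 <= dot a (y *m A) + dot b (y *m B)) -> 0 <= dot a c + dot b e ->
  mult_exists.
Proof.
set N := _ + _ => N0 a0 ab0 g0; have i0 : 0 <= N^-1 by rewrite invr_ge0 ltW.
exists (N^-1 *: a), (N^-1 *: b); split.
- by rewrite !norm_sumZ (ger0_norm i0) -mulrDr mulVf// gt_eqF.
- by move=> i; rewrite mxE mulr_ge0.
- by move=> y Ky; rewrite !dotZl -mulrDr mulr_ge0// ab0.
- by rewrite !dotZl -mulrDr mulr_ge0.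
Qed.

Lemma degenerate_multiplier (b : 'rV[R]_d) : b != 0 ->
  (forall y, K y -> dot b (y *m B) = 0) -> mult_exists.
Proof.
move=> b0 bK; have N0 := norm_sum_gt0 b0.
have [g0|/ltW g0] := leP 0 (dot b e).
  apply: (@normalize_multiplier 0 b) => [|i|y Ky|].
  - by rewrite ltr_wpDl// sumr_ge0.
  - by rewrite mxE.
  - by rewrite bK// addr0 dotC dot0r.
  - by rewrite dotC dot0r add0r.
apply: (@normalize_multiplier 0 (- b)) => [|i|y Ky|].
- rewrite ltr_wpDl ?sumr_ge0//.
  by rewrite (eq_bigr (fun j => `|b 0 j|))// => j _; rewrite mxE normrN.
- by rewrite mxE.
- by rewrite -scaleN1r dotZl bK// mulr0 addr0 dotC dot0r.
- by rewrite dotC dot0r add0r -scaleN1r dotZl mulN1r oppr_ge0.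
Qed.

(** The parameters [t], [x] and the slack [s] of the cone are strictly positive. So if 0 lies in it,
    dividing by [t] gives strict inequalities for the [phi] part and a positive coefficient [th] on
    every [ys l]. If 0 does not lie in it, separation applies with no closure argument. *)
Lemma multiplier_rule : mult_exists \/
  exists q (ys : 'I_q -> 'rV[R]_n) y c0 th, [/\ forall l, K (ys l), K y, 0 <= c0, 0 < th &
    [/\ row_full (\matrix_l (ys l *m B)),
        forall i, (c + (c0 *: y + th *: \sum_l ys l) *m A) 0 i < 0 &
        e + (c0 *: y + th *: \sum_l ys l) *m B = 0]].
Proof.
have [q [M [MS Mspan]]] := spanning_rows [set s | exists2 y, K y & s = y *m B].
have /choice[ys Hys] : forall l, exists y, K y /\ row l M = y *m B.
  by move=> l; have [y Ky ->] := MS l; exists y.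
have ME : M = \matrix_l (ys l *m B).
  by apply/row_matrixP => l; rewrite rowK (Hys l).2.
have [Mf|Mf] := boolP (row_full M); last first.
  left; have [b b0 Mb] := not_row_full_annihilator Mf.
  apply: (degenerate_multiplier b0) => y Ky.
  have /submxP[D ->] : (y *m B <= M)%MS by apply: Mspan; exists y.
  by rewrite dot_mulmx -mulmxA Mb mulmx0 mxE.
(* [Y0] contains every spanning vector once, so a positive multiple of it leaves room to vary each
   coefficient in both directions. *)
pose Y0 := \sum_l ys l.
have KY0 : K Y0 by apply: big_ind => // l _; case: (Hys l).
pose P y : 'rV[R]_(p.+1 + d) := row_mx (y *m A) (y *m B).
have PD y y' : P (y + y') = P y + P y' by rewrite /P !mulmxDl -add_row_mx.
have PZ x y : P (x *: y) = x *: P y by rewrite /P -!scalemxAl -scale_row_mx.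
pose S : set 'rV[R]_(p.+1 + d) := [set w | exists (t x : R) (y : 'rV[R]_n) (s : 'rV[R]_p.+1), [/\ 0 < t, 0 < x, K y,
  forall i, 0 < s 0 i & w = t *: row_mx c e + P (y + x *: Y0) + row_mx s 0]].
have SD w w' : S w -> S w' -> S (w + w').
  move=> [t [x [y [s [t0 x0 Ky s0 ->]]]]] [t' [x' [y' [s' [t'0 x'0 Ky' s'0 ->]]]]].
  exists (t + t'), (x + x'), (y + y'), (s + s'); split; rewrite ?addr_gt0//.
  - exact: KD.
  - by move=> i; rewrite mxE addr_gt0.
  - have -> : row_mx (s + s') (0 : 'rV[R]_d) = row_mx s 0 + row_mx s' 0.
      by rewrite add_row_mx addr0.
    have -> : y + y' + (x + x') *: Y0 = (y + x *: Y0) + (y' + x' *: Y0).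
      by rewrite scalerDl addrACA.
    by rewrite (PD (y + x *: Y0)) scalerDl addrACA [X in X + _ = _]addrACA.
have SZ x' w : 0 < x' -> S w -> S (x' *: w).
  move=> x'0 [t [x [y [s [t0 x0 Ky s0 ->]]]]].
  exists (x' * t), (x' * x), (x' *: y), (x' *: s); split; rewrite ?mulr_gt0//.
  - by apply: KZ => //; exact: ltW.
  - by move=> i; rewrite mxE mulr_gt0.
  - have -> : row_mx (x' *: s) (0 : 'rV[R]_d) = x' *: row_mx s 0 by rewrite scale_row_mx scaler0.
    have -> : x' *: y + (x' * x) *: Y0 = x' *: (y + x *: Y0) by rewrite scalerDr scalerA.
    by rewrite (PZ x') scalerDr (scalerDr x' (t *: _)) scalerA.
have [[t [x [y [s [t0 x0 Ky s0 S0]]]]]|nS0] := pselect (S 0); [right|left].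
  have ti0 : 0 <= t^-1 by rewrite invr_ge0 ltW.
  exists q, ys, y, t^-1, (x / t); split=> //; first by move=> l; case: (Hys l).
    by rewrite divr_gt0.
  have E k (N : 'M[R]_(n, k)) : (t^-1 *: y + (x / t) *: Y0) *m N = t^-1 *: ((y + x *: Y0) *m N).
    by rewrite scalemxAl scalerDr scalerA [x / t]mulrC.
  have := S0; rewrite scale_row_mx /P !add_row_mx addr0 -[in LHS]row_mx0 => /eq_row_mx[Sc Se].
  have tt w : w = t^-1 *: (t *: w) :> 'rV[R]_p.+1 by rewrite scalerA mulVf ?scale1r// gt_eqF.
  have tt' w : w = t^-1 *: (t *: w) :> 'rV[R]_d by rewrite scalerA mulVf ?scale1r// gt_eqF.
  split=> [|i|]; first by rewrite -ME.
  - rewrite E [c]tt -scalerDr mxE pmulr_rlt0 ?invr_gt0//.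
    have /rowP/(_ i) := Sc; rewrite mxE [in RHS]mxE => h.
    rewrite -(ltrD2r (s 0 i)) add0r -h; exact: s0.
  - by rewrite E [e]tt' -scalerDr -Se scaler0.
have [Q Q0 QS] : exists2 Q : 'rV[R]_(p.+1 + d), Q != 0 & forall w, S w -> 0 <= dot Q w.
  exact: (@cone_separation R (p + d) S SD SZ nS0).
pose a := lsubmx Q; pose b := rsubmx Q.
have Qdot t x y (s : 'rV[R]_p.+1) : 0 < t -> 0 < x -> K y -> (forall i, 0 < s 0 i) ->
    0 <= t * (dot a c + dot b e) + (dot a (y *m A) + dot b (y *m B)) +
         x * (dot a (Y0 *m A) + dot b (Y0 *m B)) + dot a s.
  move=> t0 x0 Ky s0; have : 0 <= dot Q (t *: row_mx c e + P (y + x *: Y0) + row_mx s 0).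
    by apply: QS; exists t, x, y, s.
  by rewrite PD PZ !(dotDr, dotZr) !dot_row_mx dot0r addr0 addrA.
have dota_cst (x : R) : dot a (const_mx x) = x * dot a (const_mx 1).
  by rewrite -dotZr; congr (dot _ _); apply/rowP => i; rewrite !mxE mulr1.
set g := dot a c + dot b e; set h := dot a (Y0 *m A) + dot b (Y0 *m B).
have cst0 x i : 0 < x -> 0 < (const_mx x : 'rV[R]_p.+1) 0 i by rewrite mxE.
(* Each inequality below arises from a choice in [Qdot] in which the positive parameters that do not
   concern it equal a small [x], and from letting [x] tend to 0. *)
apply: (@normalize_multiplier a b) => [|i|y Ky|].
- have : row_mx a b != 0 by rewrite hsubmxK.
  apply: contraNT; rewrite -leNgt => H.
  have sa : 0 <= \sum_i `|a 0 i| by exact: sumr_ge0.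
  have sb : 0 <= \sum_j `|b 0 j| by exact: sumr_ge0.
  have [a0|a0] := eqVneq a 0; last first.
    by have := norm_sum_gt0 a0; rewrite ltNge (le_trans _ H)// lerDl.
  have [b0|b0] := eqVneq b 0; last first.
    by have := norm_sum_gt0 b0; rewrite ltNge (le_trans _ H)// lerDr.
  by rewrite a0 b0 row_mx0.
- apply: (@ge0_lim _ _ (g + h + dot a (const_mx 1))) => x x0.
  have := Qdot x x 0 (const_mx x + delta_mx 0 i) x0 x0 K0.
  rewrite dotDr dota_cst dot_deltar !mul0mx !dot0r -/g -/h => H.
  rewrite (le_trans (H _))//; last by rewrite le_eqVlt; apply/orP; left; apply/eqP; ring.
  by move=> k; rewrite !mxE ltr_pwDl// ler0n.
- apply: (@ge0_lim _ _ (g + h + dot a (const_mx 1))) => x x0.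
  have := Qdot x x y (const_mx x) x0 x0 Ky (fun k => cst0 x k x0).
  rewrite dota_cst -/g -/h => H.
  by rewrite (le_trans H)// le_eqVlt; apply/orP; left; apply/eqP; ring.
- apply: (@ge0_lim _ _ (h + dot a (const_mx 1))) => x x0.
  have := Qdot 1 x 0 (const_mx x) ltr01 x0 K0 (fun k => cst0 x k x0).
  rewrite dota_cst !mul0mx !dot0r -/g -/h => H.
  by rewrite (le_trans H)// le_eqVlt; apply/orP; left; apply/eqP; ring.
Qed.

End Rule.

End MultiplierRule.

Lemma admissible_arith {R : realType} (A B c x y : R) :
  - A <= x -> - B <= y -> A + B <= c -> 0 <= c + (x + y).
Proof. by move=> *; lra. Qed.

Lemma endpoint_vec {R : realType} {n : nat} (x q z h y s : 'rV[R]_n) (e d : R) :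
  x - q - e *: z - d *: (h + y + s) = x - q - (e *: z + d *: (y + s)) - d *: h.
Proof. by apply/rowP => j; rewrite !mxE; ring. Qed.

(** * Realizing second-order variations by controls, and the resulting alternative *)

Section Alternative.
Context {R : realType} {n m : nat} (T : R).
Local Notation leb := (@lebesgue_measure R).
Local Notation I0T := (`[0, T]%classic : set R).
Local Notation E k := (delta_mx 0 k : 'rV[R]_n).
Variables (f0 : 'rV[R]_n -> 'rV[R]_n) (f : 'I_m -> 'rV[R]_n -> 'rV[R]_n).
Local Notation F := (Fx f0 f).
Hypothesis HF : forall i, is_C2 (F i).
Hypothesis T0 : 0 < T.
Variables (xh : R -> 'rV[R]_n) (uc : R -> 'rV[R]_m) (C rho Mu : R).
Local Notation U := (fun t => vext 1 (uc t)).
Hypothesis buc : bm T uc.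
Hypothesis uc0 : forall t i, I0T t -> 0 <= uc t 0 i.
Hypothesis dxh : is_deriv T xh (fun t => G F (xh t) (U t)).
Hypothesis C1 : 1 <= C.
Hypothesis GB : Gbounds F rho C.
Hypothesis xhB : forall t, I0T t -> `|xh t| + 1 <= rho.
Hypothesis Mu0 : 0 <= Mu.
Hypothesis UB : forall t, I0T t -> `|U t| <= Mu.
Variable Psi : 'I_n -> R -> 'rV[R]_n.
Hypothesis PsiS : forall j, adj_sol T (Amx F xh U) (Psi j).
Hypothesis PsiT : forall j, Psi j T = E j.
Variable BP : R.
Hypothesis BP0 : 0 <= BP.
Hypothesis PsiB : forall j t, I0T t -> `|Psi j t| <= BP.
Local Notation Yr := (Yr T f0 f xh Psi).
Variables (z : R -> 'rV[R]_n) (v : R -> 'rV[R]_m).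
Hypothesis iv : ig T v.
Hypothesis v0 : forall t i, I0T t -> uc t 0 i = 0 -> v t 0 i = 0.
Hypothesis dz : is_deriv T z (fun t => DG F (xh t) (U t) (z t) + G F (xh t) (vext 0 (v t))).
Hypothesis z0 : z 0 = 0.
Local Notation qv := (Y T Psi (fun t => Q2 F xh U z (fun t => vext 0 (v t)) t)).

Let T0' : 0 <= T. Proof. exact: ltW. Qed.

Let bU : bm T U. Proof. exact: bm_vext. Qed.

Let ivx : forall i, integ T (fun t => vext 0 (v t) 0 i). Proof. exact: integ_vext. Qed.

Lemma Yr_v : Yr v = z T.
Proof. exact: esym (Y_sol HF T0 bU dxh PsiS PsiT dz z0 (fun t _ => erefl)). Qed.

Lemma bm_bound k (r : R -> 'rV[R]_k) : bm T r ->
  exists2 B, 0 <= B & forall t, I0T t -> `|r t| <= B.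
Proof.
move=> br; have /choice[Ms HM] : forall i, exists M, forall t, I0T t -> `|r t 0 i| <= M.
  by move=> i; have [_] := br i.
have S0 : 0 <= \sum_i `|Ms i| by apply: sumr_ge0.
exists (\sum_i `|Ms i|) => // t tT; apply: rV_norm_le => // i.
rewrite (le_trans (HM i t tT))// (le_trans (ler_norm _))// (bigD1 i)//= lerDl.
exact: sumr_ge0.
Qed.

(** Endpoints of admissible controls near the reference one, before any endpoint constraint; the
    constraints are met afterwards through [local_solve]. *)
Definition Reach eps (x : 'rV[R]_n) := exists u xt,
  [/\ bm T u, forall t i, I0T t -> 0 <= u t 0 i,
      forall t, I0T t -> `|u t - uc t| <= eps,
      sol T F xh (fun t => vext 1 (u t)) xt &
      (forall t, I0T t -> `|xt t - xh t| <= eps) /\ xt T = x].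

Section Family.
Variables (q : nat) (rs : 'I_q -> R -> 'rV[R]_m) (r : R -> 'rV[R]_m) (c0 th : R).
Hypothesis Rrs : forall l, Rcone T uc (rs l).
Hypothesis Rr : Rcone T uc r.
Hypothesis c00 : 0 <= c0.
Hypothesis th0 : 0 < th.
Implicit Types (a : 'rV[R]_q).

(** For [|a| <= th] the coefficients [th + a_l] are nonnegative, so the variation stays in the cone
    although the [a_l] take both signs. *)
Definition ra a t := c0 *: r t + \sum_l (th + a 0 l) *: rs l t.
Let y0 := c0 *: Yr r + th *: \sum_l Yr (rs l).

Lemma ra_bm a : bm T (ra a).
Proof.
apply: bmD; first by apply: bmZ; case: Rr.
have D b : bm T (fun t => \sum_l b l *: rs l t).
  move=> i; apply: (@bmeas_ext _ _ (fun t => \sum_l b l * rs l t 0 i)).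
    by move=> t _; rewrite summxE; apply: eq_bigr => l _; rewrite mxE.
  by apply: bmeas_sum => l; apply: bmeasM; [exact: bmeas_cst|case: (Rrs l) => b' _; exact: b'].
exact: (D (fun l => th + a 0 l)).
Qed.

Let irs l : ig T (rs l). Proof. by apply: bm_ig; case: (Rrs l). Qed.

Let ir : ig T r. Proof. by apply: bm_ig; case: Rr. Qed.

Lemma Yr_ra a : Yr (ra a) = y0 + \sum_l a 0 l *: Yr (rs l).
Proof.
have [i1 E1] := Yr_lincomb HF T0 dxh PsiS (fun l => th + a 0 l) irs.
have i2 := igZ c0 ir.
rewrite /ra (YrD HF T0 dxh PsiS i2 i1) E1 (YrZ HF T0 dxh PsiS c0 ir) /y0 -addrA; congr (_ + _).
rewrite scaler_sumr -big_split; apply: eq_bigr => l _.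
exact: scalerDl.
Qed.

Lemma ra_sub a a' t : ra a t - ra a' t = \sum_l (a - a') 0 l *: rs l t.
Proof.
rewrite /ra opprD addrACA subrr add0r -sumrB; apply: eq_bigr => l _.
by rewrite -scalerBl !mxE opprD addrACA subrr add0r.
Qed.

Lemma Yr_ra_sub a a' : Yr (fun t => ra a t - ra a' t) = \sum_l (a - a') 0 l *: Yr (rs l).
Proof.
have [_ <-] := Yr_lincomb HF T0 dxh PsiS (fun l => (a - a') 0 l) irs.
by congr (Yr _); apply/funext => t; exact: ra_sub.
Qed.

(** The constants are uniform over the ball of the [a], because the step [e] is fixed before the
    contraction selects [a]. *)
Lemma ra_unif : exists K Rr' L, [/\ 0 <= K, 0 <= Rr' & 0 <= L] /\ [/\
  (forall a t i, `|a| <= th -> I0T t -> - (K * uc t 0 i) <= ra a t 0 i),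
  (forall a t, `|a| <= th -> I0T t -> `|ra a t| <= Rr') &
  (forall a a' t, I0T t -> `|ra a t - ra a' t| <= L * `|a - a'|)].
Proof.
have [br [Kr Kr0 HKr]] := Rr.
have [Br Br0 HBr] := bm_bound br.
have /choice[Ks HKs] : forall l, exists K, 0 <= K /\ forall t i, I0T t -> - (K * uc t 0 i) <= rs l t 0 i.
  by move=> l; have [_ [K K0 HK]] := Rrs l; exists K.
have /choice[Bs HBs] : forall l, exists B, 0 <= B /\ forall t, I0T t -> `|rs l t| <= B.
  by move=> l; have [bl _] := Rrs l; have [B B0 HB] := bm_bound bl; exists B.
have tha a l : `|a| <= th -> 0 <= th + a 0 l <= 2 * th.
  move=> ath; have := le_trans (rV_norm_ge a l) ath; rewrite ler_norml => /andP[h1 h2].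
  by apply/andP; split; lra.
have th20 : 0 <= 2 * th by rewrite mulr_ge0// ltW.
exists (c0 * Kr + \sum_l (2 * th) * Ks l), (c0 * Br + \sum_l (2 * th) * Bs l), (\sum_l Bs l); split; split.
- by rewrite addr_ge0 ?mulr_ge0// sumr_ge0// => l _; rewrite mulr_ge0//; case: (HKs l).
- by rewrite addr_ge0 ?mulr_ge0// sumr_ge0// => l _; rewrite mulr_ge0//; case: (HBs l).
- by rewrite sumr_ge0// => l _; case: (HBs l).
- move=> a t i ath tT; rewrite mulrDl opprD mxE mulr_suml -sumrN summxE mxE; apply: lerD.
    by rewrite -mulrA -mulrN ler_wpM2l// HKr.
  apply: ler_sum => l _; rewrite mxE; have [K0 HK] := HKs l; have /andP[a1 a2] := tha a l ath.
  apply: (@le_trans _ _ ((th + a 0 l) * (- (Ks l * uc t 0 i)))); last by rewrite ler_wpM2l// HK.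
  by rewrite mulrN lerN2 -[leRHS]mulrA ler_wpM2r// mulr_ge0// uc0.
- move=> a t ath tT; rewrite (le_trans (ler_normD _ _))// lerD//.
    by rewrite normrZ ger0_norm// ler_wpM2l// HBr.
  rewrite (le_trans (ler_norm_sum _ _ _))//; apply: ler_sum => l _.
  have [B0 HB] := HBs l; have /andP[a1 a2] := tha a l ath.
  by rewrite normrZ ger0_norm// ler_pM// HB.
- move=> a a' t tT; rewrite ra_sub (le_trans (ler_norm_sum _ _ _))// mulr_suml.
  apply: ler_sum => l _; rewrite normrZ mulrC; have [B0 HB] := HBs l.
  by rewrite ler_pM// ?HB// rV_norm_ge.
Qed.

Lemma vext_add (e : R) (w s : 'rV[R]_m) t :
  U t + (e *: vext 0 w + e ^+ 2 *: vext 0 s) = vext 1 (uc t + (e *: w + e ^+ 2 *: s)).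
Proof. by rewrite -!vext0Z -!vextD !addr0. Qed.

Lemma Y_two (e : R) w s : ig T w -> ig T s ->
  Y T Psi (fun t => G F (xh t) (e *: vext 0 (w t) + e ^+ 2 *: vext 0 (s t))) =
  e *: Yr w + e ^+ 2 *: Yr s.
Proof.
move=> iw is_.
rewrite -(YrZ HF T0 dxh PsiS _ iw) -(YrZ HF T0 dxh PsiS _ is_).
rewrite -(YrD HF T0 dxh PsiS (igZ _ iw) (igZ _ is_)).
apply: Y_ext => t _; congr (G _ _ _).
by rewrite -!vext0Z -!vextD !addr0.
Qed.

(** Provides the hypothesis of [local_solve]. The exact equality [Yr w = z T] from [density] is
    decisive: a first-order error, divided by [e^2], would not be small. *)
Lemma family eps : 0 < eps -> exists2 C3, 0 <= C3 &
  forall k, 0 < k <= 1 -> exists2 W : R, 0 <= W & forall k2, 0 < k2 ->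
     exists2 e0, 0 < e0 & forall e, 0 < e <= e0 -> exists X : 'rV[R]_q -> 'rV[R]_n,
      (forall a, `|a| <= th -> Reach eps (X a) /\
         `|X a - xh T - e *: z T - e ^+ 2 *: (qv + y0 + \sum_l a 0 l *: Yr (rs l))| <= C3 * (k * e ^+ 2)) /\
      (forall a a', `|a| <= th -> `|a'| <= th ->
         `|X a - X a' - e ^+ 2 *: \sum_l (a - a') 0 l *: Yr (rs l)| <= k2 * (e ^+ 2 * `|a - a'|)).
Proof.
move=> eps0.
have [C3 C30 Hexp] := endpoint_expansion HF T0 bU dxh C1 GB xhB Mu0 UB PsiS PsiT BP0 PsiB ivx dz z0.
exists C3 => // k k01.
have [k0 _] := andP k01.
have [w [Dw wv Yw]] := density HF T0 buc uc0 dxh C1 GB xhB PsiS BP0 PsiB iv v0 k0.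
have [bw [Kw Kw0 HKw]] := Dw.
have [W W0 HW] := bm_bound bw.
have [K [Rb [L [[K0 Rb0 L0] [HK HR HL]]]]] := ra_unif.
exists W => // k2 k20.
(* [endpoint_strict] measures [r - r'] uniformly, and here this is at most [L |a - a'|]; the
   tolerance is divided accordingly. *)
have kL0 : 0 < k2 / (L + 1) by rewrite divr_gt0// ltr_wpDl.
have [e1 e10 He1] := Hexp k W Rb k01 W0 Rb0.
have [e2 e20 He2] := endpoint_strict HF T0 bU dxh C1 GB xhB Mu0 UB PsiS PsiT BP0 PsiB W0 Rb0 kL0.
have WR0 : 0 <= W + Rb by exact: addr_ge0.
have me0 : 0 < Num.min 1 eps by rewrite lt_min ltr01.
have g0 : 0 <= grc T C Mu by rewrite mulr_ge0// expR_ge0.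
have gC0 : 0 <= grc T C Mu * C * T * (W + Rb).
  by rewrite !mulr_ge0// (le_trans ler01).
have [e3 /andP[e30 e31] He3] := small_eps WR0 me0.
have [e4 /andP[e40 _] He4] := small_eps gC0 me0.
(* The condition [e (Kw + K) <= 1], together with [e^2 <= e], keeps the perturbed control
   nonnegative. *)
have [e5 /andP[e50 _] He5] := small_eps (addr_ge0 Kw0 K0) ltr01.
exists (Num.min (Num.min e1 e2) (Num.min e3 (Num.min e4 e5))).
  by rewrite !lt_min e10 e20 e30 e40 e50.
move=> e /andP[e0]; rewrite !le_min => /andP[/andP[ee1 ee2] /andP[ee3 /andP[ee4 ee5]]].
have ele1 := le_trans ee3 e31.
have eg0 := ltW e0.
have e2e : e ^+ 2 <= e by rewrite expr2 ger_pMr.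
have := He3 e; rewrite e0 ee3 => /(_ isT); rewrite le_min => /andP[s1 seps].
have := He4 e; rewrite e0 ee4 => /(_ isT); rewrite le_min => /andP[gs1 gseps].
have := He5 e; rewrite e0 ee5 => /(_ isT) eK.
pose u a t := uc t + (e *: w t + e ^+ 2 *: ra a t).
have bu a : bm T (u a).
  by apply: bmD => //; apply: bmD; apply: bmZ => //; exact: ra_bm.
have du a t : `|a| <= th -> I0T t -> `|e *: w t + e ^+ 2 *: ra a t| <= e * (W + Rb).
  move=> ath tT; rewrite (le_trans (ler_normD _ _))// mulrDr lerD//.
    by rewrite normrZ (ger0_norm eg0) ler_wpM2l// HW.
  by rewrite normrZ ger0_norm ?sqr_ge0// ler_pM// ?sqr_ge0// HR.
have dU a t : `|a| <= th -> I0T t -> `|vext 1 (u a t) - U t| <= e * (W + Rb).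
  move=> ath tT; rewrite /u -vext_add addrC addKr -!vext0Z -vextD addr0.
  exact: (le_trans (vext0_norm _)) (du a t ath tT).
have es0 : 0 <= e * (W + Rb) by exact: mulr_ge0.
have s01 : 0 <= e * (W + Rb) <= 1 by rewrite es0 s1.
have gs : grc T C Mu * (C * (e * (W + Rb)) * T) <= 1.
  by apply: le_trans gs1; rewrite le_eqVlt; apply/orP; left; apply/eqP; ring.
(* Trajectories are chosen for all [a] at once; outside the ball [xh] serves as a default value. *)
have Hsol a : exists x, `|a| <= th -> sol T F xh (fun t => vext 1 (u a t)) x.
  have [ath|ath] := boolP (`|a| <= th); last by exists xh.
  have [x Hx] := sol_exists HF T0 dxh C1 GB xhB Mu0 UB (bm_vext 1 (bu a)) s01
    (fun t => @dU a t ath) gs.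
  by exists x.
have [xs Hxs] := choice Hsol.
exists (fun a => xs a T).
have solE a : (fun t => vext 1 (u a t)) = fun t => U t + (e *: vext 0 (w t) + e ^+ 2 *: vext 0 (ra a t)).
  by apply/funext => t; rewrite vext_add.
have bwx := bm_vext 0 bw.
have brx a : bm T (fun t => vext 0 (ra a t)) by exact/bm_vext/ra_bm.
have WX t : I0T t -> `|vext 0 (w t)| <= W by move=> tT; exact: (le_trans (vext0_norm _)) (HW t tT).
have RX a t : `|a| <= th -> I0T t -> `|vext 0 (ra a t)| <= Rb.
  by move=> ath tT; exact: (le_trans (vext0_norm _)) (HR a t ath tT).
have iw := bm_ig bw.
have ira a := bm_ig (ra_bm a).
split=> [a ath|a a' ath a'th].
  have Sa := Hxs a ath; split.
    exists (u a), (xs a); split => // [t i tT|t tT|].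
    - rewrite 3!mxE.
      have h2 := HK a t i ath tT.
      have h3 := uc0 i tT.
      have h4 : - (Kw * uc t 0 i) <= w t 0 i by have := HKw t i tT; rewrite ler_norml => /andP[].
      have h5 : - (e * (Kw * uc t 0 i)) <= e * w t 0 i by rewrite -mulrN ler_wpM2l.
      have h6 : - (e * (K * uc t 0 i)) <= e ^+ 2 * ra a t 0 i.
        apply: (@le_trans _ _ (e ^+ 2 * - (K * uc t 0 i))); last by rewrite ler_wpM2l// sqr_ge0.
        by rewrite mulrN lerN2 ler_wpM2r// mulr_ge0.
      have h7 : e * (Kw * uc t 0 i) + e * (K * uc t 0 i) <= uc t 0 i.
        by rewrite -mulrDr -mulrDl mulrA ler_piMl.
      rewrite [X in _ + (_ + X)]mxE.
      exact: admissible_arith h5 h6 h7.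
    - by rewrite /u addrC addKr (le_trans (du a t ath tT)).
    - split=> // t tT; apply: le_trans gseps.
      have := sol_lip T0 C1 GB xhB Mu0 UB Sa (sol_xh dxh) es0
        (fun t tT => le_trans (dU a t ath tT) s1) (fun t tT => dU a t ath tT) tT.
      by move=> h; rewrite (le_trans h)// le_eqVlt; apply/orP; left; apply/eqP; ring.
  have := He1 e _ _ (xs a) _ bwx (brx a) WX (fun t => RX a t ath) _ _.
  rewrite e0 ee1 -solE => /(_ isT) /(_ _ Sa).
  have wvx : \int[leb]_(t in `[0, T]) `|vext 0 (w t) - vext 0 (v t)| <= k.
    apply: le_trans wv; apply: le_Rintegral => //.
    - rewrite (_ : (fun t => _) = fun t => `|vext 0 (w t - v t)|); last first.
        by apply/funext => t; rewrite vext0B.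
      exact: (integ_vnorm (integ_vext 0 (igB iw iv))).
    - exact: (integ_vnorm (igB iw iv)).
    - by move=> t _; rewrite -vext0B; exact: vext0_norm.
  move=> /(_ wvx); rewrite Y_two// Yw Yr_v Yr_ra => h.
  rewrite (le_trans _ h)// le_eqVlt; apply/orP; left; apply/eqP; congr `|_|.
  exact: endpoint_vec.
have nu0 : 0 <= L * `|a - a'| by exact: mulr_ge0.
have rlip t : I0T t -> `|vext 0 (ra a t) - vext 0 (ra a' t)| <= L * `|a - a'|.
  by move=> tT; rewrite -vext0B; exact: (le_trans (vext0_norm _)) (HL a a' t tT).
have Sa := Hxs a ath; have Sa' := Hxs a' a'th.
rewrite solE in Sa; rewrite solE in Sa'.
have e02 : 0 < e <= e2 by rewrite e0 ee2.
have := He2 e _ _ _ _ _ _ e02 nu0 bwx (brx a) (brx a') WX (fun t => RX a t ath)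
  (fun t => RX a' t a'th) rlip Sa Sa'.
rewrite (@Y_ext _ _ _ _ _ (fun t => G F (xh t) (vext 0 (ra a t - ra a' t)))); last first.
  by move=> t _; rewrite vext0B.
rewrite -/(Yr _) Yr_ra_sub => h; rewrite (le_trans h)//.
apply: (@le_trans _ _ (k2 / (L + 1) * (L + 1) * (e ^+ 2 * `|a - a'|))).
  rewrite -[leRHS]mulrA; apply: ler_wpM2l; first exact: ltW.
  by rewrite [leLHS]mulrCA ler_wpM2r ?mulr_ge0 ?sqr_ge0// lerDl.
by rewrite divfK// gt_eqF// ltr_wpDl.
Qed.

End Family.

Section Problem.
Variables (dphi deta : nat) (phi : 'I_dphi.+1 -> 'rV[R]_n -> R) (eta : 'I_deta -> 'rV[R]_n -> R).
Hypothesis Tphi : forall i, twice_diff (phi i).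
Hypothesis Teta : forall j, twice_diff (eta j).
Hypothesis phi0 : forall i, phi i (xh T) = 0.
Hypothesis eta0 : forall j, eta j (xh T) = 0.
Hypothesis zphi : forall i, 'D_(z T) (phi i) (xh T) <= 0.
Hypothesis zeta : forall j, 'D_(z T) (eta j) (xh T) = 0.

Definition dmx k (g : 'I_k -> 'rV[R]_n -> R) : 'M[R]_(n, k) := \matrix_(l, i) 'D_(E l) (g i) (xh T).

Lemma mul_dmx k (g : 'I_k -> 'rV[R]_n -> R) h i : differentiable (g i) (xh T) ->
  (h *m dmx g) 0 i = 'D_h (g i) (xh T).
Proof.
move=> dg; rewrite (derive_basis h dg) mxE; apply: eq_bigr => l _.
by rewrite [X in _ * X]mxE.
Qed.

Definition curv (g : 'rV[R]_n -> R) : R :=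
  'D_qv g (xh T) + 2^-1 * 'D_(z T) ('D_(z T) g) (xh T).

Lemma alternative eps : 0 < eps ->
  (forall x, Reach eps x -> (forall i, phi i x < 0) -> (forall j, eta j x = 0) -> False) ->
  exists (a : 'I_dphi.+1 -> R) (b : 'I_deta -> R),
    [/\ \sum_i `|a i| + \sum_j `|b j| = 1, forall i, 0 <= a i,
        forall r, Rcone T uc r -> 0 <=
          \sum_i a i * 'D_(Yr r) (phi i) (xh T) + \sum_j b j * 'D_(Yr r) (eta j) (xh T) &
        0 <= \sum_i a i * curv (phi i) + \sum_j b j * curv (eta j)].
Proof.
move=> eps0 noimp.
pose K : set 'rV[R]_n := [set y | exists2 r, Rcone T uc r & y = Yr r].
have iR r : Rcone T uc r -> ig T r by case=> br _; exact: bm_ig.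
have KZ x y : 0 <= x -> K y -> K (x *: y).
  move=> x0 [r Rr ->]; exists (fun t => x *: r t); first exact: RconeZ.
  by rewrite (YrZ HF T0 dxh PsiS x (iR r Rr)).
have K0 : K 0.
  by rewrite -(scale0r (Yr (fun=> 0))); apply: KZ => //; exists (fun=> 0) => //; exact: Rcone0.
have KD y y' : K y -> K y' -> K (y + y').
  move=> [r Rr ->] [r' Rr' ->]; exists (fun t => r t + r' t); first exact: RconeD.
  by rewrite (YrD HF T0 dxh PsiS (iR r Rr) (iR r' Rr')).
have dphi_ i : differentiable (phi i) (xh T) by have [d1 _] := Tphi i; exact: d1.
have deta_ j : differentiable (eta j) (xh T) by have [d1 _] := Teta j; exact: d1.
pose c : 'rV[R]_dphi.+1 := \row_i curv (phi i).
pose e : 'rV[R]_deta := \row_j curv (eta j).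
have [[a [b [ab1 a0 abK ab0]]]|] := @multiplier_rule R n dphi deta K (dmx phi) (dmx eta) c e K0 KD KZ.
  exists (fun i => a 0 i), (fun j => b 0 j); split => //.
  - move=> r Rr; have := abK (Yr r); rewrite /dot => /(_ (ex_intro2 _ _ r Rr erefl)).
    rewrite (eq_bigr (fun i => a 0 i * 'D_(Yr r) (phi i) (xh T))); last first.
      by move=> i _; rewrite mul_dmx.
    rewrite [X in _ + X](eq_bigr (fun j => b 0 j * 'D_(Yr r) (eta j) (xh T)))//.
    by move=> j _; rewrite mul_dmx.
  - move: ab0; rewrite /dot (eq_bigr (fun i => a 0 i * curv (phi i))); last first.
      by move=> i _; rewrite [X in _ * X]mxE.
    rewrite [X in _ + X](eq_bigr (fun j => b 0 j * curv (eta j)))//.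
    by move=> j _; rewrite [X in _ * X]mxE.
move=> [q [ys [y [c0 [th [Kys [r Rr yE] c00 th0 [Mf cneg ezero]]]]]]].
have /choice[rs Hrs] : forall l, exists r, Rcone T uc r /\ ys l = Yr r.
  by move=> l; have [r' Rr' ->] := Kys l; exists r'.
have [C3 C30 fam] := family (fun l => (Hrs l).1) Rr c00 th0 eps0.
have ysE : ys = fun l => Yr (rs l) by apply/funext => l; exact: (Hrs l).2.
pose y0 := c0 *: Yr r + th *: \sum_l Yr (rs l).
have ZE : c0 *: y + th *: \sum_l ys l = y0 by rewrite ysE yE.
rewrite ZE in cneg ezero.
have [x [Rx px ex]] : exists x, [/\ Reach eps x, forall i, phi i x < 0 & forall j, eta j x = 0].
  apply: (@local_solve R n dphi.+1 deta q phi eta (xh T) (z T) qv y0 (fun l => Yr (rs l)) th C3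
    (Reach eps)) => //.
  - move=> i; rewrite (derive_add qv y0 (dphi_ i)).
    by have := cneg i; rewrite mxE (mul_dmx y0 (dphi_ i)) [X in X + _ < _]mxE /curv addrAC.
  - move=> j; rewrite (derive_add qv y0 (deta_ j)).
    have ej : e 0 j + 'D_y0 (eta j) (xh T) = 0.
      rewrite -(mul_dmx y0 (deta_ j)); have := congr1 (fun M : 'rV[R]_deta => M 0 j) ezero.
      by move=> h; rewrite mxE [RHS]mxE in h.
    by move: ej; rewrite [e 0 j]mxE /curv addrAC.
  - rewrite (_ : \matrix_(l, j) _ = \matrix_l (ys l *m dmx eta))//.
    by apply/matrixP => l j; rewrite [LHS]mxE [RHS]mxE mul_dmx// ysE.
by case: (noimp x Rx px ex).
Qed.

End Problem.

End Alternative.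

(** * Representatives with pointwise properties *)

Section Reduction.
Context {R : realType} {n m : nat} (T : R).
Local Notation leb := (@lebesgue_measure R).
Local Notation I0T := (`[0, T]%classic : set R).

Lemma essbounded_nonneg_repr (u : R -> 'rV[R]_m) : Linf_vec T u ->
  ae_on T (fun t => forall i, 0 <= u t 0 i) ->
  exists uc, [/\ bm T uc, forall t i, I0T t -> 0 <= uc t 0 i & ae_on T (fun t => u t = uc t)].
Proof.
move=> Lu u0.
have /choice[M HM] : forall i, exists M, ae_on T (fun t => `|u t 0 i| <= M).
  by move=> i; have [_] := Lu i.
pose uc t : 'rV[R]_m := \row_i Num.max 0 (Num.max (- `|M i|) (Num.min `|M i| (u t 0 i))).
exists uc; split.
- move=> i; under eq_fun do rewrite mxE.
  apply: bmeas_max; first exact: bmeas_cst.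
  by apply: bmeas_clip => //; [exact: bmeas_cst|have [] := Lu i].
- by move=> t i tT; rewrite mxE le_max lexx.
- apply: (ae_onS2 _ u0 (ae_on_forall HM)) => t tT ut0 utM; apply/rowP => i.
  have uM : u t 0 i <= `|M i| by rewrite (le_trans (ler_norm _))// (le_trans (utM i))// ler_norm.
  have uN : - `|M i| <= u t 0 i by rewrite (le_trans _ (ut0 i))// oppr_le0.
  by rewrite mxE (min_r uM) (max_r uN) (max_r (ut0 i)).
Qed.

Lemma L2_vanishing_repr (uc v : R -> 'rV[R]_m) : bm T uc -> L2_vec T v ->
  (forall i, ae_on T (fun t => uc t 0 i = 0 -> v t 0 i = 0)) ->
  exists vc, [/\ ig T vc, forall t i, I0T t -> uc t 0 i = 0 -> vc t 0 i = 0 &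
    ae_on T (fun t => v t = vc t)].
Proof.
move=> bu Lv v0.
pose vc t : 'rV[R]_m := \row_i (if uc t 0 i == 0 then 0 else v t 0 i).
exists vc; split.
- move=> i; have [mv iv2] := Lv i; have [mu _] := bu i.
  (* A square-integrable function on a bounded interval is integrable, since [|v| <= 1 + v^2]. *)
  apply: (@integ_le _ _ _ (fun t => 1 + v t 0 i ^+ 2)).
  + rewrite (_ : (fun t => vc t 0 i) = fun t => if uc t 0 i == 0 then 0 else v t 0 i); last first.
      by apply/funext => t; rewrite mxE.
    apply: measurable_fun_if => //.
    * by apply: measurable_fun_eqr => //; exact: measurable_cst.
    * by apply: measurable_funS mv => //; exact: subIsetl.
  + by apply: integD => //; exact: integ_cst.
  + move=> t tT; rewrite mxE; case: ifP => _; first by rewrite normr0 addr_ge0// sqr_ge0.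
    by rewrite -[leRHS]/(1 + _) -[v t 0 i ^+ 2]real_normK ?num_real//; nra.
- by move=> t i tT u0; rewrite mxE u0 eqxx.
- apply: (ae_onS _ (ae_on_forall v0)) => t tT vt; apply/rowP => i.
  by rewrite mxE; case: eqP => // /(vt i).
Qed.

End Reduction.

Theorem mainTheorem3 (R : realType) (n m : nat) (T : R) (x0 : 'rV[R]_n)
  (f0 : 'rV[R]_n -> 'rV[R]_n) (f : 'I_m -> 'rV[R]_n -> 'rV[R]_n)
  (dphi deta : nat) (phi : 'I_dphi.+1 -> 'rV[R]_n -> R)
  (eta : 'I_deta -> 'rV[R]_n -> R)
  (xh : R -> 'rV[R]_n) (uh : R -> 'rV[R]_m) :
  (0 < n)%N -> (0 < m)%N -> 0 < T ->
  is_C2 f0 -> (forall i, is_C2 (f i)) ->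
  (forall i, twice_diff (phi i)) -> (forall j, twice_diff (eta j)) ->
  feasible T x0 f0 f phi eta xh uh ->
  (forall i, phi i (xh T) = 0) ->
  Assumption1 T f0 f phi eta xh uh ->
  weak_min T x0 f0 f phi eta xh uh ->
  forall (z : R -> 'rV[R]_n) (v : R -> 'rV[R]_m),
    C2cone T f0 f phi eta xh uh z v ->
    exists lam : @mult R n dphi deta,
      in_Lambda T f0 f phi eta xh uh lam /\ 0 <= Omega T f0 f phi eta xh uh lam z v.
Proof.
move=> _ _ T0 C2f0 C2f Tphi Teta [Luh [[y [dx [Ly yE]]] [xh0 [uh0 [_ eta0]]]]] phi0 A1 wm z v.
move=> [[yz [dzy [_ yzE]]] [Lv [z0 [vI0 [zphi zeta]]]]].
have T0' := ltW T0.
have HF := Fx_C2 C2f0 C2f.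
have [uc [buc uc0 uhE]] := essbounded_nonneg_repr Luh uh0.
(* By Assumption 1 almost every zero of [uh_i] lies in [I0 i], where [v_i] vanishes; this is the
   condition under which clipping converges to [v]. *)
have v00 i : ae_on T (fun t => uc t 0 i = 0 -> v t 0 i = 0).
  have h := ae_onS2 (fun t _ (h1 : _ <-> _) h2 (u0 : uh t 0 i = 0) => h2 (h1.2 u0)) (A1 i) (vI0 i).
  by apply: (ae_onS2 _ h uhE) => t tT vt <-.
have [vc [ivc vc0 vE]] := L2_vanishing_repr buc Lv v00.
have cxh : contT T xh := @is_deriv_contT _ _ _ _ _ T0' dx.
have cz : contT T z := @is_deriv_contT _ _ _ _ _ T0' dzy.
have bU : bm T (fun t => vext 1 (uc t)) by exact: bm_vext.
have dynE t u : dyn f0 f (xh t) u = G (Fx f0 f) (xh t) (vext 1 u) by rewrite G_vext scale1r.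
have dxh : is_deriv T xh (fun t => G (Fx f0 f) (xh t) (vext 1 (uc t))).
  apply: (is_deriv_ae _ _ dx); first by apply: bm_ig; exact: bm_G.
  by apply: (ae_onS2 _ yE uhE) => t tT -> ->; exact: dynE.
have dz : is_deriv T z (fun t => DG (Fx f0 f) (xh t) (vext 1 (uc t)) (z t) +
    G (Fx f0 f) (xh t) (vext 0 (vc t))).
  apply: (is_deriv_ae _ _ dzy).
    apply: igD; first by apply: bm_ig; exact: bm_DG.
    by move=> j; apply: integ_G => //; exact: integ_vext.
  have yzE2 := ae_onS2 (fun t _ h1 h2 => conj h1 h2) yzE uhE.
  apply: (ae_onS2 _ yzE2 vE) => t tT [-> ut] vt.
  by rewrite DG_vext G_vext scale1r scale0r add0r /Aop /Bop ut vt.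
have [_ [Mx HMx]] := contT_bmeas (contT_norm cxh).
(* The margin 1 is the radius of the tube in [sol]. *)
pose rho := Mx + 1.
have xhB t : `[0, T]%classic t -> `|xh t| + 1 <= rho.
  by move=> tT; rewrite lerD2r; have := HMx t tT; rewrite normr_id.
have [C C1 GB] := G_bounds HF rho.
have [Mu Mu0 UB] := bm_bound bU.
have [Psi [PsiS PsiT]] := adj_fundamental (fun k l => @bAmx _ _ _ _ _ HF T0 _ _ bU dxh k l) T0.
have /choice[Bs HBs] : forall j, exists B, forall t, `[0, T]%classic t -> `|Psi j t| <= B.
  move=> j; have [_ [B HB]] := contT_bmeas (contT_norm (@is_deriv_contT _ _ _ _ _ T0' (PsiS j))).
  by exists B => t tT; have := HB t tT; rewrite normr_id.
pose BP := \sum_j `|Bs j|.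
have BP0 : 0 <= BP by exact: sumr_ge0.
have PsiB j t : `[0, T]%classic t -> `|Psi j t| <= BP.
  move=> tT; rewrite (le_trans (HBs j t tT))// (le_trans (ler_norm _))// /BP (bigD1 j)//= lerDl.
  exact: sumr_ge0.
have [eps [eps0 wmin]] := wm.
(* [Reach] gives non-strict bounds whereas weak minimality asks for strict ones, so half of [eps] is
   used. *)
have eps20 : 0 < eps / 2 by rewrite divr_gt0.
have epslt : eps / 2 < eps by rewrite ltr_pdivrMr// mulr_natr mulr2n ltrDl.
have noimp x : Reach T f0 f xh uc (eps / 2) x -> (forall i, phi i x < 0) ->
    (forall j, eta j x = 0) -> False.
  move=> [u [xt [bu u0 du [dxt xt0 _] [xtB <-]]]] px ex.
  have cxt : contT T xt := @is_deriv_contT _ _ _ _ _ T0' dxt.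
  (* Such an endpoint is feasible and has [phi_0] below 0, the value of [phi_0] at [xh T], against
     minimality. *)
  have := px ord0; rewrite ltNge => /negP; apply; rewrite -(phi0 ord0); apply: (wmin xt u).
  - split.
      by move=> i; have [mu [M HM]] := bu i; split => //; exists M; exact: ae_onW.
    split; [|split; [|split; [|split]]].
    + exists (fun t => G (Fx f0 f) (xt t) (vext 1 (u t))); split=> //; split.
        have bG := bm_G HF cxt (bm_vext 1 bu).
        by move=> i; have [mg [M HM]] := bG i; split => //; exists M; exact: ae_onW.
      by apply: ae_onW => t tT; rewrite G_vext scale1r.
    + by rewrite xt0.
    + by apply: ae_onW => t tT i; exact: u0.
    + by move=> i _; exact: ltW.
    + exact: ex.
  - by move=> t tT; exact: le_lt_trans (xtB t tT) epslt.
  - exists (eps / 2); split=> //; apply: (ae_onS _ uhE) => t tT ->; exact: du.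
have [a [b [ab1 a0 abR ab0]]] := alternative HF T0 buc uc0 dxh C1 GB xhB Mu0 UB PsiS PsiT BP0 PsiB
  ivc vc0 dz z0 Tphi Teta phi0 eta0 zphi zeta eps20 noimp.
exists (lam T xh Psi phi eta a b); split.
  apply: (lam_in_Lambda HF T0 buc uc0 uhE dxh PsiS PsiT ab1 a0) => r Rr.
  by rewrite (dot_grad T xh Tphi Teta); exact: abR.
have mv i : measurable_fun `[0, T]%classic (fun t => v t 0 i) by have [] := Lv i.
have mu i : measurable_fun `[0, T]%classic (fun t => uh t 0 i) by have [] := Luh i.
by rewrite (Omega_lam HF T0 buc uhE dxh PsiS Tphi Teta ivc dz vE mv mu).
Qed.
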